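(* Assume, in addition to the standing assumptions of the context, that $p_1$ is constant on each of the intervals $[0,\alpha)$ and $(\beta,l]$, that $p_2$ is constant on $(l,L]$, and that $a\in C(\alpha,\beta)$. Then the $C_0$-semigroup $e^{t\mathcal A_2}$ generated by $\mathcal A_2$ on $\mathcal H_2$ is polynomially stable; in particular there exists $M>0$ such that for all $(u^0,u^1)=((u_1^0,u_2^0),(u_1^1,u_2^1))\in\mathcal D(\mathcal A_2)$ and all $t\ge 0$, $$\|e^{t\mathcal A_2}(u^0,u^1)\|_{\mathcal H_2}\le\frac{M}{(1+t)^2}\,\|(u^0,u^1)\|_{\mathcal D(\mathcal A_2)} .$$
   Context: All function spaces consist of complex-valued functions; a prime denotes $d/dx$. Let $0\le\alpha<\beta\le l<L$ and $c_0>0$. Let $p_1\in L^\infty(0,l)$, $p_2\in L^\infty(l,L)$ be real-valued with $p_1,p_2\ge c_0$, and let $D_a=a\,\chi_{(\alpha,\beta)}\in L^\infty(0,l)$, where $a$ is real-valued with $a\ge c_0$ on $(\alpha,\beta)$ and $\chi_{(\alpha,\beta)}$ is the characteristic function of $(\alpha,\beta)$. $H=L^2(0,l)\times L^2(l,L)$ with its usual norm $\|(v_1,v_2)\|_H^2=\int_0^l|v_1|^2dx+\int_l^L|v_2|^2dx$. $V_2=\{(u_1,u_2)\in H^1(0,l)\times H^1(l,L): u_1(l)=u_2(l),\ u_1(0)=0,\ u_2(L)=0\}$ with norm $\|u\|_{V_2}^2=\int_0^l p_1|u_1'|^2dx+\int_l^L p_2|u_2'|^2dx$. $\mathcal H_2=V_2\times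 H$ with $\|(u,v)\|_{\mathcal H_2}^2=\|u\|_{V_2}^2+\|v\|_H^2$. The operator $\mathcal A_2$ on $\mathcal H_2$ has domain $\mathcal D(\mathcal A_2)$ consisting of all $(u,v)=((u_1,u_2),(v_1,v_2))\in\mathcal H_2$ such that $v\in V_2$, $p_1u_1'+D_av_1'\in H^1(0,l)$, $p_2u_2'\in H^1(l,L)$ and $(p_1u_1'+D_av_1')(l)=(p_2u_2')(l)$; and $$\mathcal A_2(u,v)=\big((v_1,v_2),\,((p_1u_1'+D_av_1')',\,(p_2u_2')')\big).$$ It models the transmission wave system $\ddot u_1-(p_1u_1'+D_a\dot u_1')'=0$ in $(0,l)$, $\ddot u_2-(p_2u_2')'=0$ in $(l,L)$, with $v=\dot u$, and it generates a $C_0$-semigroup of contractions on $\mathcal H_2$. The norm $\|\cdot\|_{\mathcal D(\mathcal A_2)}$ is the graph norm of $\mathcal A_2$. *)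

(* Defs.v *)
From HB Require Import structures.
From mathcomp Require Import all_boot all_order all_algebra.
From mathcomp Require Import all_classical all_reals all_analysis.
From mathcomp Require Import complex.

Set Implicit Arguments.
Unset Strict Implicit.
Unset Printing Implicit Defensive.

Import Order.TTheory GRing.Theory Num.Theory numFieldNormedType.Exports.

Local Open Scope classical_set_scope.
Local Open Scope ring_scope.
Local Open Scope complex_scope.

(** Function spaces on a bounded open interval ]a, b[.

    An element of L^2(a, b), H^1(a, b) or L^oo(a, b) is represented by a
    function on the whole line which is Borel measurable on ]a, b[; every
    class of Lebesgue measurable functions has such a representative.  The
    notions below do not depend on the choice of the representative, nor on its
    values outside ]a, b[. *)

(* The alias [^o] gives R[i] its structures of left module over itself and of
   normed (in particular topological) space. *)
Definition cfun (R : realType) : Type := R -> R[i]^o.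
HB.instance Definition _ (R : realType) := GRing.Lmodule.copy (cfun R) (R -> R[i]^o).
HB.instance Definition _ (R : realType) := Pointed.copy (cfun R) (R -> R[i]^o).

Section FunctionSpaces.
Context {R : realType}.
Implicit Types (a b : R) (f g : cfun R) (p phi : R -> R).

Let mu := @lebesgue_measure R.

Definition ae_on a b (P : R -> Prop) : Prop :=
  {ae mu, forall x, a < x < b -> P x}.

Definition Linfty a b p : Prop :=
  measurable_fun `]a, b[ p /\ exists M : R, ae_on a b (fun x => `|p x| <= M).

Definition sqmod f : R -> R := fun x => ComplexField.Normc.normc (f x) ^+ 2.

Definition spaceL2 a b f : Prop :=
  [/\ measurable_fun `]a, b[ (fun x => complex.Re (f x)),
      measurable_fun `]a, b[ (fun x => complex.Im (f x)) &
      mu.-integrable `]a, b[ (fun x => (sqmod f x)%:E)].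

Definition cintegral a b f : R[i] :=
  (\int[mu]_(x in `]a, b[) complex.Re (f x)) +i*
  (\int[mu]_(x in `]a, b[) complex.Im (f x)).

(* phi \in C^1_c(]a, b[).  Testing against real-valued functions is enough
   since the weak derivative is defined by a complex-linear condition. *)
Definition test_function a b phi : Prop :=
  [/\ forall x, derivable phi x 1,
      continuous (phi^`())%classic,
      compact (closure [set x | phi x != 0]) &
      closure [set x | phi x != 0] `<=` `]a, b[].

Definition weak_derivative a b f g : Prop :=
  forall phi, test_function a b phi ->
    cintegral a b (fun x => f x * ((phi^`())%classic x)%:C) =
    - cintegral a b (fun x => g x * (phi x)%:C).

Definition Sobolev1 a b f : Prop :=
  spaceL2 a b f /\ exists g, spaceL2 a b g /\ weak_derivative a b f g.

(* The derivative of f \in H^1(a, b); it is unique up to a null set. *)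
Definition weak_D a b f : cfun R :=
  get [set g : cfun R | spaceL2 a b g /\ weak_derivative a b f g].

(* The value at x \in [a, b] of f \in H^1(a, b), that is, the value of its
   representative which is continuous on [a, b]; this representative is unique
   on [a, b]. *)
Definition trace a b f (x : R) : R[i] :=
  (get [set g : cfun R | {within `[a, b], continuous g} /\
                         ae_on a b (fun y => g y = f y)]) x.

Definition sqnormL2 a b p f : R := \int[mu]_(x in `]a, b[) (p x * sqmod f x).

End FunctionSpaces.

(** Semigroups of operators.

    A normed space is given by a seminorm N on a subspace X of a space E of
    representatives: two elements x, y of X are identified when N (x - y) = 0.
    Accordingly, identities between vectors are required up to N-null vectors.
    An operator that is linear in this sense and bounded for N sends equivalent
    representatives to equivalent ones, i.e. it is an operator on the
    quotient normed space. *)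

Section Semigroups.
Context {R : realType} {E : lmodType R[i]}.
Variables (X : set E) (N : E -> R) (T : R -> E -> E).

Definition C0_semigroup : Prop :=
  [/\ forall t x, 0 <= t -> X x -> X (T t x),
      forall t (c : R[i]) x y, 0 <= t -> X x -> X y ->
        N (T t (c *: x + y) - (c *: T t x + T t y)) = 0,
      forall t, 0 <= t -> exists C : R, forall x, X x -> N (T t x) <= C * N x &
      [/\ forall x, X x -> N (T 0 x - x) = 0,
          forall s t x, 0 <= s -> 0 <= t -> X x ->
            N (T (s + t) x - T s (T t x)) = 0 &
          forall x, X x -> N (T h x - x) @[h --> 0^'+] --> (0 : R)]].

Variables (domA : set E) (A : E -> E).

(* The pairs (x, y) such that (T h x - x) / h tends to y as h tends to 0 from
   the right are exactly those of the graph of A. *)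
Definition generated_by : Prop :=
  forall x y, X x -> X y ->
    (N ((h^-1)%:C *: (T h x - x) - y) @[h --> 0^'+] --> (0 : R)) <->
    (domA x /\ N (A x - y) = 0).

Definition graph_norm (x : E) : R := N x + N (A x).

Definition polynomially_stable : Prop :=
  exists2 gamma : R, 0 < gamma &
    exists2 M : R, 0 < M & forall t x, 0 <= t -> domA x ->
      N (T t x) <= M / (1 + t) `^ gamma * graph_norm x.

End Semigroups.

(** The transmission problem. *)

Section Transmission.
Context {R : realType}.

Definition pair_space : Type := (cfun R * cfun R)%type.
HB.instance Definition _ :=
  GRing.Lmodule.copy pair_space (cfun R * cfun R)%type.

(* ((u_1, u_2), (v_1, v_2)) *)
Definition state : Type := (pair_space * pair_space)%type.
HB.instance Definition _ :=
  GRing.Lmodule.copy state (pair_space * pair_space)%type.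

Definition damping (alpha beta : R) (a : R -> R) : R -> R :=
  fun x => a x * \1_(`]alpha, beta[%classic) x.

Variables (l L : R) (p1 p2 : R -> R).

Definition spaceH : set pair_space := [set v | spaceL2 0 l v.1 /\ spaceL2 l L v.2].

Definition sqnormH (v : pair_space) : R :=
  sqnormL2 0 l (fun=> 1) v.1 + sqnormL2 l L (fun=> 1) v.2.

Definition V2 : set pair_space :=
  [set u | [/\ Sobolev1 0 l u.1, Sobolev1 l L u.2,
               trace 0 l u.1 l = trace l L u.2 l,
               trace 0 l u.1 0 = 0 & trace l L u.2 L = 0]].

Definition sqnormV2 (u : pair_space) : R :=
  sqnormL2 0 l p1 (weak_D 0 l u.1) + sqnormL2 l L p2 (weak_D l L u.2).

Definition calH2 : set state := [set U | V2 U.1 /\ spaceH U.2].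

Definition norm_calH2 (U : state) : R := Num.sqrt (sqnormV2 U.1 + sqnormH U.2).

(* d stands for the damping coefficient D_a. *)
Variable d : R -> R.

(* p_1 u_1' + D_a v_1' *)
Definition flux1 (U : state) : cfun R := fun x =>
  (p1 x)%:C * weak_D 0 l U.1.1 x + (d x)%:C * weak_D 0 l U.2.1 x.

(* p_2 u_2' *)
Definition flux2 (U : state) : cfun R := fun x => (p2 x)%:C * weak_D l L U.1.2 x.

Definition domA2 : set state :=
  [set U | calH2 U /\
     [/\ V2 U.2, Sobolev1 0 l (flux1 U), Sobolev1 l L (flux2 U) &
         trace 0 l (flux1 U) l = trace l L (flux2 U) l]].

Definition A2 (U : state) : state :=
  (U.2, (weak_D 0 l (flux1 U), weak_D l L (flux2 U))).

End Transmission.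

Arguments pair_space : clear implicits.
Arguments state : clear implicits.

(* Main.v *)
(** Write q = u' and v for a state, (r, w) for its time derivative, E for the energy,
    D for the integral of d r^2 (so E' = - 2 D) and D_1 for the same quantity for the
    time derivative of the state.  There are bounded quadratic forms Phi_1, Phi_2 such
    that, for every large kappa,

      E + Phi_1' + Phi_2' / kappa <= C (kappa D + D_1 / kappa^3),

    where Phi_1 is evaluated at the state and Phi_2 at the state and its derivative.
    On the undamped intervals, where p is constant, a multiplier m q v with m piecewise
    affine bounds the energy by the traces of v and of the flux S = p q + d r at alpha
    and beta; a large weight on (beta, l) absorbs the jump of p at l.  The traces of v are
    bounded inside the damped interval by v and r.  Those of S cost, besides S itself,
    the product of d r and w = S', that is kappa D plus the norm of w divided by kappa,
    and w is in turn bounded by D_1.  The remaining integrals over the damped interval,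
    those of v^2 and p q^2, are bounded up to time derivatives of products of v, or q,
    with primitives of q, or v.

    Integrating this over (t, 2t) along an orbit with kappa = eps t, and using that E
    decreases, gives E(2t) <= E(t) / 32 + O(t^-4), whence E = O(t^-4), that is, decay of
    the norm like t^-2 on the domain of A^2, and then on the domain of A by density.
    Real and imaginary parts satisfy the same real system, and elements of H^1 are
    handled through their absolutely continuous representatives. *)

Require Import Defs.
From mathcomp Require Import all_boot all_order all_algebra.
From mathcomp Require Import all_classical all_reals all_analysis.
From mathcomp Require Import measurable_realfun.
From mathcomp Require Import complex.
From mathcomp Require Import ring lra.

Set Implicit Arguments.
Unset Strict Implicit.
Unset Printing Implicit Defensive.

Import Order.TTheory GRing.Theory Num.Theory numFieldNormedType.Exports.

Local Open Scope classical_set_scope.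
Local Open Scope ring_scope.

(** * Real functions *)

(** On the damped interval [p] and [d] are only bounded and measurable, so no identity may
    differentiate them there. This dictates the objects: only [v], [w], the flux [S], primitives and
    affine weights are integrated by parts on it, never [q] or [r]. A product like p q w is instead
    read as the time derivative of p q v, up to p r v. What is left over in S w is d r w, which is
    why the traces of [S] cost [w] and why a second form, involving the time derivative of the
    state, is needed.

    The semigroup acts on a seminormed space of representatives, with no completeness assumption and
    with one bound for each separate time. Orbits are therefore treated by one-sided derivatives and
    a monotonicity lemma rather than by vector-valued integrals, left continuity has its own
    argument, and the density of the domain of A^2 comes from the surjectivity of A rather than from
    time averages. All identities between vectors hold up to null vectors, and bounded forms do not
    see these. *)

Section RealLemmas.
Context {R : realType}.
Implicit Types (f e : R -> R) (s t : R).

(** Orbits provide only right derivatives, from the generator, and left continuity. The supremum of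
    the [u] with [f u <= f s + eps * (u - s)] has this property by the left condition, and the right
    condition pushes past it unless it is [t]. *)
Lemma right_derivative_le0 f s t : s <= t ->
  (forall u, s < u <= t -> forall eps, 0 < eps ->
     exists2 del, 0 < del & forall h, 0 < h < del -> f u <= f (u - h) + eps) ->
  (forall u, s <= u < t -> forall eps, 0 < eps ->
     exists2 del, 0 < del & forall h, 0 < h < del -> f (u + h) <= f u + eps * h) ->
  f t <= f s.
Proof.
move=> st lf rf; apply/ler_addgt0Pl => e0 e0gt0.
pose eps := e0 / (t - s + 1).
have ts1 : 0 < t - s + 1 by lra.
have eps0 : 0 < eps by rewrite divr_gt0.
suff H : f t <= f s + eps * (t - s).
  apply: (le_trans H); rewrite addrC lerD2r /eps mulrAC ler_pdivrMr//.
  by rewrite ler_pM2l//; lra.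
pose S := [set u | s <= u <= t /\ f u <= f s + eps * (u - s)].
have Ss : S s by split; [lra|rewrite subrr mulr0 addr0].
have ubS : ubound S t by move=> u [] /andP[].
have supS : has_sup S by split; [by exists s|by exists t].
have sS : s <= sup S by apply: (ub_le_sup (ex_intro _ t ubS)).
have St : sup S <= t by apply: ge_sup; [exists s|].
have SS : S (sup S).
  split; first lra.
  have [->|neq] := eqVneq (sup S) s; first by rewrite subrr mulr0 addr0.
  have sS' : s < sup S by rewrite lt_neqAle eq_sym neq.
  apply/ler_addgt0Pl => d d0.
  have sSt : s < sup S <= t by rewrite sS'.
  have [del del0 Hdel] := lf (sup S) sSt d d0.
  have [u [Su1 Su2] ltu] := sup_adherent del0 supS.
  have [->|neu] := eqVneq (sup S) u; first by lra.
  have uS : u < sup S.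
    rewrite lt_neqAle eq_sym neu/=; apply: (ub_le_sup (ex_intro _ t ubS)).
    by split.
  have := Hdel (sup S - u); rewrite opprB addrCA subrr addr0 => /(_ ltac:(lra)) H.
  have : eps * (u - s) <= eps * (sup S - s) by rewrite ler_pM2l//; lra.
  by lra.
have [<-|neq] := eqVneq (sup S) t; first by case: SS.
have St' : sup S < t by rewrite lt_neqAle neq.
have [del del0 H] := rf (sup S) ltac:(lra) eps eps0.
pose h := Num.min (del / 2) (t - sup S).
have h0 : 0 < h by rewrite lt_min; apply/andP; split; lra.
have hd : h < del by rewrite gt_min; apply/orP; left; lra.
have ht : h <= t - sup S by rewrite ge_min lexx orbT.
have : S (sup S + h).
  split; first lra.
  have := H h ltac:(lra); case: SS => _ SS2.
  by rewrite (_ : eps * (sup S + h - s) = eps * (sup S - s) + eps * h); [lra|ring].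
by move/(ub_le_sup (ex_intro _ t ubS)); lra.
Qed.

Lemma quartic_decay (C k0 : R) : 0 < C -> 0 < k0 ->
  exists2 M : R, 0 < M & forall (e : R -> R) (K : R),
    (forall t, 0 <= t -> 0 <= e t <= K) ->
    (forall t k, 0 < t -> k0 <= k -> t * e (2 * t) <= C * (k * e t + k ^- 3 * K)) ->
    forall t, 0 <= t -> e t <= M * K / (1 + t) ^+ 4.
Proof.
move=> C0 k00.
(* with k = ep * t the recurrence reads e (2 * t) <= e t / 32 + O(t^-4) *)
pose ep := (32 * C)^-1; pose t0 := k0 / ep.
have ep0 : 0 < ep by rewrite invr_gt0; lra.
have t00 : 0 < t0 by rewrite divr_gt0.
(* Doubling the time multiplies its fourth power by 16, so the recurrence turns a bound [x * K] of
   t^4 e(t) into (x / 2 + 16 C ep^-3) K; the second term is the fixed point of this map. The first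
   term covers the times between [t0] and [2 * t0]. *)
pose M1 := 16 * t0 ^+ 4 + 32 * C * ep ^- 3.
have ep3 : 0 < ep ^- 3 by rewrite invr_gt0 exprn_gt0.
have t04 : 0 < t0 ^+ 4 by rewrite exprn_gt0.
have M10 : 0 < M1 by have := mulr_gt0 C0 ep3; rewrite /M1; lra.
(* The first term serves for [t > t0], where [1 + t <= (1 + t0^-1) * t]; the second for [t <= t0],
   where [e t <= K] suffices. *)
pose M := M1 * (1 + t0^-1) ^+ 4 + (1 + t0) ^+ 4.
have ti0 : 0 < t0^-1 by rewrite invr_gt0.
exists M.
  apply: addr_gt0; first apply: mulr_gt0 => //.
    by apply: exprn_gt0; lra.
  by apply: exprn_gt0; lra.
move=> e K eK rec.
have K0 : 0 <= K by have := eK 0 (lexx _); lra.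
have main n t : t0 <= t <= 2 ^+ n * t0 -> t ^+ 4 * e t <= M1 * K.
  elim: n t => [|n IH] t.
    rewrite expr0 mul1r => /andP[a b].
    have -> : t = t0 by apply/eqP; rewrite eq_le a b.
    have := eK t0 (ltW t00) => /andP[e0 e1].
    apply: (@le_trans _ _ (t0 ^+ 4 * K)); first by rewrite ler_pM2l ?exprn_gt0.
    apply: ler_wpM2r => //.
    have := mulr_gt0 C0 ep3.
    by rewrite /M1; lra.
  move=> /andP[tt0 tle].
  have [le2|gt2] := leP t (2 * t0).
    have := eK t ltac:(lra) => /andP[e0 e1].
    apply: (@le_trans _ _ ((2 * t0) ^+ 4 * K)).
      apply: ler_pM => //; first by rewrite exprn_ge0//; lra.
      by rewrite lerXn2r ?nnegrE//; lra.
    apply: ler_wpM2r => //.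
    have := mulr_gt0 C0 ep3.
    have -> : (2 * t0) ^+ 4 = 16 * t0 ^+ 4 by ring.
    by rewrite /M1; lra.
  pose s := t / 2.
  have ts : t = 2 * s by rewrite /s; lra.
  have s_t0 : t0 <= s by rewrite /s; lra.
  have s0 : 0 < s by lra.
  have IHs : s ^+ 4 * e s <= M1 * K.
    by apply: IH; rewrite s_t0/=; move: tle; rewrite ts exprS; lra.
  have k0s : k0 <= ep * s.
    by move: s_t0; rewrite /t0 ler_pdivrMr// mulrC.
  have := rec s (ep * s) s0 k0s; rewrite -ts => H.
  have H2 : s ^+ 3 * (s * e t) <= s ^+ 3 * (C * (ep * s * e s + (ep * s) ^- 3 * K)).
    by rewrite ler_pM2l// exprn_gt0.
  have E1 : s ^+ 3 * (C * (ep * s * e s + (ep * s) ^- 3 * K)) =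
    C * ep * (s ^+ 4 * e s) + C * ep ^- 3 * K.
    by field; rewrite !gt_eqF.
  have Cep : C * ep = 32^-1.
    by rewrite /ep; field; rewrite gt_eqF.
  rewrite E1 Cep in H2.
  have -> : t ^+ 4 * e t = 16 * (s ^+ 3 * (s * e t)) by rewrite ts; ring.
  have M1K : M1 * K = 16 * t0 ^+ 4 * K + 32 * (C * ep ^- 3 * K) by rewrite /M1; ring.
  have : 0 <= 16 * t0 ^+ 4 * K by apply: mulr_ge0 => //; lra.
  by lra.
move=> t t_ge0; have t1 : 0 < 1 + t by lra.
rewrite ler_pdivlMr ?exprn_gt0//.
have := eK t t_ge0 => /andP[e0 e1].
have pos1 : 0 <= (1 + t0) ^+ 4 * K by apply: mulr_ge0 => //; apply: exprn_ge0; lra.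
have pos2 : 0 <= M1 * (1 + t0^-1) ^+ 4 * K.
  by apply: mulr_ge0 => //; apply: mulr_ge0; [lra|apply: exprn_ge0; lra].
have -> : M * K = M1 * (1 + t0^-1) ^+ 4 * K + (1 + t0) ^+ 4 * K by rewrite /M; ring.
have [le0|gt0] := leP t t0.
  apply: (@le_trans _ _ ((1 + t0) ^+ 4 * K)); last by lra.
  by rewrite mulrC; apply: ler_pM => //; rewrite ?exprn_ge0 ?lerXn2r ?nnegrE; lra.
apply: (@le_trans _ _ (M1 * (1 + t0^-1) ^+ 4 * K)); last by lra.
have [n Hn] : exists n, t <= 2 ^+ n * t0.
  exists (Num.bound (t / t0)); rewrite -ler_pdivrMr// ltW//.
  exact: upper_nthrootP (leqnn _).
have Ht := main n t; rewrite (ltW gt0) Hn in Ht.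
have {}Ht := Ht isT.
have le1 : 1 + t <= (1 + t0^-1) * t.
  rewrite mulrDl mul1r addrC lerD2l mulrC ler_pdivlMr// mul1r ltW//.
have le2 : (1 + t) ^+ 4 <= (1 + t0^-1) ^+ 4 * t ^+ 4.
  rewrite -exprMn lerXn2r ?nnegrE//; first lra.
  by apply: le_trans le1; lra.
apply: (@le_trans _ _ (e t * ((1 + t0^-1) ^+ 4 * t ^+ 4))).
  by apply: ler_wpM2l.
have -> : e t * ((1 + t0^-1) ^+ 4 * t ^+ 4) = (1 + t0^-1) ^+ 4 * (t ^+ 4 * e t) by ring.
have -> : M1 * (1 + t0^-1) ^+ 4 * K = (1 + t0^-1) ^+ 4 * (M1 * K) by ring.
by apply: ler_wpM2l => //; apply: exprn_ge0; lra.
Qed.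

End RealLemmas.

(** * Quadratic forms on a seminormed space *)

Section AtRight.
Context {R : realType}.

Lemma at_right0P (P : R -> Prop) :
  (\forall h \near 0^'+, P h) <-> exists2 d : R, 0 < d & forall h, 0 < h < d -> P h.
Proof.
split=> [/nbhs_ballP[d /= d0 H]|[d d0 H]].
  exists d => // h /andP[h0 hd]; apply: H => //.
  by rewrite /ball/= sub0r normrN gtr0_norm.
near=> h; apply: H; apply/andP; split.
  by near: h; exact: nbhs_right_gt.
by near: h; exact: nbhs_right_lt.
Unshelve. all: by end_near. Qed.

Lemma cvg_at_right0P (f : R -> R) (a : R) :
  (f h @[h --> 0^'+] --> a) <->
  forall eps, 0 < eps -> exists2 d : R, 0 < d &
    forall h, 0 < h < d -> `|f h - a| <= eps.
Proof.
split=> [/cvgrPdist_le H eps /H /at_right0P[d d0 Hd]|H].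
  by exists d => // h /Hd; rewrite distrC.
apply/cvgrPdist_le => eps /H[d d0 Hd]; apply/at_right0P; exists d => // h /Hd.
by rewrite distrC.
Qed.
End AtRight.

Section Forms.
Context {R : realType} {E : lmodType R[i]}.
Variables (X : set E) (N : E -> R) (B : E -> E -> R).
Implicit Types (F : E -> E -> R) (x y z w : E).

Definition subspace : Prop :=
  X 0 /\ forall (c : R[i]) x y, X x -> X y -> X (c *: x + y).

(** Bilinearity over the reals only: the forms in use are sums over real and imaginary parts, which
    a complex scalar mixes. *)
Definition real_form F : Prop :=
  (forall (c : R) x y z, X x -> X y -> X z ->
    F (c%:C%C *: x + y) z = c * F x z + F y z) /\
  (forall (c : R) x y z, X x -> X y -> X z ->
    F z (c%:C%C *: x + y) = c * F z x + F z y).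

Definition bounded_form F : Prop :=
  real_form F /\ exists2 C : R, 0 <= C &
    forall x y, X x -> X y -> `|F x y| <= C * N x * N y.

Definition form_norm : Prop :=
  [/\ real_form B, forall x y, X x -> X y -> B x y = B y x,
      forall x, X x -> 0 <= B x x & forall x, X x -> N x = Num.sqrt (B x x)].

Hypotheses (HX : subspace) (HB : form_norm).

Lemma subspaceZ (c : R[i]) x : X x -> X (c *: x).
Proof. by move=> Xx; rewrite -[_ *: _]addr0; apply: HX.2 => //; exact: HX.1. Qed.

Lemma subspaceD x y : X x -> X y -> X (x + y).
Proof. by move=> Xx Xy; rewrite -[x]scale1r; exact: HX.2. Qed.

Lemma subspaceB x y : X x -> X y -> X (x - y).
Proof. by move=> Xx Xy; rewrite addrC -scaleN1r; exact: HX.2. Qed.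

Lemma realN1 : ((-1 : R)%:C)%C = -1.
Proof. by rewrite rmorphN1. Qed.

Lemma subE_real x y : x - y = ((-1 : R)%:C)%C *: y + x.
Proof. by rewrite realN1 scaleN1r addrC. Qed.

Lemma addE_real x y : x + y = ((1 : R)%:C)%C *: x + y.
Proof. by rewrite rmorph1 scale1r. Qed.

Section OneForm.
Variable F : E -> E -> R.
Hypothesis HF : real_form F.

Lemma form_subl x y z : X x -> X y -> X z -> F (x - y) z = F x z - F y z.
Proof. by move=> ? ? ?; rewrite subE_real HF.1//; ring. Qed.

Lemma form_subr x y z : X x -> X y -> X z -> F z (x - y) = F z x - F z y.
Proof. by move=> ? ? ?; rewrite subE_real HF.2//; ring. Qed.

Lemma form_addl x y z : X x -> X y -> X z -> F (x + y) z = F x z + F y z.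
Proof. by move=> ? ? ?; rewrite addE_real HF.1//; ring. Qed.

Lemma form_addr x y z : X x -> X y -> X z -> F z (x + y) = F z x + F z y.
Proof. by move=> ? ? ?; rewrite addE_real HF.2//; ring. Qed.

Lemma form0l z : X z -> F 0 z = 0.
Proof. by move=> Xz; rewrite -(subrr 0) form_subl ?subrr//; exact: HX.1. Qed.

Lemma form0r z : X z -> F z 0 = 0.
Proof. by move=> Xz; rewrite -(subrr 0) form_subr ?subrr//; exact: HX.1. Qed.

Lemma form_scalel c x z : X x -> X z -> F (c%:C%C *: x) z = c * F x z.
Proof. by move=> ? ?; rewrite -[_ *: x]addr0 HF.1 ?form0l ?addr0//; exact: HX.1. Qed.

Lemma form_scaler c x z : X x -> X z -> F z (c%:C%C *: x) = c * F z x.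
Proof. by move=> ? ?; rewrite -[_ *: x]addr0 HF.2 ?form0r ?addr0//; exact: HX.1. Qed.

End OneForm.

Let HBf : real_form B. Proof. by case: HB. Qed.
Let Bsym x y : X x -> X y -> B x y = B y x. Proof. by case: HB => _ + _ _; exact. Qed.
Let Bge0 x : X x -> 0 <= B x x. Proof. by case: HB => _ _ + _; exact. Qed.

Lemma norm_ge0 x : X x -> 0 <= N x.
Proof. by move=> Xx; case: HB => _ _ _ ->//; exact: sqrtr_ge0. Qed.

Lemma sqr_norm x : X x -> N x ^+ 2 = B x x.
Proof. by move=> Xx; case: HB => _ _ H ->//; rewrite sqr_sqrtr// H. Qed.

Lemma form_CS x y : X x -> X y -> `|B x y| <= N x * N y.
Proof.
move=> Xx Xy; rewrite -[leRHS]ger0_norm ?mulr_ge0 ?norm_ge0// -ler_sqr ?nnegrE ?normr_ge0//.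
rewrite !real_normK ?num_real// exprMn !sqr_norm//.
pose b := B x y; pose c := B y y.
have H t : 0 <= B x x + 2 * t * b + t ^+ 2 * c.
  have Xtx : X (t%:C%C *: y + x) by exact: HX.2.
  have := Bge0 Xtx; rewrite HBf.1// !HBf.2// (Bsym Xy Xx) -/b -/c.
  by congr (_ <= _); ring.
have c0 : 0 <= c by exact: Bge0.
have [c_eq0|c_neq0] := eqVneq c 0.
  have [b0|b0] := eqVneq b 0; first by rewrite -/b -/c b0 c_eq0 expr0n mulr0.
  (* When [B y y = 0] the polynomial is affine, and it would take the value -1 here. *)
  have := H (- (B x x + 1) / (2 * b)); rewrite c_eq0 mulr0 addr0.
  have -> : 2 * (- (B x x + 1) / (2 * b)) * b = - (B x x + 1) by field.
  lra.
have c_gt0 : 0 < c by rewrite lt_neqAle eq_sym c_neq0.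
have := H (- b / c).
have -> : B x x + 2 * (- b / c) * b + (- b / c) ^+ 2 * c = (B x x * c - b ^+ 2) / c.
  by field.
by rewrite pmulr_lge0 ?invr_gt0// subr_ge0 -/b -/c.
Qed.

Lemma normD x y : X x -> X y -> N (x + y) <= N x + N y.
Proof.
move=> Xx Xy; have Xxy := subspaceD Xx Xy.
rewrite -ler_sqr ?nnegrE ?norm_ge0 ?addr_ge0 ?norm_ge0// sqrrD !sqr_norm//.
rewrite form_addl// !form_addr// (Bsym Xy Xx).
have := le_trans (ler_norm _) (form_CS Xx Xy); lra.
Qed.

Lemma normZ (c : R) x : X x -> N (c%:C%C *: x) = `|c| * N x.
Proof.
move=> Xx; apply/eqP; rewrite -(@eqrXn2 _ 2)// ?mulr_ge0 ?norm_ge0//; last exact: subspaceZ.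
rewrite exprMn !sqr_norm//; last exact: subspaceZ.
rewrite form_scalel ?form_scaler//; last exact: subspaceZ.
by rewrite real_normK ?num_real// expr2 mulrA.
Qed.

Lemma norm0 : N 0 = 0.
Proof. by rewrite -(scaler0 _ ((0 : R)%:C)%C) normZ ?normr0 ?mul0r//; exact: HX.1. Qed.

Lemma normN x : X x -> N (- x) = N x.
Proof. by move=> Xx; rewrite -scaleN1r -realN1 normZ// normrN1 mul1r. Qed.

Lemma normB x y : X x -> X y -> N (x - y) <= N x + N y.
Proof.
move=> Xx Xy; rewrite -[N y]normN//; apply: normD => //.
by rewrite -scaleN1r; exact: subspaceZ.
Qed.

Lemma norm_dist x y : X x -> X y -> N (x - y) = N (y - x).
Proof. by move=> Xx Xy; rewrite -normN ?opprB//; exact: subspaceB. Qed.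

Lemma norm_le_dist x y : X x -> X y -> N x <= N (x - y) + N y.
Proof. by move=> Xx Xy; rewrite -{1}[x](subrK y); apply: normD => //; exact: subspaceB. Qed.

Lemma dist_trans y x z : X x -> X y -> X z -> N (x - z) <= N (x - y) + N (y - z).
Proof.
move=> Xx Xy Xz; have -> : x - z = (x - y) + (y - z) by rewrite addrA subrK.
by apply: normD; exact: subspaceB.
Qed.

Lemma norm_eqv x y : X x -> X y -> N (x - y) = 0 -> N x = N y.
Proof.
move=> Xx Xy e; apply/eqP; rewrite eq_le.
have := norm_le_dist Xx Xy; have := norm_le_dist Xy Xx.
by rewrite (norm_dist Xy Xx) e !add0r => -> ->.
Qed.

(** A bounded form vanishes as soon as one argument is null, so it descends to the quotient. This
    lets the semigroup identities, true only up to null vectors, be used inside forms. *)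
Lemma form_eqv F x x' y y' : bounded_form F -> X x -> X x' -> X y -> X y' ->
  N (x - x') = 0 -> N (y - y') = 0 -> F x y = F x' y'.
Proof.
move=> [HF [C C0 bF]] Xx Xx' Xy Xy' ex ey.
have h1 : F x y = F x' y.
  apply/eqP; rewrite -subr_eq0 -form_subl// -normr_le0.
  by have := bF _ _ (subspaceB Xx Xx') Xy; rewrite ex mulr0 mul0r.
rewrite h1; apply/eqP; rewrite -subr_eq0 -form_subr// -normr_le0.
by have := bF _ _ Xx' (subspaceB Xy Xy'); rewrite ey mulr0.
Qed.

Lemma bounded_formB : bounded_form B.
Proof. by split=> //; exists 1 => // x y Xx Xy; rewrite mul1r form_CS. Qed.

Lemma form_cvg F (u v : R -> E) y z : bounded_form F -> X y -> X z ->
  (\forall h \near 0^'+, X (u h)) -> (\forall h \near 0^'+, X (v h)) ->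
  N (u h - y) @[h --> 0^'+] --> (0 : R) ->
  N (v h - z) @[h --> 0^'+] --> (0 : R) ->
  F (u h) (v h) @[h --> 0^'+] --> F y z.
Proof.
move=> [HF [C C0 bF]] Xy Xz Xu Xv cu cv.
have H : C * (N (u h - y) * N (v h - z) + N (u h - y) * N z + N y * N (v h - z))
    @[h --> 0^'+] --> (0 : R).
  rewrite -[X in _ --> X](_ : C * (0 * 0 + 0 * N z + N y * 0) = 0); last by ring.
  apply: cvgMr; apply: cvgD; [apply: cvgD|apply: cvgMr => //].
    exact: cvgM.
  by apply: cvgMl.
apply/cvgrPdist_le => /= eps eps0.
move/cvgrPdist_le : H => /(_ _ eps0) H.
near=> h.
have Xuh : X (u h) by near: h.
have Xvh : X (v h) by near: h.
have Xuy := subspaceB Xuh Xy; have Xvz := subspaceB Xvh Xz.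
have : `|0 - C * (N (u h - y) * N (v h - z) + N (u h - y) * N z + N y * N (v h - z))| <= eps.
  by near: h.
rewrite sub0r normrN ger0_norm; last first.
  by rewrite mulr_ge0// !addr_ge0// mulr_ge0// norm_ge0.
apply: le_trans.
have -> : F y z - F (u h) (v h) =
  - (F (u h - y) (v h - z) + F (u h - y) z + F y (v h - z)).
  by rewrite !form_subl// !form_subr//; ring.
rewrite normrN; apply: (le_trans (ler_normD _ _)).
rewrite 2!mulrDr; apply: lerD; last by rewrite mulrA bF.
apply: (le_trans (ler_normD _ _)).
by apply: lerD; rewrite mulrA bF.
Unshelve. all: by end_near. Qed.

End Forms.

(** * Decay of semigroups *)

(* A right-continuous function is continuous at some point of every interval:
   shrink intervals on which the oscillation is small. *)
Section ContinuityPoint.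
Context {R : realType}.
Variables (dist : R -> R -> R).
Hypotheses (dist_tri : forall s t u, 0 <= s -> 0 <= t -> 0 <= u ->
              dist s u <= dist s t + dist t u)
  (dist_sym : forall s t, 0 <= s -> 0 <= t -> dist s t = dist t s)
  (right_cont : forall t, 0 <= t -> forall eps, 0 < eps ->
     exists2 d : R, 0 < d & forall h, 0 < h < d -> dist (t + h) t <= eps).

Lemma continuity_point (T : R) : 0 < T ->
  exists t0, 0 < t0 < T /\ forall eps, 0 < eps ->
     exists2 d : R, 0 < d & forall h, 0 < h < d -> dist (t0 - h) t0 <= eps.
Proof.
move=> T0.
(* The strict inclusions keep the limit point in the interior of every interval, so that a left
   neighbourhood of it lies where the oscillation is small. *)
have step (n : nat) (I : R * R) : exists J : R * R,
    0 <= I.1 -> I.1 < I.2 -> [/\ I.1 < J.1, J.1 < J.2, J.2 < I.2 &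
      forall s, J.1 <= s <= J.2 -> dist s J.1 <= n.+1%:R^-1].
  case: I => a b /=.
  have [[a0 ab]|nab] := pselect (0 <= a /\ a < b); last first.
    by exists (0, 0) => a0 ab; exfalso; apply: nab.
  pose c := (a + b) / 2.
  have [d d0 Hd] := @right_cont c ltac:(rewrite /c; lra) (n.+1%:R^-1 / 2) ltac:(by rewrite divr_gt0// invr_gt0).
  pose m := Num.min d (b - c).
  have m0 : 0 < m by rewrite lt_min d0/= /c; lra.
  have md : m <= d by rewrite ge_min lexx.
  have mb : m <= b - c by rewrite ge_min lexx orbT.
  exists (c + m / 3, c + m / 2) => _ _ /=; split; [rewrite /c; lra|lra|lra|].
  move=> s /andP[s1 s2].
  have c0 : 0 <= c by rewrite /c; lra.
  apply: (le_trans (@dist_tri s c _ _ _ _)); [lra|lra|lra|].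
  have h1 := Hd (s - c) ltac:(lra); rewrite addrC subrK in h1.
  have h2 := Hd (m / 3) ltac:(lra).
  rewrite (dist_sym c0); last lra.
  by move: h1 h2; set iv := n.+1%:R^-1; lra.
have [f Hf] := choice (fun nI : nat * (R * R) => step nI.1 nI.2).
pose I := fix I n := if n is m.+1 then f (m, I m) else (0, T).
have IS n : I n.+1 = f (n, I n) by [].
have Iok n : 0 <= (I n).1 /\ (I n).1 < (I n).2.
  elim: n => [|n [IH1 IH2]]; first by split.
  by rewrite IS; have [/= h1 h2 h3 _] := Hf (n, I n) IH1 IH2; split => //; lra.
have Inext n : [/\ (I n).1 < (I n.+1).1, (I n.+1).2 < (I n).2 &
      forall s, (I n.+1).1 <= s <= (I n.+1).2 -> dist s (I n.+1).1 <= n.+1%:R^-1].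
  by have [h1 h2] := Iok n; have [/= h3 h4 h5 h6] := Hf (n, I n) h1 h2; split.
have mono n k : (I n).1 <= (I (n + k)%N).1 /\ (I (n + k)%N).2 <= (I n).2.
  elim: k => [|k [h1 h2]]; first by rewrite addn0.
  by rewrite addnS; have [h3 h4 _] := Inext (n + k)%N; split; lra.
have cross n m : (I n).1 <= (I m).2.
  have [h1 h2] := mono n m; have [h3 h4] := mono m n; rewrite addnC in h3 h4.
  by have [_ h5] := Iok (n + m)%N; lra.
pose S := [set (I n).1 | n in [set: nat]].
have hS : has_sup S.
  by split; [exists (I 0%N).1; exists 0%N|exists T => _ [n _ <-]; exact: (cross n 0%N)].
pose t0 := sup S.
have t0l n : (I n).1 < t0.
  have [h _ _] := Inext n; apply: (lt_le_trans h).
  by apply: ub_le_sup; [case: hS|exists n.+1].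
have t0r n : t0 <= (I n).2.
  by apply: ge_sup; [case: hS|move=> _ [m _ <-]; exact: cross].
exists t0; split.
  have := t0l 0%N; have := t0r 1%N; have [_ h _] := Inext 0%N.
  by move: h; rewrite /=; lra.
move=> eps eps0.
have [n Hn] : exists n : nat, n.+1%:R^-1 <= eps / 2.
  exists (Num.bound (2 / eps)).
  have : 2 / eps < (Num.bound (2 / eps))%:R by apply: archi_boundP; rewrite divr_ge0 ?ltW.
  set b := Num.bound _ => Hb.
  have b0 : 0 < b.+1%:R :> R by rewrite ltr0n.
  rewrite -[eps / 2]invrK lef_pV2 ?posrE ?invr_gt0//; last lra.
  by rewrite invf_div -natr1; lra.
have t0n := t0l n.+1.
exists (t0 - (I n.+1).1); first lra.
move=> h /andP[h0 h1].
have [i0 _] := Iok n.+1; have [_ _ H] := Inext n; have t0r' := t0r n.+1.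
apply: (le_trans (@dist_tri _ (I n.+1).1 _ _ _ _)); [lra|lra|lra|].
have d1 := H (t0 - h) ltac:(lra).
have d2 := H t0 ltac:(lra).
rewrite (@dist_sym (I n.+1).1 t0)//; last lra.
by move: Hn d1 d2; set iv := n.+1%:R^-1; lra.
Qed.
End ContinuityPoint.

(** * Orbits of a semigroup and its generator *)

Section Orbits.
Context {R : realType} {E : lmodType R[i]}.
Variables (X : set E) (N : E -> R) (B : E -> E -> R) (T : R -> E -> E)
  (domA : set E) (A : E -> E).
Hypotheses (HX : subspace X) (HB : form_norm X N B)
  (domX : domA `<=` X) (AX : forall x, domA x -> X (A x))
  (HT : C0_semigroup X N T) (HG : generated_by X N T domA A).
Implicit Types (x y z : E) (F : E -> E -> R).

Let TX t x : 0 <= t -> X x -> X (T t x).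
Proof. by case: HT => H _ _ _; exact: H. Qed.

Let Tlin t (c : R[i]) x y : 0 <= t -> X x -> X y ->
  N (T t (c *: x + y) - (c *: T t x + T t y)) = 0.
Proof. by case: HT => _ H _ _; exact: H. Qed.

Let Tbd t : 0 <= t -> exists2 C : R, 0 <= C & forall x, X x -> N (T t x) <= C * N x.
Proof.
move=> t0; case: HT => _ _ /(_ _ t0)[C HC] _; exists `|C| => // x Xx.
apply: (le_trans (HC x Xx)); apply: ler_wpM2r; [exact: norm_ge0 HB _ _|exact: ler_norm].
Qed.

Let T0 x : X x -> N (T 0 x - x) = 0.
Proof. by case: HT => _ _ _ [H _ _]; exact: H. Qed.

Let TD s t x : 0 <= s -> 0 <= t -> X x -> N (T (s + t) x - T s (T t x)) = 0.
Proof. by case: HT => _ _ _ [_ H _]; exact: H. Qed.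

Let Tc x : X x -> N (T h x - x) @[h --> 0^'+] --> (0 : R).
Proof. by case: HT => _ _ _ [_ _ H]; exact: H. Qed.

Let XB x y : X x -> X y -> X (x - y). Proof. exact: subspaceB. Qed.
Let XZ (c : R[i]) x : X x -> X (c *: x). Proof. exact: subspaceZ. Qed.

Lemma near_right_gt0 : \forall h \near (0:R)^'+, 0 < h.
Proof. by exact: nbhs_right_gt. Qed.

Lemma TB t x y : 0 <= t -> X x -> X y -> N (T t (x - y) - (T t x - T t y)) = 0.
Proof.
move=> t0 Xx Xy; have := Tlin (-1) t0 Xy Xx.
by rewrite !scaleN1r ![- _ + _]addrC.
Qed.

Lemma T_eqv t x y : 0 <= t -> X x -> X y -> N (x - y) = 0 -> N (T t x - T t y) = 0.
Proof.
move=> t0 Xx Xy e; have [C C0 HC] := Tbd t0.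
have Xxy := XB Xx Xy; have XT := XB (TX t0 Xx) (TX t0 Xy).
rewrite -(norm_eqv HX HB (TX t0 Xxy) XT (TB t0 Xx Xy)).
apply/eqP; rewrite eq_le (norm_ge0 HB) ?andbT//; last exact: TX.
by apply: (le_trans (HC _ Xxy)); rewrite e mulr0.
Qed.

Lemma orbit_dist t x y C : 0 <= t -> X x -> X y ->
  (forall x, X x -> N (T t x) <= C * N x) ->
  N (T t x - T t y) <= C * N (x - y).
Proof.
move=> t0 Xx Xy HC; have Xxy := XB Xx Xy.
have XT := XB (TX t0 Xx) (TX t0 Xy).
by rewrite -(norm_eqv HX HB (TX t0 Xxy) XT (TB t0 Xx Xy)) HC.
Qed.

Lemma orbit_right t x : 0 <= t -> X x ->
  N (T (t + h) x - T t x) @[h --> 0^'+] --> (0 : R).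
Proof.
move=> t0 Xx; have Xt := TX t0 Xx.
apply: (cvg_trans _ (Tc Xt)); apply: near_eq_cvg; near=> h.
have h0 : 0 <= h by apply: ltW; near: h; exact: near_right_gt0.
have Xh := TX h0 Xt; have Xth := TX (addr_ge0 h0 t0) Xx.
rewrite [t + h]addrC; apply/esym; apply: (norm_eqv HX HB (XB Xth Xt) (XB Xh Xt)).
have -> : T (h + t) x - T t x - (T h (T t x) - T t x) = T (h + t) x - T h (T t x).
  by rewrite opprB addrA subrK.
exact: TD.
Unshelve. all: by end_near. Qed.

(* The orbit is continuous at some t_0 < t, and T (t - t_0) carries this over to t. *)
Lemma orbit_left t x : 0 < t -> X x ->
  N (T (t - h) x - T t x) @[h --> 0^'+] --> (0 : R).
Proof.
move=> t_gt0 Xx; pose dist s t := N (T s x - T t x).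
have dtri s u v : 0 <= s -> 0 <= u -> 0 <= v -> dist s v <= dist s u + dist u v.
  by move=> ? ? ?; apply: (dist_trans HX HB); exact: TX.
have dsym s u : 0 <= s -> 0 <= u -> dist s u = dist u s.
  by move=> ? ?; apply: (norm_dist HX HB); exact: TX.
have drc u : 0 <= u -> forall eps, 0 < eps ->
     exists2 d : R, 0 < d & forall h, 0 < h < d -> dist (u + h) u <= eps.
  move=> u0 eps eps0; have /cvg_at_right0P/(_ _ eps0)[d d0 Hd] := orbit_right u0 Xx.
  by exists d => // h /Hd; rewrite subr0; exact/le_trans/ler_norm.
have [t0 [/andP[t00 t0t] Ht0]] := continuity_point dtri dsym drc t_gt0.
have tt0 : 0 <= t - t0 by lra.
have [C C0 HC] := Tbd tt0.
apply/cvg_at_right0P => eps eps0.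
have [d d0 Hd] := Ht0 (eps / (C + 1)) ltac:(by rewrite divr_gt0//; lra).
exists (Num.min d t0); first by rewrite lt_min d0.
move=> h /andP[h0]; rewrite lt_min => /andP[hd ht0].
have Xh : X (T (t - h) x) by apply: TX => //; lra.
have Xt : X (T t x) by apply: TX => //; lra.
have Xh' : X (T (t0 - h) x) by apply: TX => //; lra.
have Xt' : X (T t0 x) by apply: TX => //; lra.
rewrite subr0 ger0_norm; last by apply: (norm_ge0 HB); exact: XB.
have e1 : N (T (t - h) x - T (t - t0) (T (t0 - h) x)) = 0.
  have h1 : 0 <= t0 - h by lra.
  by have := TD tt0 h1 Xx; rewrite addrA subrK.
have e2 : N (T (t - t0) (T t0 x) - T t x) = 0.
  rewrite (norm_dist HX HB)//; last exact: TX.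
  by have := TD tt0 (ltW t00) Xx; rewrite subrK.
apply: (le_trans (dist_trans HX HB Xh (TX tt0 Xh') Xt)).
rewrite e1 add0r; apply: (le_trans (dist_trans HX HB (TX tt0 Xh') (TX tt0 Xt') Xt)).
rewrite e2 addr0; apply: (le_trans (@orbit_dist (t - t0) _ _ _ tt0 Xh' Xt' HC)) => //.
have := Hd h ltac:(lra); rewrite /dist => H.
apply: (le_trans (ler_wpM2l C0 H)).
by rewrite mulrA ler_pdivrMr; nra.
Qed.

Lemma diff_quotient x : domA x ->
  N (((h^-1)%:C)%C *: (T h x - x) - A x) @[h --> 0^'+] --> (0 : R).
Proof.
move=> dx; apply/(HG (domX dx) (AX dx)); split=> //.
by rewrite subrr (norm0 HX HB).
Qed.

Lemma X_quotient x : X x -> \forall h \near 0^'+, X (((h^-1)%:C)%C *: (T h x - x)).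
Proof.
move=> Xx; near=> h; apply: XZ; apply: XB => //; apply: TX => //.
Unshelve. all: by end_near. Qed.

(** Difference quotients of equivalent vectors differ by null vectors, so the description of the
    graph by limits transfers. It is needed because [A (T u x)] is only equivalent to [T u (A x)],
    which is the one known to lie in the domain. *)
Lemma dom_eqv x y : domA x -> X y -> N (y - x) = 0 -> domA y /\ N (A y - A x) = 0.
Proof.
move=> dx Xy e; have Xx := domX dx.
suff H : N (((h^-1)%:C)%C *: (T h y - y) - A x) @[h --> 0^'+] --> (0 : R).
  exact: (HG Xy (AX dx)).1 H.
apply: (cvg_trans _ (diff_quotient dx)); apply: near_eq_cvg; near=> h.
have h0 : 0 <= h by apply: ltW; near: h; exact: near_right_gt0.
have Xhx := TX h0 Xx; have Xhy := TX h0 Xy.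
have XAx := AX dx.
apply: (norm_eqv HX HB); [by apply: XB => //; apply: XZ; exact: XB..|].
have -> : ((h^-1)%:C)%C *: (T h x - x) - A x - (((h^-1)%:C)%C *: (T h y - y) - A x) =
   ((h^-1)%:C)%C *: ((T h x - T h y) - (x - y)).
  rewrite opprB addrA subrK -scalerBr; congr (_ *: _).
  by rewrite opprD addrACA -opprD.
rewrite (normZ HX HB); last by apply: XB; exact: XB.
have Xxy := XB Xx Xy; have Xhxy := XB Xhx Xhy.
suff -> : N (T h x - T h y - (x - y)) = 0 by rewrite mulr0.
apply/eqP; rewrite eq_le (norm_ge0 HB) ?andbT//; last exact: XB.
apply: (le_trans (normB HX HB Xhxy Xxy)).
have e' : N (x - y) = 0 by rewrite (norm_dist HX HB).
by rewrite e' addr0 T_eqv.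
Unshelve. all: by end_near. Qed.

Lemma dom_linear (c : R) x y : domA x -> domA y ->
  domA (c%:C%C *: x + y) /\ N (A (c%:C%C *: x + y) - (c%:C%C *: A x + A y)) = 0.
Proof.
move=> dx dy; have Xx := domX dx; have Xy := domX dy.
have XAx := AX dx; have XAy := AX dy.
have Xz : X (c%:C%C *: x + y) by exact: HX.2.
have XAz : X (c%:C%C *: A x + A y) by exact: HX.2.
apply/(HG Xz XAz).
have H : `|c| * N (((h^-1)%:C)%C *: (T h x - x) - A x) +
   N (((h^-1)%:C)%C *: (T h y - y) - A y) @[h --> 0^'+] --> (0 : R).
  rewrite -[X in _ --> X](_ : `|c| * 0 + 0 = 0); last by ring.
  by apply: cvgD; [apply: cvgMr|]; exact: diff_quotient.
apply: (squeeze_cvgr _ (cvg_cst (0:R)) H).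
near=> h.
have h0 : 0 <= h by apply: ltW; near: h; exact: near_right_gt0.
have Xhx := TX h0 Xx; have Xhy := TX h0 Xy; have Xhz := TX h0 Xz.
have Xqx : X (((h^-1)%:C)%C *: (T h x - x) - A x) by apply: XB => //; apply: XZ; exact: XB.
have Xqy : X (((h^-1)%:C)%C *: (T h y - y) - A y) by apply: XB => //; apply: XZ; exact: XB.
have Xqz : X (((h^-1)%:C)%C *: (T h (c%:C%C *: x + y) - (c%:C%C *: x + y)) -
    (c%:C%C *: A x + A y)).
  by apply: XB => //; apply: XZ; exact: XB.
rewrite (norm_ge0 HB)//=.
have Xs : X (c%:C%C *: (((h^-1)%:C)%C *: (T h x - x) - A x) +
    (((h^-1)%:C)%C *: (T h y - y) - A y)) by exact: HX.2.
rewrite -(normZ HX HB)//; apply: (le_trans _ (normD HX HB (XZ _ Xqx) Xqy)).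
rewrite le_eqVlt; apply/orP; left; apply/eqP; apply: (norm_eqv HX HB) => //.
have -> : ((h^-1)%:C)%C *: (T h (c%:C%C *: x + y) - (c%:C%C *: x + y)) - (c%:C%C *: A x + A y) -
   (c%:C%C *: (((h^-1)%:C)%C *: (T h x - x) - A x) + (((h^-1)%:C)%C *: (T h y - y) - A y)) =
   ((h^-1)%:C)%C *: (T h (c%:C%C *: x + y) - (c%:C%C *: T h x + T h y)).
  set k := (h^-1)%:C%C; set a := c%:C%C.
  have -> : a *: (k *: (T h x - x) - A x) + (k *: (T h y - y) - A y) =
     k *: ((a *: T h x + T h y) - (a *: x + y)) - (a *: A x + A y).
    rewrite scalerBr scalerA mulrC -scalerA addrACA -opprD -scalerDr scalerBr.
    by rewrite addrACA -opprD.
  by rewrite opprB addrA subrK -scalerBr opprB addrA subrK.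
rewrite (normZ HX HB); last by apply: XB => //; exact: HX.2.
by rewrite Tlin// mulr0.
Unshelve. all: by end_near. Qed.

(** Up to null vectors, the difference quotient at [T t x] is the image under [T t] of the one at
    [x]; the bound on [T t] then passes to the limit. *)
Lemma T_commutes t x : 0 <= t -> domA x ->
  domA (T t x) /\ N (A (T t x) - T t (A x)) = 0.
Proof.
move=> t0 dx; have Xx := domX dx; have XAx := AX dx; have [C C0 HC] := Tbd t0.
have XTx := TX t0 Xx; have XTAx := TX t0 XAx.
apply/(HG XTx XTAx).
have H : C * N (((h^-1)%:C)%C *: (T h x - x) - A x) @[h --> 0^'+] --> (0 : R).
  rewrite -[X in _ --> X](_ : C * 0 = 0); last by ring.
  by apply: cvgMr; exact: diff_quotient.
apply: (squeeze_cvgr _ (cvg_cst (0:R)) H).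
near=> h.
have h0 : 0 <= h by apply: ltW; near: h; exact: near_right_gt0.
set k := ((h^-1)%:C)%C.
have Xhx := TX h0 Xx; have XhTx := TX h0 XTx; have XThx := TX t0 Xhx.
have Xq : X (k *: (T h x - x)) by apply: XZ; exact: XB.
rewrite (norm_ge0 HB)/=; last by apply: XB => //; apply: XZ; exact: XB.
apply: (le_trans _ (orbit_dist t0 Xq XAx HC)).
rewrite le_eqVlt; apply/orP; left; apply/eqP; apply: (norm_eqv HX HB).
- by apply: XB => //; apply: XZ; exact: XB.
- by apply: XB => //; exact: TX.
rewrite opprB addrA subrK.
have e1 : N (T h (T t x) - T t (T h x)) = 0.
  have Xth := TX (addr_ge0 h0 t0) Xx; have Xth' := TX (addr_ge0 t0 h0) Xx.
  apply/eqP; rewrite eq_le (norm_ge0 HB) ?andbT; last exact: XB.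
  apply: (le_trans (dist_trans HX HB XhTx Xth XThx)).
  rewrite (norm_dist HX HB XhTx Xth) TD// add0r [h + t]addrC TD//.
have e2 : N (k *: (T h (T t x) - T t x) - k *: (T t (T h x - x))) = 0.
  have XThxx := TX t0 (XB Xhx Xx); have XTT := XB XThx XTx.
  rewrite -scalerBr (normZ HX HB); last by apply: XB => //; exact: XB.
  rewrite (_ : N _ = 0) ?mulr0//.
  have H1 := XB XhTx XTx.
  apply/eqP; rewrite eq_le (norm_ge0 HB) ?andbT; last exact: XB.
  apply: (le_trans (dist_trans HX HB H1 XTT XThxx)).
  rewrite opprB addrA subrK e1 add0r (norm_dist HX HB)//.
  by rewrite TB.
have Xk1 : X (k *: (T h (T t x) - T t x)) by apply: XZ; exact: XB.
have Xk2 : X (k *: T t (T h x - x)) by apply: XZ; apply: TX => //; exact: XB.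
have Xk3 := TX t0 Xq.
apply/eqP; rewrite eq_le (norm_ge0 HB) ?andbT; last exact: XB.
apply: (le_trans (dist_trans HX HB Xk1 Xk2 Xk3)); rewrite e2 add0r.
have Xhxx := XB Xhx Xx.
(* Homogeneity of [T t] is linearity with second vector 0; it leaves the term [T t 0], which is only
   known to be null. *)
have := Tlin k t0 Xhxx HX.1; rewrite !addr0 => e3.
have X0 := TX t0 HX.1; have XTh := TX t0 Xhxx.
have e4 : N (T t 0) = 0.
  apply/eqP; rewrite eq_le (norm_ge0 HB)// andbT.
  by apply: (le_trans (HC _ HX.1)); rewrite (norm0 HX HB) mulr0.
rewrite (norm_dist HX HB)//.
have Xm : X (k *: T t (T h x - x) + T t 0) by exact: HX.2.
apply: (le_trans (dist_trans HX HB Xk3 Xm Xk2)).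
by rewrite e3 add0r addrAC subrr add0r e4.
Unshelve. all: by end_near. Qed.

Lemma form_orbit_left F t x y : bounded_form X N F -> 0 < t -> X x -> X y ->
  F (T (t - h) x) (T (t - h) y) @[h --> 0^'+] --> F (T t x) (T t y).
Proof.
move=> bF t0 Xx Xy; apply: (form_cvg HX HB bF); try exact: TX (ltW t0) _.
- near=> h; apply: TX => //; rewrite subr_ge0; near: h; exact: nbhs_right_le.
- near=> h; apply: TX => //; rewrite subr_ge0; near: h; exact: nbhs_right_le.
- exact: orbit_left.
- exact: orbit_left.
Unshelve. all: by end_near. Qed.

(** Product rule: with [u x h] the difference quotient, the increment divided by [h] is F(u x h, y)
    + F(x, u y h) + h F(u x h, u y h), and the last term tends to 0. *)
Lemma form_right_derivative F x y : bounded_form X N F -> domA x -> domA y ->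
  h^-1 * (F (T h x) (T h y) - F x y) @[h --> 0^'+] --> F (A x) y + F x (A y).
Proof.
move=> bF dx dy; have Xx := domX dx; have Xy := domX dy.
have XAx := AX dx; have XAy := AX dy.
pose u x h := ((h^-1)%:C)%C *: (T h x - x).
have c0 (z : E) : N (z - z) @[h --> (0:R)^'+] --> (0:R).
  by rewrite subrr (norm0 HX HB); exact: cvg_cst.
have H : F (u x h) y + F x (u y h) + h * F (u x h) (u y h) @[h --> 0^'+] -->
    F (A x) y + F x (A y) + 0 * F (A x) (A y).
  apply: cvgD; [apply: cvgD|apply: cvgM].
  - apply: (@form_cvg _ _ _ _ _ HX HB _ (u x) (fun=> y)) => //.
    + exact: X_quotient.
    + exact: nearW.
    + exact: diff_quotient.
  - apply: (@form_cvg _ _ _ _ _ HX HB _ (fun=> x) (u y)) => //.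
    + exact: nearW.
    + exact: X_quotient.
    + exact: diff_quotient.
  - by apply: cvg_at_right_filter; exact: cvg_id.
  - apply: (form_cvg HX HB) => //; try exact: X_quotient; exact: diff_quotient.
rewrite mul0r addr0 in H.
apply: (cvg_trans _ H); apply: near_eq_cvg; near=> h.
have h_gt0 : 0 < h by near: h; exact: near_right_gt0.
have h0 := ltW h_gt0.
have Xhx := TX h0 Xx; have Xhy := TX h0 Xy; case: bF => [lF _].
have Xdx := XB Xhx Xx; have Xdy := XB Xhy Xy.
rewrite /u !(form_scalel HX lF, form_scaler HX lF)//; last by apply: XZ.
rewrite !(form_subl lF)// !(form_subr lF)//.
by field; rewrite gt_eqF.
Unshelve. all: by end_near. Qed.

Lemma form_orbit_step F t x y eps : bounded_form X N F -> 0 <= t ->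
  domA x -> domA y -> 0 < eps ->
  exists2 d : R, 0 < d & forall h, 0 < h < d ->
    F (T (t + h) x) (T (t + h) y) <= F (T t x) (T t y) +
     (F (A (T t x)) (T t y) + F (T t x) (A (T t y)) + eps) * h.
Proof.
move=> bF t0 dx dy eps0.
have [dTx _] := T_commutes t0 dx; have [dTy _] := T_commutes t0 dy.
have Xx := domX dx; have Xy := domX dy.
have XTx := domX dTx; have XTy := domX dTy.
have /cvg_at_right0P/(_ _ eps0)[d d0 Hd] := form_right_derivative bF dTx dTy.
exists d => // h /[dup] /andP[h0 _] /Hd H.
have h0' := ltW h0.
have th0 : 0 <= t + h by lra.
rewrite (form_eqv HX bF (TX th0 Xx) (TX h0' XTx) (TX th0 Xy) (TX h0' XTy)); last 2 first.
- by rewrite [t + h]addrC TD.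
- by rewrite [t + h]addrC TD.
have := le_trans (ler_norm _) H; rewrite lerBlDr mulrC ler_pdivrMr//.
lra.
Qed.

(** * Decay from a static inequality *)

Section Decay.
Variables (F1 F2 : E -> E -> R) (C0 k0 : R).
Hypotheses (dissip : forall x, domA x -> B (A x) x <= 0)
  (A_onto : forall x, X x -> exists2 z, domA z & N (A z - x) = 0)
  (F1_bounded : bounded_form X N F1) (F2_bounded : bounded_form X N F2)
  (C0_gt0 : 0 < C0) (k0_gt0 : 0 < k0)
  (static : forall x k, domA x -> domA (A x) -> k0 <= k ->
     B x x + (F1 (A x) x + F1 x (A x)) + k^-1 * (F2 (A x) (A x) + F2 x (A (A x))) <=
     C0 * (k * - B (A x) x + k ^- 3 * - B (A (A x)) (A x))).

Let bB : bounded_form X N B. Proof. exact: bounded_formB HX HB. Qed.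
Let Bsym x y : X x -> X y -> B x y = B y x. Proof. by case: HB => _ + _ _; exact. Qed.

Lemma energy_nonincreasing x s t : domA x -> 0 <= s <= t ->
  B (T t x) (T t x) <= B (T s x) (T s x).
Proof.
move=> dx /andP[s0 st]; have Xx := domX dx.
apply: (@right_derivative_le0 _ (fun t => B (T t x) (T t x))) => // u /andP[su ut] eps eps0.
  have u0 : 0 < u by lra.
  have /cvg_at_right0P/(_ _ eps0)[d d0 Hd] := form_orbit_left bB u0 Xx Xx.
  exists d => // h /Hd; rewrite distrC => /(le_trans (ler_norm _)); lra.
have u0 : 0 <= u by lra.
have [d d0 Hd] := form_orbit_step bB u0 dx dx eps0.
exists d => // h /[dup] /andP[h0 _] /Hd H; apply: (le_trans H).
have [dT _] := T_commutes u0 dx.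
rewrite lerD2l ler_pM2r// (Bsym (domX dT) (AX dT)).
by have := dissip dT; lra.
Qed.

(* Integrates [static] along the orbit over (s, t); F1 and F2 contribute boundary terms
   only, which are bounded by energies. *)
Lemma energy_step : exists2 C : R, 0 < C & forall x s t k,
  domA x -> domA (A x) -> 0 <= s <= t -> k0 <= k ->
  (t - s) * B (T t x) (T t x) <=
    C * (k * B (T s x) (T s x) + k ^- 3 * B (T s (A x)) (T s (A x))).
Proof.
have [_ [C1 C10 H1]] := F1_bounded; have [_ [C2 C20 H2]] := F2_bounded.
have C0p := C0_gt0; have k0p := k0_gt0.
pose C3 := C0 + C1 / k0 + C2 + 1.
have C1k0 : 0 <= C1 / k0 by rewrite divr_ge0// ltW.
have C3gt0 : 0 < C3.
  by rewrite /C3; have := C0_gt0; move: C1k0; set q := C1 / k0; lra.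
exists (2 * C3); first by rewrite mulr_gt0.
move=> x s t k dx dAx /andP[s0 st] k0k.
have kpos : 0 < k by lra.
have kV : 0 < k^-1 by rewrite invr_gt0.
have k3 : 0 < k ^- 3 by rewrite invr_gt0 exprn_gt0.
have Xx := domX dx; have XAx := AX dx.
pose e u := B (T u x) (T u x); pose e1 u := B (T u (A x)) (T u (A x)).
pose f1 u := F1 (T u x) (T u x); pose f2 u := F2 (T u x) (T u (A x)).
(* The derivative of [e] is twice [B (A x) x] along the orbit, and likewise for [e1]: with the
   factor 1/2, the last two terms have the opposite of the right-hand side of [static] as
   derivative. *)
pose L u := f1 u + k^-1 * f2 u + C0 * k / 2 * e u + C0 * k ^- 3 / 2 * e1 u.
have e_ge0 u : 0 <= u -> 0 <= e u.
  by move=> u0; case: HB => _ _ H _; apply: H; exact: TX.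
have e1_ge0 u : 0 <= u -> 0 <= e1 u.
  by move=> u0; case: HB => _ _ H _; apply: H; exact: TX.
have Lbd u : 0 <= u -> `|L u| <= C3 * (k * e u + k ^- 3 * e1 u).
  move=> u0; have XT := TX u0 Xx; have XT1 := TX u0 XAx.
  have b1 : `|f1 u| <= C1 / k0 * (k * e u).
    apply: (le_trans (H1 _ _ XT XT)); rewrite -mulrA -expr2 (sqr_norm HB)// -/(e u).
    rewrite -mulrA; apply: ler_wpM2l => //; rewrite mulrA ler_peMl ?e_ge0//.
    by rewrite mulrC ler_pdivlMr// mul1r.
  have b2 : `|k^-1 * f2 u| <= C2 * (k * e u + k ^- 3 * e1 u).
    rewrite normrM (gtr0_norm kV).
    apply: (@le_trans _ _ (k^-1 * (C2 * N (T u x) * N (T u (A x))))).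
      by rewrite ler_pM2l// H2.
    rewrite /e /e1 -!(sqr_norm HB)//; set a := N _; set b := N _.
    have -> : k^-1 * (C2 * a * b) = C2 * (k^-1 * (a * b)) by ring.
    apply: ler_wpM2l => //.
    (* Young's inequality with k^-1 split as k^(1/2) k^(-3/2), the square roots of the weights of
       the two energies. *)
    have -> : k * a ^+ 2 + k ^- 3 * b ^+ 2 = k^-1 * (a * b) + k * (a - k^-1 ^+ 2 * b / 2) ^+ 2 + 3 / 4 * (k ^- 3 * b ^+ 2).
      by field; rewrite gt_eqF.
    rewrite -addrA lerDl addr_ge0// mulr_ge0//; try exact: sqr_ge0; try exact: ltW.
    by rewrite mulr_ge0 ?sqr_ge0// ltW.
  have b3 : `|C0 * k / 2 * e u| <= C0 * (k * e u).
    have p : 0 <= C0 * (k * e u) by apply: mulr_ge0; [exact: ltW|apply: mulr_ge0; [exact: ltW|exact: e_ge0]].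
    by rewrite (_ : C0 * k / 2 * e u = C0 * (k * e u) / 2); [rewrite ger0_norm; lra|ring].
  have b4 : `|C0 * k ^- 3 / 2 * e1 u| <= C0 * (k ^- 3 * e1 u).
    have p : 0 <= C0 * (k ^- 3 * e1 u).
      by apply: mulr_ge0; [exact: ltW|apply: mulr_ge0; [exact: ltW|exact: e1_ge0]].
    rewrite (_ : C0 * k ^- 3 / 2 * e1 u = C0 * (k ^- 3 * e1 u) / 2); last by ring.
    by rewrite ger0_norm; lra.
  have p1 : 0 <= k * e u by rewrite mulr_ge0 ?e_ge0// ltW.
  have p2 : 0 <= k ^- 3 * e1 u by rewrite mulr_ge0 ?e1_ge0// ltW.
  rewrite /L; apply: (le_trans (ler_normD _ _)).
  apply: (le_trans (lerD (ler_normD _ _) (lexx _))).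
  apply: (le_trans (lerD (lerD (ler_normD _ _) (lexx _)) (lexx _))).
  have q1 : 0 <= C1 / k0 * (k ^- 3 * e1 u) by rewrite mulr_ge0.
  rewrite /C3; lra.
(* By [static], [L] decreases at least at the rate [e u], and [e t <= e u] for [u <= t]; so adding
   [u * e t] leaves a nonincreasing function. *)
have key : L t + t * e t <= L s + s * e t.
  apply: (@right_derivative_le0 _ (fun u => L u + u * e t)) => // u /andP[su ut] eps eps0.
    have u0 : 0 < u by lra.
    have H : L (u - h) + (u - h) * e t @[h --> 0^'+] --> L u + u * e t.
      apply: cvgD; last first.
        apply: cvgMl; rewrite -[X in _ --> X]subr0; apply: cvgB; first exact: cvg_cst.
        by apply: cvg_at_right_filter; exact: cvg_id.
      apply: cvgD; [apply: cvgD; [apply: cvgD|]|]; try apply: cvgMr; exact: form_orbit_left.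
    have /cvg_at_right0P/(_ _ eps0)[d d0 Hd] := H.
    exists d => // h /Hd; rewrite distrC => /(le_trans (ler_norm _)); lra.
  have u0 : 0 <= u by lra.
  (* Total weight of the four forms in [L]: an error [ep] in each of their derivatives adds up to
     [w * ep = eps]. *)
  pose w := 1 + k^-1 + C0 * k / 2 + C0 * k ^- 3 / 2.
  have w0 : 0 < w.
    have := mulr_gt0 C0_gt0 kpos; have := mulr_gt0 C0_gt0 k3; rewrite /w; lra.
  pose ep := eps / w.
  have ep0 : 0 < ep by rewrite divr_gt0.
  have [d1 d10 Hd1] := form_orbit_step F1_bounded u0 dx dx ep0.
  have [d2 d20 Hd2] := form_orbit_step F2_bounded u0 dx dAx ep0.
  have [d3 d30 Hd3] := form_orbit_step bB u0 dx dx ep0.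
  have [d4 d40 Hd4] := form_orbit_step bB u0 dAx dAx ep0.
  exists (Num.min (Num.min d1 d2) (Num.min d3 d4)); first by rewrite !lt_min d10 d20 d30.
  move=> h /andP[h0]; rewrite !lt_min => /andP[/andP[hd1 hd2] /andP[hd3 hd4]].
  have := Hd1 h; rewrite h0 hd1 => /(_ isT).
  have := Hd2 h; rewrite h0 hd2 => /(_ isT).
  have := Hd3 h; rewrite h0 hd3 => /(_ isT).
  have := Hd4 h; rewrite h0 hd4 => /(_ isT).
  rewrite -/(f1 u) -/(f2 u) -/(e u) -/(e1 u) -/(f1 (u + h)) -/(f2 (u + h)) -/(e (u + h)) -/(e1 (u + h)).
  have [dT eT] := T_commutes u0 dx; have [dTA eTA] := T_commutes u0 dAx.
  have XT := domX dT; have XAT := AX dT; have XTA := domX dTA; have XATA := AX dTA.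
  (* The increments of the forms are expressed with [T u (A x)], while [static] speaks of
     [A (T u x)]; the rewritings below exchange the two inside each form. *)
  have [dAT eAA] := dom_eqv dTA XAT eT.
  have XAAT := AX dAT.
  have n0 z : N (z - z) = 0 by rewrite subrr (norm0 HX HB).
  have eT' : N (T u (A x) - A (T u x)) = 0 by rewrite (norm_dist HX HB).
  have eAA' : N (A (T u (A x)) - A (A (T u x))) = 0 by rewrite (norm_dist HX HB).
  rewrite (form_eqv HX F2_bounded XAT XAT XTA XAT (n0 _) eT').
  rewrite (form_eqv HX F2_bounded XT XT XATA XAAT (n0 _) eAA').
  rewrite (form_eqv HX bB XATA XAAT XTA XAT eAA' eT').
  rewrite (form_eqv HX bB XTA XAT XATA XAAT eT' eAA').
  rewrite (Bsym XT XAT) (Bsym XAT XAAT).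
  have := static dT dAT k0k.
  set g1 := F1 _ _ + F1 _ _; set g2 := F2 _ _ + F2 _ _.
  set b := B (A (T u x)) (T u x); set b1 := B (A (A (T u x))) (A (T u x)).
  rewrite -/(e u) => Hs i4 i3 i2 i1.
  have Het : e t <= e u by apply: energy_nonincreasing => //; rewrite u0 ltW.
  have j2 := ler_wpM2l (ltW kV) i2.
  have Ck : 0 <= C0 * k / 2 by rewrite divr_ge0// mulr_ge0// ltW.
  have Ck3 : 0 <= C0 * k ^- 3 / 2 by rewrite divr_ge0// mulr_ge0// ltW.
  have j3 := ler_wpM2l Ck i3.
  have j4 := ler_wpM2l Ck3 i4.
  have jt := ler_wpM2r (ltW h0) Het.
  have js := ler_wpM2r (ltW h0) Hs.
  have ew : eps = w * ep by rewrite /ep mulrC divfK ?gt_eqF.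
  rewrite ew /L /w.
  lra.
have b1 := Lbd s s0; have b2 := Lbd t (le_trans s0 st).
have m1 : e t <= e s by apply: energy_nonincreasing => //; rewrite s0.
have m2 : e1 t <= e1 s by apply: energy_nonincreasing => //; rewrite s0.
have b3 := le_trans (ler_norm _) b1.
have b4 := le_trans (ler_norm (- L t)) _; rewrite normrN in b4.
have {}b4 := b4 _ b2.
have m1' := ler_wpM2l (ltW kpos) m1; have m2' := ler_wpM2l (ltW k3) m2.
have C30 : 0 <= C3 by rewrite /C3; lra.
have m3 := ler_wpM2l C30 (lerD m1' m2').
rewrite -/(e t) -/(e s) -/(e1 s); lra.
Qed.

Lemma decay_domA2 : exists2 M : R, 0 < M & forall x t, domA x -> domA (A x) -> 0 <= t ->
  N (T t x) <= M / (1 + t) ^+ 2 * (N x + N (A x)).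
Proof.
have [C Cpos HC] := energy_step.
have [M M0 HM] := quartic_decay Cpos k0_gt0.
exists (Num.sqrt M); first by rewrite sqrtr_gt0.
move=> x t dx dAx t0.
have Xx := domX dx; have XAx := AX dx.
pose e u := B (T u x) (T u x).
pose K := B x x + B (A x) (A x).
have Bge0 z : X z -> 0 <= B z z by case: HB => _ _ + _; exact.
have at0 z : X z -> B (T 0 z) (T 0 z) = B z z.
  move=> Xz; rewrite -!(sqr_norm HB)//; last exact: TX.
  by rewrite (norm_eqv HX HB (TX (lexx 0) Xz) Xz (T0 Xz)).
have eK u : 0 <= u -> 0 <= e u <= K.
  move=> u0; apply/andP; split; first by apply: Bge0; exact: TX.
  apply: (@le_trans _ _ (B x x)); last by rewrite lerDl Bge0.
  by rewrite -(at0 _ Xx); apply: energy_nonincreasing => //; rewrite lexx.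
have rec : forall v k, 0 < v -> k0 <= k -> v * e (2 * v) <= C * (k * e v + k ^- 3 * K).
  move=> v k v0 k0k; have := HC x v (2 * v) k dx dAx ltac:(lra) k0k.
  have -> : 2 * v - v = v by ring.
  move=> /le_trans; apply; rewrite ler_pM2l// lerD2l ler_wpM2l//.
    by rewrite invr_ge0 exprn_ge0// (le_trans (ltW k0_gt0)).
  apply: (@le_trans _ _ (B (A x) (A x))); last by rewrite lerDr Bge0.
  rewrite -(at0 _ XAx); apply: energy_nonincreasing => //.
  by rewrite lexx ltW.
have := HM e K eK rec t t0; rewrite /e -(sqr_norm HB); last exact: TX.
have t1 : 0 < 1 + t by lra.
have XT := TX t0 Xx.
have n1 := norm_ge0 HB Xx; have n2 := norm_ge0 HB XAx; have n3 := norm_ge0 HB XT.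
have r0 : 0 <= Num.sqrt M / (1 + t) ^+ 2 * (N x + N (A x)).
  by rewrite mulr_ge0 ?divr_ge0 ?sqrtr_ge0 ?exprn_ge0 ?addr_ge0// ltW.
rewrite -(@ler_sqr _ (N _)) ?nnegrE// => /le_trans; apply.
rewrite exprMn expr_div_n sqr_sqrtr ?(ltW M0)// -exprM /=.
rewrite mulrAC; apply: ler_wpM2l.
  by apply: divr_ge0; [exact: ltW|apply: exprn_ge0; exact: ltW].
rewrite /K -!(sqr_norm HB)// sqrrD -addrA lerD2l lerDr.
by rewrite mulrn_wge0// mulr_ge0.
Qed.

(** Take [y] with [A y] equivalent to [x], and z = (T h y - y) / h. Then [A z] is equivalent to (T h
    x - x) / h, which lies in the domain because [x] does, and as h tends to 0 the limits of [z] and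
    [A z] are [x] and [A x]. *)
Lemma dense_domA2 x eps : domA x -> 0 < eps ->
  exists z, [/\ domA z, domA (A z), N (z - x) <= eps & N (A z - A x) <= eps].
Proof.
move=> dx eps0; have Xx := domX dx; have XAx := AX dx.
have [y dy ey] := A_onto Xx.
have Xy := domX dy; have XAy := AX dy.
have ey' : N (x - A y) = 0 by rewrite (norm_dist HX HB).
have [d1 d10 H1] := (cvg_at_right0P _ _).1 (diff_quotient dy) eps eps0.
have [d2 d20 H2] := (cvg_at_right0P _ _).1 (diff_quotient dx) eps eps0.
pose h := Num.min d1 d2 / 2.
have m0 : 0 < Num.min d1 d2 by rewrite lt_min d10.
have m1 : Num.min d1 d2 <= d1 by rewrite ge_min lexx.
have m2 : Num.min d1 d2 <= d2 by rewrite ge_min lexx orbT.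
have h0 : 0 < h by rewrite divr_gt0.
have h0' := ltW h0.
have := H1 h; rewrite /h => /(_ ltac:(lra)); rewrite -/h subr0 => {}H1.
have := H2 h; rewrite /h => /(_ ltac:(lra)); rewrite -/h subr0 => {}H2.
have {}H1 := le_trans (ler_norm _) H1.
have {}H2 := le_trans (ler_norm _) H2.
set k := (h^-1)%:C%C in H1 H2.
exists (k *: (T h y - y)).
have [dTy eTy] := T_commutes h0' dy.
have XTy := domX dTy; have XATy := AX dTy; have XTAy := TX h0' XAy; have XTx := TX h0' Xx.
have [dTx _] := T_commutes h0' dx.
have dd0 a b c : domA a -> domA b -> domA (c%:C%C *: (a - b)) /\ N (A (c%:C%C *: (a - b)) - c%:C%C *: (A a - A b)) = 0.
  move=> da db; have := dom_linear (-1) db da.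
  rewrite realN1 !scaleN1r [- b + a]addrC [- A b + A a]addrC => -[dab eab].
  have XX : domA 0 /\ N (A 0) = 0.
    have := dom_linear (-1) da da; rewrite realN1 !scaleN1r ![- _ + _]addrC !subrr subr0.
    by [].
  have [d00 e00] := XX.
  have := dom_linear c dab d00; rewrite addr0 => -[dc ec]; split=> //.
  have XA0 := AX d00; have XAab := AX dab; have XAc := AX dc.
  have XAB := XB (AX da) (AX db).
  have Xmid : X (c%:C%C *: A (a - b) + A 0) by exact: HX.2.
  have Xmid2 : X (c%:C%C *: A (a - b)) by exact: XZ.
  apply/eqP; rewrite eq_le (norm_ge0 HB) ?andbT; last by apply: XB => //; exact: XZ.
  apply: (le_trans (dist_trans HX HB XAc Xmid (XZ _ XAB))); rewrite ec add0r.
  apply: (le_trans (dist_trans HX HB Xmid Xmid2 (XZ _ XAB))).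
  rewrite addrAC subrr add0r e00 add0r -scalerBr (normZ HX HB) ?eab ?mulr0//.
  exact: XB.
have [dz ez] := dd0 _ _ h^-1 dTy dy.
have [dw ew] := dd0 _ _ h^-1 dTx dx; rewrite -/k in dz ez dw ew.
have Xz := domX dz; have XAz := AX dz; have Xw := domX dw.
have e1 : N (A (k *: (T h y - y)) - k *: (T h x - x)) = 0.
  have Xm := XZ k (XB XATy XAy).
  apply/eqP; rewrite eq_le (norm_ge0 HB) ?andbT; last exact: XB.
  apply: (le_trans (dist_trans HX HB XAz Xm Xw)); rewrite ez add0r -scalerBr (normZ HX HB).
    rewrite (_ : N _ = 0) ?mulr0//.
    have Xu1 := XB XATy XAy; have Xu2 := XB XTx Xx.
    apply/eqP; rewrite eq_le (norm_ge0 HB) ?andbT; last exact: XB.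
    have -> : A (T h y) - A y - (T h x - x) = (A (T h y) - T h x) - (A y - x).
      by rewrite opprD addrACA -opprD.
    apply: (le_trans (normB HX HB (XB XATy XTx) (XB XAy Xx))); rewrite ey addr0.
    apply: (le_trans (dist_trans HX HB XATy XTAy XTx)); rewrite eTy add0r.
    by rewrite T_eqv.
  by apply: XB => //; exact: XB.
split=> //.
- by have [] := dom_eqv dw XAz e1.
- apply: (le_trans (dist_trans HX HB Xz XAy Xx)); rewrite ey addr0//.
- apply: (le_trans (dist_trans HX HB XAz Xw XAx)); rewrite e1 add0r//.
Qed.

Theorem semigroup_decay : exists2 M : R, 0 < M & forall x t, domA x -> 0 <= t ->
  N (T t x) <= M / (1 + t) ^+ 2 * graph_norm N A x.
Proof.
have [M M0 HM] := decay_domA2; exists M => // x t dx t0.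
have Xx := domX dx; have XAx := AX dx; have XT := TX t0 Xx.
have [C Cge0 HC] := Tbd t0.
apply/ler_addgt0Pl => d d0.
pose r := M / (1 + t) ^+ 2.
have r0 : 0 <= r by rewrite divr_ge0 ?exprn_ge0 ?ltW//; lra.
(* Replacing [x] by [z] costs [C * eps] on the orbit and [2 * r * eps] on the graph norm. *)
pose eps := d / (C + 2 * r + 1).
have den : 0 < C + 2 * r + 1 by lra.
have eps0 : 0 < eps by rewrite divr_gt0.
have [z [dz dAz e1 e2]] := dense_domA2 dx eps0.
have Xz := domX dz; have XAz := AX dz; have XTz := TX t0 Xz.
have h1 := HM z t dz dAz t0.
have h2 := norm_le_dist HX HB XT XTz.
have h3 := orbit_dist t0 Xx Xz HC.
have h4 := norm_le_dist HX HB Xz Xx.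
have h5 := norm_le_dist HX HB XAz XAx.
rewrite (norm_dist HX HB Xx Xz) in h3.
have h6 := ler_wpM2l Cge0 e1.
rewrite /graph_norm -/r in h1 *.
have h7 : r * (N z + N (A z)) <= r * (2 * eps + (N x + N (A x))) by rewrite ler_wpM2l//; lra.
have h8 : C * eps + r * (2 * eps) <= d.
  rewrite (_ : _ + _ = d * ((C + 2 * r) / (C + 2 * r + 1))); last by rewrite /eps; field; rewrite gt_eqF.
  by rewrite ger_pMr// ler_pdivrMr// mul1r; lra.
lra.
Qed.

End Decay.
End Orbits.

(** * Integrals on bounded intervals *)

Section Intervals.
Context {R : realType}.
Implicit Types (a b c s t x y : R) (f g m F G : R -> R).
Notation mu := (@lebesgue_measure R).

Definition intg a b f := mu.-integrable `]a, b[ (EFin \o f).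
Definition II a b f : R := \int[mu]_(x in `]a, b[) f x.

Lemma intg_meas a b f : intg a b f -> measurable_fun `]a, b[ f.
Proof. by move/integrableP => [/measurable_EFinP]. Qed.

Lemma intgD a b f g : intg a b f -> intg a b g -> intg a b (f \+ g).
Proof.
move=> If Ig; rewrite /intg (_ : _ \o _ = (EFin \o f) \+ (EFin \o g))%E//.
exact: integrableD.
Qed.

Lemma intgZ a b c f : intg a b f -> intg a b (fun x => c * f x).
Proof. by move=> If; exact: (integrableZl _ c If). Qed.

Lemma intgN a b f : intg a b f -> intg a b (fun x => - f x).
Proof.
move=> /(intgZ (-1)) H; rewrite (_ : (fun x => - f x) = fun x => -1 * f x)//.
by apply/funext => x; rewrite mulN1r.
Qed.

Lemma intgB a b f g : intg a b f -> intg a b g -> intg a b (f \- g).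
Proof. by move=> If /intgN; exact: intgD. Qed.

Lemma mu_itv_lty a b : (mu `]a, b[ < +oo)%E.
Proof. by rewrite lebesgue_measure_itv/=; case: ifP => _; rewrite ?ltry// -EFinB ltry. Qed.

Lemma intg_cst a b c : intg a b (cst c).
Proof.
apply: measurable_bounded_integrable => //=; first exact: mu_itv_lty.
exists `|c|; split; first exact: num_real.
by move=> M cM x _; exact: ltW.
Qed.

Lemma itv_oo_sub a b s t : a <= s -> t <= b -> (`]s, t[%classic : set R) `<=` `]a, b[.
Proof.
move=> as_ tb x /=; rewrite !in_itv/= => /andP[sx xt].
by rewrite (le_lt_trans as_ sx) (lt_le_trans xt tb).
Qed.

Lemma intgS a b s t f : a <= s -> t <= b -> intg a b f -> intg s t f.
Proof. by move=> as_ tb; apply: integrableS => //; exact: itv_oo_sub. Qed.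

Lemma measS a b s t f : a <= s -> t <= b ->
  measurable_fun `]a, b[ f -> measurable_fun `]s, t[ f.
Proof. by move=> as_ tb; apply: measurable_funS => //; exact: itv_oo_sub. Qed.

Lemma eq_II a b f g : (forall x, a < x < b -> f x = g x) -> II a b f = II a b g.
Proof. by move=> fg; apply: eq_Rintegral => x; rewrite inE/= in_itv/= => /fg. Qed.

Lemma eq_intg a b f g : (forall x, a < x < b -> f x = g x) -> intg a b f -> intg a b g.
Proof.
move=> fg; apply: eq_integrable => // x; rewrite inE/= in_itv/= => /fg xx.
by rewrite /= xx.
Qed.

Lemma IID a b f g : intg a b f -> intg a b g ->
  II a b (fun x => f x + g x) = II a b f + II a b g.
Proof. by move=> If Ig; exact: RintegralD. Qed.

Lemma IIB a b f g : intg a b f -> intg a b g ->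
  II a b (fun x => f x - g x) = II a b f - II a b g.
Proof. by move=> If Ig; exact: RintegralB. Qed.

Lemma IIZ a b c f : intg a b f -> II a b (fun x => c * f x) = c * II a b f.
Proof. by move=> If; exact: RintegralZl. Qed.

Lemma II_cst a b c : a <= b -> II a b (cst c) = c * (b - a).
Proof.
move=> ab; rewrite /II Rintegral_cst//= lebesgue_measure_itv/= lte_fin.
move: ab; rewrite le_eqVlt => /predU1P[->|->]; last by rewrite -EFinB.
by rewrite ltxx subrr.
Qed.

Lemma II_empty a b f : b <= a -> II a b f = 0.
Proof.
by move=> ba; rewrite /II set_itv_ge ?Rintegral_set0// bnd_simp -leNgt.
Qed.

Lemma II_split a b c f : a <= c -> c <= b -> intg a b f ->
  II a b f = II a c f + II c b f.
Proof.
rewrite le_eqVlt => /predU1P[<- _ _|ac]; first by rewrite (II_empty f (lexx a)) add0r.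
rewrite le_eqVlt => /predU1P[-> _|cb If]; first by rewrite (II_empty f (lexx b)) addr0.
have Ic : intg a c f by apply: intgS If; rewrite // ltW.
have := @Rintegral_itvB R f (BRight a) (BLeft b) c If.
rewrite !bnd_simp (ltW ac) cb => /(_ isT isT) E.
rewrite /II -E (Rintegral_itv_bndo_bndc Ic).
by rewrite addrC subrK.
Qed.

Lemma II_ge0 a b f : (forall x, a < x < b -> 0 <= f x) -> 0 <= II a b f.
Proof. by move=> f0; apply: Rintegral_ge0 => x /=; rewrite in_itv/= => /f0. Qed.

Lemma ae_imp (P Q : R -> Prop) : (forall x, P x -> Q x) ->
  {ae mu, forall x, P x} -> {ae mu, forall x, Q x}.
Proof.
move=> PQ [A [mA A0 sub]]; exists A; split => // x /= nQ.
by apply: sub => /= Px; apply: nQ; exact: PQ.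
Qed.

Lemma ae_and (P Q : R -> Prop) : {ae mu, forall x, P x} -> {ae mu, forall x, Q x} ->
  {ae mu, forall x, P x /\ Q x}.
Proof.
move=> HP HQ; apply: negligibleS (negligibleU HP HQ) => x /= /not_andP[nP|nQ].
  by left.
by right.
Qed.

Lemma II_ae a b f g : measurable_fun `]a, b[ f -> measurable_fun `]a, b[ g ->
  ae_on a b (fun x => f x = g x) -> II a b f = II a b g.
Proof.
move=> mf mg fg; congr fine; apply: ae_eq_integral => //.
- exact/measurable_EFinP.
- exact/measurable_EFinP.
- apply: ae_imp fg => x H; by rewrite /= in_itv/= => /H ->.
Qed.

Lemma intg_ae a b f g : measurable_fun `]a, b[ g ->
  ae_on a b (fun x => f x = g x) -> intg a b f -> intg a b g.
Proof.
move=> mg fg If; have mf := intg_meas If.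
move/integrableP : If => [_ If]; apply/integrableP; split; first exact/measurable_EFinP.
rewrite (_ : integral _ _ _ = (\int[mu]_(x in `]a, b[) `|(EFin \o f) x|)%E)//.
apply: ae_eq_integral => //.
- by apply: measurableT_comp => //; exact/measurable_EFinP.
- by apply: measurableT_comp => //; exact/measurable_EFinP.
- apply: ae_imp fg => x H; by rewrite /= in_itv/= => /H ->.
Qed.

Lemma ae_onW a b (P : R -> Prop) : (forall x, a < x < b -> P x) -> ae_on a b P.
Proof. by move=> H; apply: aeW. Qed.

Lemma ae_on_imp a b (P Q : R -> Prop) : (forall x, a < x < b -> P x -> Q x) ->
  ae_on a b P -> ae_on a b Q.
Proof.
move=> PQ; by apply: ae_imp => x H xab; apply: PQ => //; exact: H.
Qed.

Lemma ae_on_imp2 a b (P P' Q : R -> Prop) : (forall x, a < x < b -> P x -> P' x -> Q x) ->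
  ae_on a b P -> ae_on a b P' -> ae_on a b Q.
Proof.
move=> PQ h1 h2; apply: ae_imp (ae_and h1 h2) => x [H H'] xab.
by apply: PQ => //; [exact: H|exact: H'].
Qed.

Lemma ae_on_and a b (P Q : R -> Prop) : ae_on a b P -> ae_on a b Q ->
  ae_on a b (fun x => P x /\ Q x).
Proof. exact: ae_on_imp2. Qed.

Lemma ae_onS a b s t (P : R -> Prop) : a <= s -> t <= b -> ae_on a b P -> ae_on s t P.
Proof.
move=> as_ tb; apply: ae_imp => x H /andP[sx xt]; apply: H.
by rewrite (le_lt_trans as_ sx) (lt_le_trans xt tb).
Qed.

Lemma ae_on_split a b c (P : R -> Prop) : ae_on a c P -> ae_on c b P -> ae_on a b P.
Proof.
have : {ae mu, forall x, x != c}.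
  exists [set c]; split => //; first by rewrite lebesgue_measure_set1.
  by move=> x /= /negP; rewrite negbK => /eqP.
move=> H0 H1 H2; apply: ae_imp (ae_and H0 (ae_and H1 H2)) => x [xc [h1 h2]] /andP[ax xb]; case: (ltgtP x c) xc => // xc _.
  by apply: h1; rewrite ax.
by apply: h2; rewrite xc.
Qed.

Lemma le_II a b f g : intg a b f -> intg a b g ->
  ae_on a b (fun x => f x <= g x) -> II a b f <= II a b g.
Proof.
move=> If Ig fg; rewrite -subr_ge0 -IIB//.
have Im := intgB Ig If.
rewrite (@II_ae a b _ (fun x => `|g x - f x|)).
- exact: II_ge0.
- exact: intg_meas Im.
- by apply: measurableT_comp => //; exact: intg_meas Im.
- by apply: ae_on_imp fg => x _ h; rewrite ger0_norm// subr_ge0.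
Qed.

Lemma II_ae_ge0 a b f : intg a b f -> ae_on a b (fun x => 0 <= f x) -> 0 <= II a b f.
Proof.
move=> If f0; rewrite [leLHS](_ : 0 = II a b (cst 0)); last first.
  by rewrite /II /Rintegral integral0.
by apply: le_II => //; exact: intg_cst.
Qed.

(** Truncation at the levels [- c] and [c] gives an everywhere bounded function that differs from
    [f] on a null set only. The same device serves for products in [intg_mul_bnd]. *)
Lemma intg_bnd a b (c : R) f : measurable_fun `]a, b[ f ->
  ae_on a b (fun x => `|f x| <= c) -> intg a b f.
Proof.
move=> mf bf.
pose g x := Num.max (- c) (Num.min (f x) c).
have mg : measurable_fun `]a, b[ g.
  by apply: measurable_maxr => //; apply: measurable_minr.
apply: (@intg_ae a b g) => //.
  apply: ae_on_imp bf => x _; rewrite ler_norml /g => /andP[h1 h2].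
  by rewrite (min_idPl h2) (max_idPr h1).
apply: measurable_bounded_integrable => //=.
  exact: mu_itv_lty.
exists `|c|; split; first exact: num_real.
move=> M cM x _; apply: le_trans (ltW cM); rewrite ler_norml /g.
rewrite le_max ge_max ge_min.
have := ler_norm c; have := ler_norm (- c); rewrite normrN => h1 h2.
by rewrite lerN2 h1/= h2/= orbT.
Qed.

Lemma intg_mul_bnd a b (c : R) f m : measurable_fun `]a, b[ m ->
  ae_on a b (fun x => `|m x| <= c) -> intg a b f -> intg a b (fun x => m x * f x).
Proof.
move=> mm bm If.
pose g x := Num.max (- c) (Num.min (m x) c).
have mg : measurable_fun `]a, b[ g.
  by apply: measurable_maxr => //; apply: measurable_minr.
apply: (@intg_ae a b (fun x => f x * g x)).
- by apply: measurable_funM => //; exact: intg_meas.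
- apply: ae_on_imp bm => x _; rewrite ler_norml /g => /andP[h1 h2].
  by rewrite (min_idPl h2) (max_idPr h1) mulrC.
rewrite /intg (_ : EFin \o _ = ((EFin \o f) \* (EFin \o g))%E)//.
apply: integrableMl => //.
exists `|c|; split; first exact: num_real.
move=> M cM x _; apply: le_trans (ltW cM); rewrite ler_norml /g.
rewrite le_max ge_max ge_min.
have := ler_norm c; have := ler_norm (- c); rewrite normrN => h1 h2.
by rewrite lerN2 h1/= h2/= orbT.
Qed.

Definition L2 a b f := measurable_fun `]a, b[ f /\ intg a b (fun x => f x ^+ 2).

Lemma L2_mul a b f g : L2 a b f -> L2 a b g -> intg a b (fun x => f x * g x).
Proof.
move=> [mf If] [mg Ig].
have I := intgD If Ig.
apply: le_integrable I => //.
  by apply/measurable_EFinP; exact: measurable_funM.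
move=> x _ /=; rewrite lee_fin normrM [leRHS]ger0_norm ?addr_ge0 ?sqr_ge0//.
rewrite -[f x ^+ 2]real_normK ?num_real// -[g x ^+ 2]real_normK ?num_real//.
have := sqr_ge0 (`|f x| - `|g x|); have := normr_ge0 (f x); have := normr_ge0 (g x); nra.
Qed.

Lemma L2_cst a b c : L2 a b (cst c).
Proof. by split; [exact: measurable_cst|exact: (intg_cst a b (c ^+ 2))]. Qed.

Lemma L2_intg a b f : L2 a b f -> intg a b f.
Proof.
move=> Lf; have := L2_mul (L2_cst a b 1) Lf; apply: eq_intg => x _.
by rewrite mul1r.
Qed.

Lemma L2_mul_bnd a b (c : R) f m : measurable_fun `]a, b[ m ->
  ae_on a b (fun x => `|m x| <= c) -> L2 a b f -> L2 a b (fun x => m x * f x).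
Proof.
move=> mm bm [mf If]; split; first exact: measurable_funM.
apply: (@eq_intg a b (fun x => m x ^+ 2 * f x ^+ 2)); first by move=> x _; rewrite exprMn.
apply: (@intg_mul_bnd _ _ (c ^+ 2)) => //; first by exact: measurable_funX.
apply: ae_on_imp bm => x _ h; rewrite normrX lerXn2r ?nnegrE//.
exact: le_trans h.
Qed.

Lemma L2D a b f g : L2 a b f -> L2 a b g -> L2 a b (fun x => f x + g x).
Proof.
move=> Lf Lg; have Ifg := L2_mul Lf Lg; case: Lf Lg => [mf If] [mg Ig].
split; first exact: measurable_funD.
apply: eq_intg (intgD (intgD If Ig) (intgZ 2 Ifg)) => x _ /=; ring.
Qed.

Lemma L2Z a b c f : L2 a b f -> L2 a b (fun x => c * f x).
Proof.
move=> [mf If]; split; first exact: measurable_funM.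
by apply: eq_intg (intgZ (c ^+ 2) If) => x _ /=; ring.
Qed.

Lemma L2B a b f g : L2 a b f -> L2 a b g -> L2 a b (fun x => f x - g x).
Proof.
move=> Lf /(L2Z (-1)) Lg.
have E : (fun x => f x - g x) = (fun x => f x + -1 * g x).
  by apply/funext => x; rewrite mulN1r.
by rewrite E; exact: L2D.
Qed.

Lemma L2S a b s t f : a <= s -> t <= b -> L2 a b f -> L2 s t f.
Proof.
move=> as_ tb [mf If]; split; [exact: measS mf|exact: intgS If].
Qed.

Lemma L2_ae a b f g : measurable_fun `]a, b[ g ->
  ae_on a b (fun x => f x = g x) -> L2 a b f -> L2 a b g.
Proof.
move=> mg fg [mf If]; split => //; apply: intg_ae If; first exact: measurable_funX.
by apply: ae_on_imp fg => x _ ->.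
Qed.

Lemma L2_bnd a b (c : R) f : measurable_fun `]a, b[ f ->
  ae_on a b (fun x => `|f x| <= c) -> L2 a b f.
Proof.
move=> mf bf; have := L2_mul_bnd mf bf (L2_cst a b 1).
by apply: L2_ae => //; apply: ae_onW => x _; rewrite mulr1.
Qed.

Lemma meas_glue a b c f g : measurable_fun `]a, c[ f -> measurable_fun `]c, b[ g ->
  measurable_fun `]a, b[ (fun x => if x < c then f x else g x).
Proof.
move=> mf mg.
apply: (@measurable_funS _ _ _ _ ((`]a, c[ `|` `]c, b[) `|` [set c])).
- by apply: measurableU => //; exact: measurableU.
- move=> x /=; rewrite !in_itv/= => /andP[ax xb].
  by case: (ltgtP x c) => xc; [left; left; rewrite ax|left; right|right].
apply/measurable_funU => //; first exact: measurableU.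
split; last exact: measurable_fun_set1.
apply/measurable_funU => //; split.
- apply: eq_measurable_fun mf => x; rewrite inE/= in_itv/= => /andP[_ ->].
  by [].
- apply: eq_measurable_fun mg => x; rewrite inE/= in_itv/= => /andP[cx _].
  by rewrite ltNge (ltW cx).
Qed.

End Intervals.

(** * Primitives *)

Section Primitives.
Context {R : realType}.
Implicit Types (a b c s t x y : R) (f g m F G : R -> R).
Notation mu := (@lebesgue_measure R).

Lemma intg_restrict a b f : intg a b f ->
  mu.-integrable setT (EFin \o (f \_ `]a, b[)).
Proof.
move=> If; rewrite -restrict_EFin.
by apply/integrable_restrict => //=; rewrite setTI.
Qed.

Lemma II_restrict a b x f : intg a b f -> x <= b ->
  II a x f = \int[mu]_(t in `[a, x]) (f \_ `]a, b[) t.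
Proof.
move=> If xb; have Ir := intg_restrict If.
rewrite -Rintegral_itv_obnd_cbnd; last by apply: integrableS Ir.
rewrite -Rintegral_itv_bndo_bndc; last by apply: integrableS Ir.
apply: eq_Rintegral => t; rewrite inE/= in_itv/= => /andP[at_ tx].
by rewrite patchE ifT// inE/= in_itv/= at_ (lt_le_trans tx xb).
Qed.

Lemma II_continuous a b f : a <= b -> intg a b f ->
  {within `[a, b], continuous (fun x => II a x f)}.
Proof.
move=> ab If; have Ir := intg_restrict If.
have Ir' : mu.-integrable `[a, b] (EFin \o (f \_ `]a, b[)) by apply: integrableS Ir.
have := parameterized_integral_continuous ab Ir'.
apply: subspace_eq_continuous => x; rewrite inE/= in_itv/= => /andP[ax xb].
by rewrite /from_subspace /= /parameterized_integral (II_restrict If xb).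
Qed.

Lemma intg_norm a b f : intg a b f -> intg a b (fun x => `|f x|).
Proof. by move=> If; exact: integrable_norm. Qed.

Lemma norm_II a b f : intg a b f -> `|II a b f| <= II a b (fun x => `|f x|).
Proof. by move=> If; exact: le_normr_Rintegral. Qed.

Lemma le_II_sub a b s t f : a <= s -> s <= t -> t <= b -> intg a b f ->
  ae_on a b (fun x => 0 <= f x) -> II s t f <= II a b f.
Proof.
move=> as_ st tb If f0; have sb := le_trans st tb.
rewrite (II_split as_ sb If) (II_split st tb (intgS as_ (lexx b) If)).
have h1 := II_ae_ge0 (intgS (lexx a) sb If) (ae_onS (lexx a) sb f0).
have h2 := II_ae_ge0 (intgS (le_trans as_ st) (lexx b) If) (ae_onS (le_trans as_ st) (lexx b) f0).
lra.
Qed.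

Lemma norm_II_le a b x f : a <= x <= b -> intg a b f ->
  `|II a x f| <= II a b (fun x => `|f x|).
Proof.
move=> /andP[ax xb] If; apply: (le_trans (norm_II (intgS (lexx a) xb If))).
by apply: le_II_sub => //; [exact: intg_norm|apply: ae_onW].
Qed.

Lemma II_meas a b f : intg a b f -> measurable_fun `]a, b[ (fun x => II a x f).
Proof.
move=> If; have [ab|ba] := ltP a b; last first.
  by rewrite set_itv_ge; [exact: measurable_fun_set0|rewrite bnd_simp -leNgt].
apply: (@measurable_funS _ _ _ _ `[a, b]%classic) => //.
  exact: subset_itv_oo_cc.
by apply: subspace_continuous_measurable_fun => //; apply: II_continuous => //; exact: ltW.
Qed.

(** Integration by parts without derivatives: over the triangle [y < x] the two iterated integrals
    of [f x * g y] coincide. One is the first term, the other is [II a b f * II a b g] minus the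
    second. *)
Lemma II_Fubini a b f g : a <= b -> intg a b f -> intg a b g ->
  II a b (fun x => f x * II a x g) + II a b (fun x => II a x f * g x) =
  II a b f * II a b g.
Proof.
move=> ab If Ig.
pose fr := f \_ `]a, b[; pose gr := g \_ `]a, b[.
have Ifr := intg_restrict If; have Igr := intg_restrict Ig.
rewrite -/fr in Ifr; rewrite -/gr in Igr.
have mfr : measurable_fun setT fr by case/integrableP : Ifr => /measurable_EFinP.
have mgr : measurable_fun setT gr by case/integrableP : Igr => /measurable_EFinP.
pose GR := measurableTypeR R.
pose chi (z : GR * GR) : R := (z.2 < z.1)%R%:R.
have mchi : measurable_fun setT chi.
  apply: (@measurableT_comp _ _ _ _ _ _ (fun b : bool => b%:R : R) _ (fun z : GR * GR => (z.2 < z.1)%R)) => //.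
  exact: measurable_fun_ltr.
pose H (z : GR * GR) : \bar R := (fr z.1 * gr z.2 * chi z)%:E.
have mH : measurable_fun setT H.
  apply/measurable_EFinP; apply: measurable_funM => //.
  apply: measurable_funM; first exact: measurableT_comp mfr measurable_fst.
  exact: measurableT_comp mgr measurable_snd.
have chi01 z : 0 <= chi z <= 1 by rewrite /chi; case: (_ < _); rewrite lexx ler01.
have mafr : measurable_fun setT (fun x => `|fr x|%:E).
  by apply/measurable_EFinP; exact: measurableT_comp.
have magr : measurable_fun setT (fun x => `|gr x|%:E).
  by apply/measurable_EFinP; exact: measurableT_comp.
have IH : (mu \x mu)%E.-integrable setT H.
  apply/(integrable12ltyP mu mu mH).
  apply: (@le_lt_trans _ _ (\int[mu]_x (`|fr x|%:E * \int[mu]_y `|gr y|%:E))%E).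
    apply: ge0_le_integral => //.
    - by move=> x _; apply: integral_ge0.
    - have mabs : measurable_fun setT (abse \o H) by exact: measurableT_comp.
      have := measurable_fun_fubini_tonelli_F (m2 := mu) (abse \o H).
      rewrite /fubini_F; apply => // z; exact: abse_ge0.
    - exact: emeasurable_funM.
    move=> x _; rewrite -ge0_integralZl//.
    apply: ge0_le_integral => //.
    - by apply: measurableT_comp => //; exact: measurableT_comp mH (pair1_measurable _).
    - exact: emeasurable_funM.
    move=> y _; rewrite /H /= -EFinM lee_fin !normrM ler_piMr ?mulr_ge0//.
    by have /andP[c0 c1] := chi01 (x, y); rewrite ger0_norm.
  rewrite ge0_integralZr//; last exact: integral_ge0.
  case/integrableP : Ifr => _ hf; case/integrableP : Igr => _ hg.
  by rewrite lte_mul_pinfty ?integral_ge0// ge0_fin_numE ?integral_ge0.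
have := Fubini IH.
have inner (h : R -> R) (k : R) s t : intg s t h ->
    (\int[mu]_y (k * (h \_ `]s, t[) y)%:E = (k * II s t h)%:E)%E.
  move=> Ih; have Ihr := intg_restrict Ih.
  rewrite -[LHS]fineK; last by apply: integrable_fin_num => //; exact: (integrableZl _ k Ihr).
  congr EFin; rewrite /II Rintegral_mkcond.
  exact: (RintegralZl _ _ Ihr).
have -> : (\int[mu]_x \int[mu]_y H (x, y) = \int[mu]_x (fr x * II a x g)%:E)%E.
  apply: eq_integral => x _.
  have [xab|xab] := boolP (x \in `]a, b[); last first.
    have fx0 : fr x = 0 by rewrite /fr patchE ifF//; apply/negP; rewrite inE; exact/negP.
    rewrite fx0 mul0r; apply: integral0_eq => y _.
    by rewrite /H /= fx0 !mul0r.
  move: xab; rewrite in_itv/= => /andP[ax xb].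
  rewrite -inner; last by apply: intgS Ig => //; exact: ltW.
  apply: eq_integral => y _; rewrite /H /= -mulrA; congr (_ * _)%:E.
  rewrite /gr /chi /= !patchE !mem_setE !in_itv/=.
  case: (ltP y x) => yx; rewrite ?andbT ?andbF ?mulr0 ?mulr1//.
  by rewrite (lt_trans yx xb) andbT.
have -> : (\int[mu]_y \int[mu]_x H (x, y) = \int[mu]_y (gr y * II y b f)%:E)%E.
  apply: eq_integral => y _.
  have [yab|yab] := boolP (y \in `]a, b[); last first.
    have gy0 : gr y = 0 by rewrite /gr patchE ifF//; apply/negP; rewrite inE; exact/negP.
    rewrite gy0 mul0r; apply: integral0_eq => x _.
    by rewrite /H /= gy0 mulr0 mul0r.
  move: yab; rewrite in_itv/= => /andP[ay yb].
  rewrite -inner; last by apply: intgS If => //; exact: ltW.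
  apply: eq_integral => x _; rewrite /H /= [fr x * _]mulrC -mulrA; congr (_ * _)%:E.
  rewrite /fr /chi /= !patchE !mem_setE !in_itv/=.
  case: (ltP y x) => yx; rewrite ?andbT ?andbF ?mulr0 ?mulr1//.
  by rewrite (lt_trans ay yx).
move=> /(congr1 fine).
have E1 : fine (\int[mu]_x (fr x * II a x g)%:E) = II a b (fun x => f x * II a x g).
  rewrite /II [RHS]Rintegral_mkcond; congr fine; apply: eq_integral => x _.
  by rewrite /fr !patchE; case: ifP => //; rewrite mul0r.
have E2 : fine (\int[mu]_y (gr y * II y b f)%:E) = II a b (fun y => g y * II y b f).
  rewrite /II [RHS]Rintegral_mkcond; congr fine; apply: eq_integral => x _.
  by rewrite /gr !patchE; case: ifP => //; rewrite mul0r.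
rewrite E1 E2 => ->.
have I3 : intg a b (fun x => II a x f * g x).
  apply: (@intg_mul_bnd _ _ _ (II a b (fun x => `|f x|))) => //; first exact: II_meas.
  by apply: ae_onW => x /andP[ax xb]; apply: norm_II_le; rewrite // !ltW.
rewrite (@eq_II _ _ _ _ (fun y => II a b f * g y - II a y f * g y)); last first.
  move=> y /andP[ay yb]; rewrite (II_split (ltW ay) (ltW yb) If); ring.
by rewrite IIB ?IIZ ?subrK//; exact: intgZ.
Qed.

(** Absolute continuity on the closed interval, with derivative [f], in integrated form: no
    pointwise derivative has to be handled, and endpoint values are included. *)
Definition prim a b f F : Prop :=
  intg a b f /\ forall x, a <= x <= b -> F x = F a + II a x f.

Lemma prim_sub a b s t f F : prim a b f F -> a <= s -> s <= t -> t <= b ->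
  II s t f = F t - F s.
Proof.
move=> [If HF] as_ st tb; rewrite (HF t) ?(HF s); [|lra|lra].
by rewrite (II_split as_ st (intgS (lexx a) tb If)); ring.
Qed.

Lemma primS a b s t f F : prim a b f F -> a <= s -> t <= b -> prim s t f F.
Proof.
move=> HF as_ tb; split; first by apply: (intgS as_ tb); case: HF.
by move=> x /andP[sx xt]; rewrite (prim_sub HF)//; [ring|lra].
Qed.

Lemma prim_cst a b c : prim a b (cst 0) (cst c).
Proof.
split; first exact: intg_cst.
by move=> x /andP[ax xb]; rewrite II_cst// mul0r addr0.
Qed.

Lemma prim_id a b : prim a b (cst 1) id.
Proof.
split; first exact: intg_cst.
by move=> x /andP[ax xb]; rewrite II_cst// mul1r addrC subrK.
Qed.

Lemma primD a b f F g G : prim a b f F -> prim a b g G ->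
  prim a b (fun x => f x + g x) (fun x => F x + G x).
Proof.
move=> [If HF] [Ig HG]; split; first exact: intgD.
move=> x /[dup] xab /andP[ax xb]; rewrite HF// HG// IID; [ring| |].
- exact: intgS If.
- exact: intgS Ig.
Qed.

Lemma primZ a b c f F : prim a b f F -> prim a b (fun x => c * f x) (fun x => c * F x).
Proof.
move=> [If HF]; split; first exact: intgZ.
move=> x /[dup] xab /andP[ax xb]; rewrite HF// IIZ; [ring|].
exact: intgS If.
Qed.

Lemma eq_prim a b f F g G : prim a b f F -> (forall x, a < x < b -> f x = g x) ->
  (forall x, a <= x <= b -> F x = G x) -> prim a b g G.
Proof.
move=> [If HF] fg FG; split; first exact: eq_intg If.
move=> x /[dup] xab /andP[ax xb]; rewrite -!FG//; last by rewrite lexx (le_trans ax).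
rewrite HF//; congr (_ + _); apply: eq_II => y /andP[ay yx]; apply: fg.
by rewrite ay (lt_le_trans yx).
Qed.

Lemma prim_II a b f : intg a b f -> prim a b f (fun x => II a x f).
Proof. by move=> If; split=> // x _; rewrite (II_empty _ (lexx a)) add0r. Qed.

Lemma prim_bounded a b f F : prim a b f F ->
  exists2 M, 0 <= M & forall x, a <= x <= b -> `|F x| <= M.
Proof.
move=> [If HF]; exists (`|F a| + II a b (fun x => `|f x|)).
  by rewrite addr_ge0// II_ge0.
move=> x xab; rewrite HF//; apply: (le_trans (ler_normD _ _)).
by rewrite lerD2l norm_II_le.
Qed.

Lemma prim_meas a b f F : prim a b f F -> measurable_fun `]a, b[ F.
Proof.
move=> [If HF]; apply: (@eq_measurable_fun _ _ _ _ `]a, b[%classic (fun x => F a + II a x f)).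
  move=> x; rewrite inE/= in_itv/= => /andP[ax xb].
  by rewrite (HF x)// (ltW ax) ltW.
by apply: measurable_funD => //; exact: II_meas.
Qed.

Lemma prim_L2 a b f F : prim a b f F -> L2 a b F.
Proof.
move=> PF; have [M M0 HM] := prim_bounded PF.
apply: (@L2_bnd _ _ _ M); first exact: prim_meas PF.
by apply: ae_onW => x /andP[ax xb]; apply: HM; rewrite !ltW.
Qed.

Lemma intg_mul_prim a b f g G : intg a b f -> prim a b g G ->
  intg a b (fun x => f x * G x).
Proof.
move=> If PG; have [M M0 HM] := prim_bounded PG.
apply: (@eq_intg _ a b (fun x => G x * f x)); first by move=> x _; rewrite mulrC.
apply: (@intg_mul_bnd _ _ _ M) => //; first exact: prim_meas PG.
by apply: ae_onW => x /andP[ax xb]; apply: HM; rewrite !ltW.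
Qed.

(** Leibniz rule: once the constants [F a] and [G a] are subtracted, it is [II_Fubini] on the
    interval from [a] to [x]. *)
Lemma prim_mul a b f F g G : prim a b f F -> prim a b g G ->
  prim a b (fun x => f x * G x + F x * g x) (fun x => F x * G x).
Proof.
move=> PF PG; have [If HF] := PF; have [Ig HG] := PG.
have I1 := intg_mul_prim If PG.
have I2 : intg a b (fun x => F x * g x).
  by apply: eq_intg (intg_mul_prim Ig PF) => x _; rewrite mulrC.
split; first exact: intgD.
move=> x /[dup] xab /andP[ax xb].
have ab := le_trans ax xb.
have If' := intgS (lexx a) xb If; have Ig' := intgS (lexx a) xb Ig.
have PF' := prim_II If'; have PG' := prim_II Ig'.
have J1 : intg a x (fun y => f y * II a y g) := intg_mul_prim If' PG'.
have J2 : intg a x (fun y => II a y f * g y).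
  by apply: eq_intg (intg_mul_prim Ig' PF') => y _; rewrite mulrC.
rewrite [II a x _](@eq_II _ _ _ _ (fun y => (G a * f y + F a * g y) + (f y * II a y g + II a y f * g y))); last first.
  move=> y /andP[ay yx]; rewrite (HF y) ?(HG y); [ring|lra|lra].
rewrite IID; [|by apply: intgD; exact: intgZ|exact: intgD].
rewrite !IID//; [|exact: intgZ|exact: intgZ].
by rewrite II_Fubini// !IIZ// (HF x)// (HG x)//; ring.
Qed.

End Primitives.

(** * Quadratic forms on square integrable functions *)

Lemma discriminant_le0 {R : realFieldType} (a b c : R) :
  (forall t, 0 <= a + 2 * t * b + t ^+ 2 * c) -> b ^+ 2 <= a * c.
Proof.
move=> H.
have a0 : 0 <= a by have := H 0; rewrite mulr0 mul0r expr0n/= mul0r !addr0.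
have c0 : 0 <= c.
  rewrite leNgt; apply/negP => c0.
  (* Adding the values at two opposite points removes [b]; at this distance the negative term in [c]
     outweighs [a]. *)
  have [h1 h2] := (H ((a + 1) / - c + 1), H (- ((a + 1) / - c + 1))).
  have k0 : 0 < - c by lra.
  have kE : (a + 1) / - c * c = - (a + 1) by field; lra.
  have kp : 0 < (a + 1) / - c by rewrite divr_gt0//; lra.
  move: h1 h2 kE kp; set k := _ / _ => h1 h2 kE kp.
  have : 0 <= a + (k + 1) ^+ 2 * c by lra.
  have -> : (k + 1) ^+ 2 * c = (k * c) * k + 2 * (k * c) + c by ring.
  by rewrite kE; nra.
have [cE|cn0] := eqVneq c 0.
  have [->|b0] := eqVneq b 0; first by rewrite cE expr0n mulr0.
  have := H (- (a + 1) / (2 * b)); rewrite cE mulr0 addr0.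
  have -> : 2 * (- (a + 1) / (2 * b)) * b = - (a + 1) by field.
  lra.
have cp : 0 < c by rewrite lt_neqAle eq_sym cn0.
have := H (- b / c).
have -> : a + 2 * (- b / c) * b + (- b / c) ^+ 2 * c = (a * c - b ^+ 2) / c by field.
by rewrite pmulr_lge0 ?invr_gt0// subr_ge0.
Qed.

Section L2Forms.
Context {R : realType}.
Variable L : R.
Hypothesis L_gt0 : 0 < L.
Implicit Types (f g h m q v : R -> R) (F : (R -> R) -> (R -> R) -> R).

Definition sqn f := II 0 L (fun x => f x ^+ 2).
Definition nrm f := Num.sqrt (sqn f).

Lemma sqn_ge0 f : 0 <= sqn f.
Proof. by apply: II_ge0 => x _; exact: sqr_ge0. Qed.

Lemma sqr_nrm f : nrm f ^+ 2 = sqn f.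
Proof. by rewrite sqr_sqrtr// sqn_ge0. Qed.

Lemma nrm_ge0 f : 0 <= nrm f. Proof. exact: sqrtr_ge0. Qed.

Lemma II_CS f g : L2 0 L f -> L2 0 L g -> `|II 0 L (fun x => f x * g x)| <= nrm f * nrm g.
Proof.
move=> Lf Lg; rewrite -ler_sqr ?nnegrE ?mulr_ge0 ?nrm_ge0//.
rewrite real_normK ?num_real// exprMn !sqr_nrm.
apply: discriminant_le0 => t.
have I1 := Lf.2; have I2 := L2_mul Lf Lg; have I3 := Lg.2.
rewrite /sqn -!IIZ// -!IID//; try by do ?[apply: intgZ|apply: intgD].
by apply: II_ge0 => x _; rewrite (_ : _ + _ = (f x + t * g x) ^+ 2) ?sqr_ge0//; ring.
Qed.

Lemma le_nrm f g C : 0 <= C -> sqn f <= C ^+ 2 * sqn g -> nrm f <= C * nrm g.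
Proof.
move=> C0 H; rewrite -ler_sqr ?nnegrE ?mulr_ge0 ?nrm_ge0//.
by rewrite exprMn !sqr_nrm.
Qed.

(** The arguments are functions rather than classes; the bound forces invariance under almost
    everywhere equality ([L2form_ael]). *)
Definition L2form F : Prop :=
  [/\ forall c f g h, L2 0 L f -> L2 0 L g -> L2 0 L h ->
        F (fun x => c * f x + g x) h = c * F f h + F g h,
      forall c f g h, L2 0 L f -> L2 0 L g -> L2 0 L h ->
        F h (fun x => c * f x + g x) = c * F h f + F h g &
      exists2 C : R, 0 <= C & forall f g, L2 0 L f -> L2 0 L g ->
        `|F f g| <= C * nrm f * nrm g].

(** Linearity is asked inside the interval only: for [x > L], a primitive [J f x] integrates [f]
    where nothing is known about it. Composition with a form therefore asks the form to ignore
    outside values. *)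
Definition L2op (T : (R -> R) -> R -> R) : Prop :=
  [/\ forall f, L2 0 L f -> L2 0 L (T f),
      forall c f g, L2 0 L f -> L2 0 L g ->
        forall x, 0 < x < L -> T (fun x => c * f x + g x) x = c * T f x + T g x &
      exists2 C : R, 0 <= C & forall f, L2 0 L f -> nrm (T f) <= C * nrm f].

Lemma L2formD F G : L2form F -> L2form G -> L2form (fun f g => F f g + G f g).
Proof.
move=> [F1 F2 [C C0 HC]] [G1 G2 [D D0 HD]]; split.
- by move=> *; rewrite F1// G1//; ring.
- by move=> *; rewrite F2// G2//; ring.
exists (C + D); first exact: addr_ge0.
move=> f g Lf Lg; apply: (le_trans (ler_normD _ _)); rewrite !mulrDl.
by apply: lerD; [exact: HC|exact: HD].
Qed.

Lemma L2formZ a F : L2form F -> L2form (fun f g => a * F f g).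
Proof.
move=> [F1 F2 [C C0 HC]]; split.
- by move=> *; rewrite F1//; ring.
- by move=> *; rewrite F2//; ring.
exists (`|a| * C); first exact: mulr_ge0.
by move=> f g Lf Lg; rewrite normrM -!mulrA ler_wpM2l// mulrA HC.
Qed.

Definition WF (s t : R) m f g := II s t (fun x => m x * (f x * g x)).

Definition weight (s t : R) m := measurable_fun `]s, t[ m /\
  exists2 C, 0 <= C & ae_on s t (fun x => `|m x| <= C).

Lemma WF_intg s t m f g : 0 <= s -> t <= L -> weight s t m ->
  L2 0 L f -> L2 0 L g -> intg s t (fun x => m x * (f x * g x)).
Proof.
move=> s0 tL [mm [C C0 HC]] Lf Lg; apply: intg_mul_bnd HC _ => //.
by apply: (intgS s0 tL); exact: L2_mul.
Qed.

Lemma WF_form s t m : 0 <= s -> s <= t -> t <= L -> weight s t m -> L2form (WF s t m).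
Proof.
move=> s0 st tL wm; have [mm [C C0 HC]] := wm; split.
- move=> c f g h Lf Lg Lh.
  rewrite /WF (@eq_II _ _ _ _ (fun x => c * (m x * (f x * h x)) + m x * (g x * h x))); last by move=> x _; ring.
  have I1 := WF_intg s0 tL wm Lf Lh; have I2 := WF_intg s0 tL wm Lg Lh.
  by rewrite IID ?IIZ//; exact: intgZ.
- move=> c f g h Lf Lg Lh.
  rewrite /WF (@eq_II _ _ _ _ (fun x => c * (m x * (h x * f x)) + m x * (h x * g x))); last by move=> x _; ring.
  have I1 := WF_intg s0 tL wm Lh Lf; have I2 := WF_intg s0 tL wm Lh Lg.
  by rewrite IID ?IIZ//; exact: intgZ.
exists C => // f g Lf Lg.
have I1 := WF_intg s0 tL wm Lf Lg.
have Lf' : L2 0 L (fun x => `|f x|).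
  case: Lf => mf If; split; first exact: measurableT_comp.
  by apply: eq_intg If => x _; rewrite real_normK ?num_real.
have Lg' : L2 0 L (fun x => `|g x|).
  case: Lg => mf If; split; first exact: measurableT_comp.
  by apply: eq_intg If => x _; rewrite real_normK ?num_real.
have nn h : nrm (fun x => `|h x|) = nrm h.
  by congr Num.sqrt; apply: eq_II => x _; rewrite real_normK ?num_real.
have I2 := L2_mul Lf' Lg'.
apply: (le_trans (norm_II I1)).
apply: (@le_trans _ _ (C * II s t (fun x => `|f x| * `|g x|))).
  rewrite -IIZ; last exact: intgS I2.
  apply: le_II; [exact: intg_norm|by apply: intgZ; exact: intgS I2|].
  apply: ae_on_imp HC => x _ hm; rewrite !normrM ler_wpM2r// mulr_ge0//.
rewrite -mulrA ler_wpM2l//.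
apply: (@le_trans _ _ (II 0 L (fun x => `|f x| * `|g x|))).
  by apply: le_II_sub => //; apply: ae_onW => x _; rewrite mulr_ge0.
apply: (le_trans (ler_norm _)); apply: (le_trans (II_CS Lf' Lg')).
by rewrite !nn.
Qed.

Lemma L2form_opl F T : L2form F -> L2op T -> (forall f g h, L2 0 L f -> L2 0 L g -> L2 0 L h ->
   (forall x, 0 < x < L -> f x = g x) -> F f h = F g h) -> L2form (fun f g => F (T f) g).
Proof.
move=> [F1 F2 [C C0 HC]] [T1 T2 [D D0 HD]] Fe; split.
- move=> c f g h Lf Lg Lh; rewrite -F1; [|exact: T1..|by []].
  apply: Fe => //; [apply: T1; apply: L2D => //; exact: L2Z|apply: L2D; [apply: L2Z|]; exact: T1|].
  exact: T2.
- by move=> c f g h Lf Lg Lh; rewrite F2//; exact: T1.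
exists (C * D); first exact: mulr_ge0.
move=> f g Lf Lg; apply: (le_trans (HC _ _ (T1 _ Lf) Lg)).
by rewrite ler_wpM2r ?nrm_ge0// -mulrA ler_wpM2l// HD.
Qed.

Lemma L2form_opr F T : L2form F -> L2op T -> (forall f g h, L2 0 L f -> L2 0 L g -> L2 0 L h ->
   (forall x, 0 < x < L -> f x = g x) -> F h f = F h g) -> L2form (fun f g => F f (T g)).
Proof.
move=> [F1 F2 [C C0 HC]] [T1 T2 [D D0 HD]] Fe; split.
- by move=> c f g h Lf Lg Lh; rewrite F1//; exact: T1.
- move=> c f g h Lf Lg Lh; rewrite -F2; [|exact: T1..|by []].
  apply: Fe => //; [apply: T1; apply: L2D => //; exact: L2Z|apply: L2D; [apply: L2Z|]; exact: T1|].
  exact: T2.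
exists (C * D); first exact: mulr_ge0.
move=> f g Lf Lg; apply: (le_trans (HC _ _ Lf (T1 _ Lg))).
rewrite -[C * D * _ * _]mulrA -mulrA -mulrA; apply: ler_wpM2l => //.
by rewrite mulrCA ler_wpM2l ?nrm_ge0// HD.
Qed.

Lemma nrm_cst c : nrm (cst c) = Num.sqrt L * `|c|.
Proof.
rewrite /nrm /sqn (II_cst (c ^+ 2)) ?ltW// subr0 mulrC sqrtrM ?ltW//.
by rewrite sqrtr_sqr.
Qed.

Lemma sup_II f x : L2 0 L f -> 0 <= x <= L -> `|II 0 x f| <= Num.sqrt L * nrm f.
Proof.
move=> Lf xL; apply: (le_trans (norm_II_le xL (L2_intg Lf))).
have Lf' : L2 0 L (fun x => `|f x|).
  case: Lf => mf If; split; first exact: measurableT_comp.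
  by apply: eq_intg If => y _; rewrite real_normK ?num_real.
have := II_CS (L2_cst 0 L 1) Lf'; rewrite nrm_cst normr1 mulr1.
have -> : nrm (fun x => `|f x|) = nrm f.
  by congr Num.sqrt; apply: eq_II => y _; rewrite real_normK ?num_real.
move/(le_trans (ler_norm _)); apply: le_trans.
by rewrite le_eqVlt; apply/orP; left; apply/eqP; apply: eq_II => y _; rewrite mul1r.
Qed.

Lemma nrm_sup f C : 0 <= C -> L2 0 L f -> (forall x, 0 < x < L -> `|f x| <= C) ->
  nrm f <= Num.sqrt L * C.
Proof.
move=> C0 Lf H; rewrite -(ger0_norm C0) -nrm_cst.
rewrite -[nrm (cst C)]mul1r; apply: le_nrm => //; rewrite expr1n mul1r.
apply: le_II; [exact: Lf.2|exact: (L2_cst 0 L C).2|].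
apply: ae_onW => x xL; rewrite -[f x ^+ 2]real_normK ?num_real//.
by rewrite lerXn2r ?nnegrE ?H.
Qed.

Definition J f : R -> R := fun x => II 0 x f.

Lemma J_op : L2op J.
Proof.
split.
- by move=> f Lf; apply: prim_L2; apply: prim_II; exact: L2_intg.
- move=> c f g Lf Lg x /andP[x0 xL]; rewrite /J.
  have If := intgS (lexx 0) (ltW xL) (L2_intg Lf).
  have Ig := intgS (lexx 0) (ltW xL) (L2_intg Lg).
  by rewrite IID ?IIZ//; exact: intgZ.
exists (Num.sqrt L * Num.sqrt L); first by rewrite mulr_ge0 ?sqrtr_ge0.
move=> f Lf; rewrite -mulrA; apply: nrm_sup.
- by rewrite mulr_ge0 ?sqrtr_ge0 ?nrm_ge0.
- by apply: prim_L2; apply: prim_II; exact: L2_intg.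
- by move=> x /andP[x0 xL]; apply: sup_II => //; rewrite !ltW.
Qed.

End L2Forms.

(** * The static estimate *)

(** The left-hand side collects the boundary terms of the multipliers in [Fa]; [va], [sa] and the
    like stand for the squares of [v] and [S] at alpha, beta and l. The traces at l come with
    opposite signs from the two sides, and the factor [K / c0] makes the favourable one win. *)
Lemma elastic_arith {R : realFieldType} (K c0 al be l L k1 k2 k3 va vb vl sa sb sl : R) :
  0 < c0 -> 0 <= al -> 0 <= be -> be <= l -> l <= L ->
  c0 <= k1 -> c0 <= k2 -> k2 <= K -> c0 <= k3 ->
  0 <= va -> 0 <= vb -> 0 <= vl -> 0 <= sa -> 0 <= sb -> 0 <= sl ->
  al * (va + k1^-1 * sa) + (K / c0 * (L - l) + l - be) * (vb + k2^-1 * sb) +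
   ((L - l) * (vl + k3^-1 * sl) - K / c0 * (L - l) * (vl + k2^-1 * sl)) <=
  (al + K / c0 * (L - l) + l) * (1 + c0^-1) * (va + vb + (sa + sb)).
Proof.
move=> c00 al0 be0 bl lL k1a k2a k2b k3a pva pvb pvl psa psb psl.
have K0 : 0 < K by lra.
have cV : 0 < c0^-1 by rewrite invr_gt0.
pose B := K / c0 * (L - l).
have B0 : 0 <= B by rewrite mulr_ge0 ?divr_ge0//; lra.
have k1V : k1^-1 <= c0^-1 by rewrite lef_pV2 ?posrE//; lra.
have k2V : k2^-1 <= c0^-1 by rewrite lef_pV2 ?posrE//; lra.
have k3V : k3^-1 <= c0^-1 by rewrite lef_pV2 ?posrE//; lra.
have k2V' : K^-1 <= k2^-1 by rewrite lef_pV2 ?posrE//; lra.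
(* the weight jumps favourably at [l] *)
have jump : (L - l) * (vl + k3^-1 * sl) <= B * (vl + k2^-1 * sl).
  have -> : B = (L - l) * (K / c0) by rewrite /B mulrC.
  rewrite -mulrA; apply: ler_wpM2l; first lra.
  have Kc : 1 <= K / c0 by rewrite ler_pdivlMr//; lra.
  have KcV : c0^-1 = K / c0 * K^-1 by field; rewrite !gt_eqF.
  rewrite mulrDr; apply: lerD; first by rewrite ler_peMl.
  rewrite [leRHS]mulrA; apply: ler_wpM2r => //; apply: (le_trans k3V).
  by rewrite {1}KcV; apply: ler_wpM2l => //; lra.
have t1 : al * (va + k1^-1 * sa) <= al * ((1 + c0^-1) * (va + sa)).
  apply: ler_wpM2l => //; have := ler_wpM2r psa k1V; have := mulr_ge0 (ltW cV) pva; lra.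
have Bl0 : 0 <= B + l - be by lra.
have t2 : (B + l - be) * (vb + k2^-1 * sb) <= (B + l - be) * ((1 + c0^-1) * (vb + sb)).
  apply: ler_wpM2l => //; have := ler_wpM2r psb k2V; have := mulr_ge0 (ltW cV) pvb; lra.
have P1 : 0 <= (1 + c0^-1) * (va + sa) by rewrite mulr_ge0 ?addr_ge0// ltW.
have P2 : 0 <= (1 + c0^-1) * (vb + sb) by rewrite mulr_ge0 ?addr_ge0// ltW.
set X := (1 + c0^-1) * (va + sa) in t1 P1; set Y := (1 + c0^-1) * (vb + sb) in t2 P2.
have -> : (al + K / c0 * (L - l) + l) * (1 + c0^-1) * (va + vb + (sa + sb)) =
    (al + B + l) * (X + Y) by rewrite /X /Y /B; ring.
have q1 : 0 <= (B + l) * X by rewrite mulr_ge0//; lra.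
have q2 : 0 <= al * Y by rewrite mulr_ge0.
have q3 : 0 <= be * Y by rewrite mulr_ge0.
rewrite -/B; lra.
Qed.

(** Linear bookkeeping that closes [elastic_le], with the integrals abstracted to variables. *)
Lemma elastic_sum {R : realFieldType} (t1 t2 t3 z E1 EI V E2 E3 C KQ : R) :
  EI <= KQ -> t1 + t2 + t3 <= C ->
  E1 + (EI + V) + (E2 + E3) + 2 * ((t1 - 0) / 2 - 1 / 2 * E1 +
    ((- z - - t2) / 2 - 1 / 2 * E2 + ((0 - - (t3 + z)) / 2 - 1 / 2 * E3))) <=
  C + (KQ + V).
Proof. by lra. Qed.

Lemma inv_scale_le {R : realFieldType} (kap len : R) : 0 < kap -> 0 < len ->
  8 / len <= kap -> kap^-1 * (2 / len) <= 1 / 4.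
Proof.
move=> k0 l0; rewrite ler_pdivrMr// => h.
rewrite mulrC -mulrA -invfM ler_pdivrMr ?mulr_gt0//; lra.
Qed.

Lemma opp_le_norm {R : realDomainType} (x y : R) : `|x| <= y -> - x <= y.
Proof. by rewrite ler_norml => /andP[h _]; rewrite lerNl. Qed.

Lemma flux_sum {R : realFieldType} (x1 x2 x3 x4 x5 x6 : R) :
  x3 <= x5 -> - x1 <= x6 ->
  x4 + 2 * (x2 + x3) + (-2 * x1 + -2 * x2) <= x4 + 2 * x5 + 2 * x6.
Proof. by lra. Qed.

Lemma accel_sum {R : realFieldType} (K tau taui x1 x2 x3 x4 x5 x6 x7 y3 y4 y5 y6 y7 y8 : R) :
  x1 + x2 = y3 - y4 -> x2 = x5 + x3 -> - x3 <= K * (tau * x6) + K * (taui * x7) ->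
  x4 <= K * x6 + K * x6 -> y3 <= y5 + y7 -> - y4 <= y6 + y8 ->
  x1 + (x4 + x5) <= y6 + y5 + (y8 + y7) + 2 * K * x6 + (K * (tau * x6) + K * (taui * x7)).
Proof. by lra. Qed.

Lemma strain_sum {R : realFieldType} (c0 K eps len x1 x2 x3 x4 x5 x6 x7 x8 x9 x10 x11 x12 x13 : R) :
  x1 + x2 = x5 - x3 -> c0 * x11 <= x1 -> eps * x8 <= eps * (len * x11) ->
  eps * x10 <= eps * x6 -> x13 * x9 <= x13 * (x7 * x12) ->
  - x4 <= x13 * x12 + eps * x10 -> - x3 <= K * (eps * x11 + x13 * x12) ->
  x5 <= eps * x8 + x13 * x9 ->
  c0 * x11 + (- x4 + x2) <= eps * (len + K) * x11 + eps * x6 +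
    (x13 * x7 + x13 * K + x13) * x12.
Proof. by lra. Qed.

(** Elimination of the norm [W] and the traces [TW] of w; here [i] is the inverse of [kap] and [Sig]
    stands for the traces of [S]. Half of [W] survives once [TW] is inserted, and division by [kap]
    leaves [i * W / 2] against one copy of [Sig]. The bound of the traces of [S] contains
    [i * W / 4], so doubling it cancels [W] exactly and still leaves one [Sig]. *)
Lemma flux_arith {R : realFieldType} (K A kap i eps e Sig fb fc SS W TW V E r rho Q : R) :
  0 < K -> 0 < A -> 1 <= kap -> 0 < i -> kap * i = 1 -> i * A <= 1 / 4 ->
  0 < eps -> 0 < e ->
  0 <= W -> 0 <= r -> 0 <= rho -> V <= E ->
  SS <= 2 * K ^+ 2 * (Q + r) ->
  Sig + fb <= A * SS + 2 * (K * (8 * K * kap * r + (8 * K)^-1 * i * W)) +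
     2 * (K * (e * r + eps * V)) ->
  W + fc <= kap * Sig + i * TW + 2 * K * r + K * (kap ^+ 2 * r + i ^+ 2 * rho) ->
  TW <= A * W + 2 * (kap / 8 * W + 8 * i * rho) ->
  Sig + (2 * fb + i * fc) <= 4 * K ^+ 2 * A * Q + 4 * K * eps * E +
    (4 * K ^+ 2 * A + 32 * K ^+ 2 + 3 * K + 4 * K * e + 16) * (kap * r + i ^+ 3 * rho).
Proof.
move=> K0 A0 k1 i0 ki iA eps0 e0 W0 r0 rho0 VE hSS hS hW hT.
have KK : K * (8 * K)^-1 = 8^-1 by field; rewrite gt_eqF.
have i1 : i <= 1 by rewrite -ki ler_peMl// ltW.
have hT' := ler_wpM2l (ltW i0) hT.
have hT2 : i * (A * W + 2 * (kap / 8 * W + 8 * i * rho)) <= W / 2 + 16 * (i ^+ 2 * rho).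
  have -> : i * (A * W + 2 * (kap / 8 * W + 8 * i * rho)) =
    (i * A) * W + (kap * i) * W / 4 + 16 * (i ^+ 2 * rho) by field.
  rewrite ki; have := ler_wpM2r W0 iA; lra.
have hW2 : W / 2 + fc <= kap * Sig + 2 * K * r + K * (kap ^+ 2 * r) + (K + 16) * (i ^+ 2 * rho).
  lra.
have hW3 := ler_wpM2l (ltW i0) hW2.
have hW4 : i * W / 2 + i * fc <= Sig + 2 * K * (i * r) + K * (kap * r) + (K + 16) * (i ^+ 3 * rho).
  have eq1 : i * (kap * Sig + 2 * K * r + K * (kap ^+ 2 * r) + (K + 16) * (i ^+ 2 * rho)) =
    (kap * i) * Sig + 2 * K * (i * r) + (kap * i) * K * (kap * r) + (K + 16) * (i ^+ 3 * rho) by ring.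
  rewrite eq1 ki in hW3; lra.
have hS2 : 2 * (K * (8 * K * kap * r + (8 * K)^-1 * i * W)) = 16 * K ^+ 2 * (kap * r) + i * W / 4.
  have -> : 2 * (K * (8 * K * kap * r + (8 * K)^-1 * i * W)) =
    16 * K ^+ 2 * (kap * r) + 2 * (K * (8 * K)^-1) * (i * W) by ring.
  rewrite KK; lra.
have hSS2 := ler_wpM2l (ltW A0) hSS.
have KE := ler_wpM2l (ltW (mulr_gt0 K0 eps0)) VE.
have r1 : r <= kap * r by rewrite ler_peMl.
have r2 : i * r <= kap * r by apply: ler_wpM2r => //; lra.
have K2 : 0 <= K ^+ 2 * A by apply: mulr_ge0; [exact: sqr_ge0|exact: ltW].
have m1 := ler_wpM2l K2 r1; have m2 := ler_wpM2l (ltW K0) r2.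
have m3 := ler_wpM2l (ltW (mulr_gt0 K0 e0)) r1.
have kr0 : 0 <= kap * r by lra.
have ir0 : 0 <= i ^+ 3 * rho by apply: mulr_ge0 => //; apply: exprn_ge0; exact: ltW.
have n1 := mulr_ge0 K2 ir0.
have n2 := mulr_ge0 (sqr_ge0 K) ir0.
have n3 := mulr_ge0 (ltW K0) ir0.
have n4 := mulr_ge0 (ltW (mulr_gt0 K0 e0)) ir0.
have -> : (4 * K ^+ 2 * A + 32 * K ^+ 2 + 3 * K + 4 * K * e + 16) * (kap * r + i ^+ 3 * rho) =
  4 * (K ^+ 2 * A * (kap * r)) + 32 * (K ^+ 2 * (kap * r)) + 3 * (K * (kap * r)) + 4 * (K * e * (kap * r)) + 16 * (kap * r) +
  4 * (K ^+ 2 * A * (i ^+ 3 * rho)) + 32 * (K ^+ 2 * (i ^+ 3 * rho)) + 3 * (K * (i ^+ 3 * rho)) + 4 * (K * e * (i ^+ 3 * rho)) + 16 * (i ^+ 3 * rho) by ring.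
rewrite hS2 in hS.
have hS3 : 2 * Sig + 2 * fb <= 2 * (A * (2 * K ^+ 2 * (Q + r))) + 2 * (16 * K ^+ 2 * (kap * r) + i * W / 4) + 4 * (K * e * r) + 4 * (K * eps * E).
  lra.
have -> : 4 * K ^+ 2 * A * Q = 4 * (K ^+ 2 * A * Q) by ring.
have -> : 4 * K * eps * E = 4 * (K * eps * E) by ring.
have eqA : A * (2 * K ^+ 2 * (Q + r)) = 2 * (K ^+ 2 * A * Q) + 2 * (K ^+ 2 * A * r) by ring.
rewrite eqA in hS3.
lra.
Qed.

(* Successive absorption of the energy into the left-hand side. *)
Lemma static_arith {R : realFieldType} (A A2 K B1 B2 B5 eps e A3 CY eps1 D1 D2 eps3 len Cr c0
    E V TV SS Sig Q r Z fa fbc fd fe : R) :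
  0 < A -> 0 < A2 -> 0 < K -> 0 < A3 -> 0 < c0 -> 0 <= D1 -> 0 <= D2 -> 0 <= Cr ->
  0 < eps -> 0 < e ->
  B1 = A * A2 + 1 -> B1 * (2 * eps * A3) = 1 / 4 ->
  B2 = B1 * e + A -> B2 * (4 * K * eps1) = 1 / 4 ->
  B5 = K + B1 + B1 * (2 * K ^+ 2) + B2 * D1 ->
  eps3 * (len + K) <= c0 / 2 -> 2 / c0 * B5 * (eps3 * CY ^+ 2) <= 1 / 4 ->
  0 <= E -> 0 <= Q -> 0 <= r -> r <= Z ->
  E + 2 * fa <= A * (TV + Sig) + (K * Q + V) ->
  TV <= A2 * V + 2 * r ->
  SS <= 2 * K ^+ 2 * (Q + r) ->
  V + fe <= 2 * eps * A3 * E + e * Sig + (Q + SS) ->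
  Sig + fbc <= D1 * Q + 4 * K * eps1 * E + D2 * Z ->
  c0 * Q + fd <= eps3 * (len + K) * Q + eps3 * CY ^+ 2 * E + Cr * r ->
  E + (8 * fa + 4 * B1 * fe + 4 * B2 * fbc + 8 / c0 * B5 * fd) <=
   4 * (2 * A + B1 * (2 * K ^+ 2) + B2 * D2 + 2 / c0 * B5 * Cr) * Z.
Proof.
move=> A0 A20 K0 A30 c00 D10 D20 Cr0 eps0 e0 B1E h1 B2E h2 B5E h3 h4 E0 Q0 r0 rZ ia iT iS iV iF iQ.
have B10 : 0 < B1 by have := mulr_gt0 A0 A20; lra.
have B20 : 0 < B2 by have := mulr_gt0 B10 e0; rewrite B2E; lra.
have K20 : 0 <= K ^+ 2 by exact: sqr_ge0.
have BK : 0 <= B1 * (2 * K ^+ 2) by apply: mulr_ge0; [exact: ltW|apply: mulr_ge0].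
have BD : 0 <= B2 * D1 by apply: mulr_ge0; [exact: ltW|].
have B50 : 0 <= B5 by rewrite B5E; lra.
have Z0 : 0 <= Z by lra.
(* The traces of v disappear here, then [V] in [s2], [Sig] in [s4] and [Q] in [s7]. Each of the last
   three gives back at most [E / 4], so a quarter of [E] remains: hence the final factor 4. *)
have s1 : E + 2 * fa <= B1 * V + A * Sig + K * Q + 2 * A * r.
  have := ler_wpM2l (ltW A0) iT; rewrite B1E; lra.
have s2 : B1 * V + B1 * fe <= E / 4 + B1 * e * Sig + B1 * Q + B1 * (2 * K ^+ 2) * (Q + r).
  have iV2 : V + fe <= 2 * eps * A3 * E + e * Sig + (Q + 2 * K ^+ 2 * (Q + r)) by lra.
  have := ler_wpM2l (ltW B10) iV2.
  have -> : B1 * (2 * eps * A3 * E + e * Sig + (Q + 2 * K ^+ 2 * (Q + r))) =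
    B1 * (2 * eps * A3) * E + B1 * e * Sig + B1 * Q + B1 * (2 * K ^+ 2) * (Q + r) by ring.
  rewrite h1; lra.
have s3 : 3 / 4 * E + 2 * fa + B1 * fe <= B2 * Sig + (K + B1 + B1 * (2 * K ^+ 2)) * Q +
   (2 * A + B1 * (2 * K ^+ 2)) * r by rewrite B2E; lra.
have s4 : B2 * Sig + B2 * fbc <= B2 * D1 * Q + E / 4 + B2 * D2 * Z.
  have := ler_wpM2l (ltW B20) iF.
  have -> : B2 * (D1 * Q + 4 * K * eps1 * E + D2 * Z) =
    B2 * D1 * Q + B2 * (4 * K * eps1) * E + B2 * D2 * Z by ring.
  rewrite h2; lra.
have s5 : E / 2 + 2 * fa + B1 * fe + B2 * fbc <= B5 * Q + (2 * A + B1 * (2 * K ^+ 2)) * r + B2 * D2 * Z.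
  by rewrite B5E; lra.
have s6 : c0 / 2 * Q + fd <= eps3 * CY ^+ 2 * E + Cr * r.
  have := ler_wpM2r Q0 h3; lra.
have c2 : 0 <= 2 / c0 by rewrite divr_ge0// ltW.
have c2B : 0 <= 2 / c0 * B5 by rewrite mulr_ge0.
have s7 : B5 * Q + 2 / c0 * B5 * fd <= E / 4 + 2 / c0 * B5 * Cr * r.
  have := ler_wpM2l c2B s6.
  have -> : 2 / c0 * B5 * (c0 / 2 * Q + fd) = B5 * Q + 2 / c0 * B5 * fd.
    by field; rewrite gt_eqF.
  have -> : 2 / c0 * B5 * (eps3 * CY ^+ 2 * E + Cr * r) =
    2 / c0 * B5 * (eps3 * CY ^+ 2) * E + 2 / c0 * B5 * Cr * r by ring.
  have := ler_wpM2r E0 h4; lra.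
have w1 : 0 <= 2 * A + B1 * (2 * K ^+ 2) by lra.
have w2 : 0 <= 2 / c0 * B5 * Cr by rewrite mulr_ge0.
have u1 := ler_wpM2l w1 rZ; have u2 := ler_wpM2l w2 rZ.
have -> : 8 / c0 * B5 * fd = 4 * (2 / c0 * B5 * fd) by ring.
have -> : 4 * (2 * A + B1 * (2 * K ^+ 2) + B2 * D2 + 2 / c0 * B5 * Cr) * Z =
  4 * ((2 * A + B1 * (2 * K ^+ 2)) * Z + B2 * D2 * Z + 2 / c0 * B5 * Cr * Z) by ring.
lra.
Qed.

Section Static.
Context {R : realType}.
Variables (alpha beta l L c0 K k1 k2 k3 : R) (p d : R -> R).
Hypotheses (alpha_ge0 : 0 <= alpha) (alpha_lt_beta : alpha < beta)
  (beta_le_l : beta <= l) (l_lt_L : l < L) (c0_gt0 : 0 < c0)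
  (p_meas : measurable_fun `]0, L[ p) (d_meas : measurable_fun `]0, L[ d)
  (p_bnd : ae_on 0 L (fun x => c0 <= p x <= K))
  (d_bnd : ae_on 0 L (fun x => 0 <= d x <= K))
  (d_ge : ae_on alpha beta (fun x => c0 <= d x))
  (d_left : ae_on 0 alpha (fun x => d x = 0)) (d_right : ae_on beta L (fun x => d x = 0))
  (p_left : ae_on 0 alpha (fun x => p x = k1)) (p_mid : ae_on beta l (fun x => p x = k2))
  (p_right : ae_on l L (fun x => p x = k3))
  (k1_bnd : c0 <= k1 <= K) (k2_bnd : c0 <= k2 <= K) (k3_bnd : c0 <= k3 <= K).
Implicit Types (s t k M eps ma mb : R) (f g m q r v w rho S F : R -> R).

Let L_gt0 : 0 < L. Proof. by have := alpha_ge0; have := alpha_lt_beta; have := beta_le_l; have := l_lt_L; lra. Qed.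
Let K_gt0 : 0 < K. Proof. by have := c0_gt0; have /andP[] := k1_bnd; lra. Qed.
Let beta_gt0 : 0 <= beta. Proof. by have := alpha_ge0; have := alpha_lt_beta; lra. Qed.
Let alpha_le_beta : alpha <= beta. Proof. exact: ltW. Qed.
Let beta_le_L : beta <= L. Proof. by have := beta_le_l; have := l_lt_L; lra. Qed.
Let alpha_le_L : alpha <= L. Proof. by have := beta_le_L; have := alpha_lt_beta; lra. Qed.
Let l_ge0 : 0 <= l. Proof. by have := beta_le_l; have := beta_gt0; lra. Qed.
Let len_gt0 : 0 < beta - alpha. Proof. by rewrite subr_gt0. Qed.

(* (q, v) is a state, (r, w) its image under the generator, rho the second
   derivative in time of q, and S the flux. *)
Definition flow q r w rho v S : Prop :=
  [/\ [/\ L2 0 L q, L2 0 L r & L2 0 L rho],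
      [/\ prim 0 L r v, v 0 = 0 & v L = 0],
      prim 0 L w S /\ ae_on 0 L (fun x => S x = p x * q x + d x * r x),
      prim 0 L rho w &
      II 0 L q = 0].

Definition energy q v := II 0 L (fun x => p x * q x ^+ 2) + II 0 L (fun x => v x ^+ 2).
Definition onI f := II alpha beta (fun x => f x ^+ 2).
Definition traces S := S alpha ^+ 2 + S beta ^+ 2.

Lemma onI_ge0 f : 0 <= onI f.
Proof. by apply: II_ge0 => x _; exact: sqr_ge0. Qed.

Lemma L2I f : L2 0 L f -> L2 alpha beta f.
Proof. exact: L2S. Qed.

Lemma young_II s t m f g M eps : 0 < eps -> measurable_fun `]s, t[ m -> 0 <= M ->
  ae_on s t (fun x => `|m x| <= M) -> L2 s t f -> L2 s t g ->
  `|II s t (fun x => m x * (f x * g x))| <=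
    M * (eps * II s t (fun x => f x ^+ 2) + eps^-1 * II s t (fun x => g x ^+ 2)).
Proof.
move=> eps0 mm M0 bm Lf Lg.
have I1 : intg s t (fun x => m x * (f x * g x)).
  by apply: (intg_mul_bnd mm bm); exact: L2_mul.
have If := Lf.2; have Ig := Lg.2.
rewrite -!IIZ// -IID; [|exact: intgZ..]; rewrite -IIZ; last by apply: intgD; exact: intgZ.
apply: (le_trans (norm_II I1)); apply: le_II.
- exact: intg_norm.
- by apply: intgZ; apply: intgD; exact: intgZ.
apply: ae_on_imp bm => x _ hm; rewrite !normrM.
apply: ler_pM; [by []|by rewrite mulr_ge0|exact: hm|].
have eV : 0 < eps^-1 by rewrite invr_gt0.
rewrite -[f x ^+ 2]real_normK ?num_real// -[g x ^+ 2]real_normK ?num_real//.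
set a := `|f x|; set b := `|g x|.
have -> : eps * a ^+ 2 + eps^-1 * b ^+ 2 = a * b + (eps * (a - eps^-1 * b / 2) ^+ 2 + 3 / 4 * eps^-1 * b ^+ 2).
  by field; rewrite gt_eqF.
rewrite lerDl addr_ge0// mulr_ge0 ?sqr_ge0//; first exact: ltW.
by rewrite mulr_ge0// ltW.
Qed.

(** The affine function with values -1 at alpha and 1 at beta. *)
Definition psi x := 2 / (beta - alpha) * x - (alpha + beta) / (beta - alpha).

Lemma psi_prim : prim alpha beta (cst (2 / (beta - alpha))) psi.
Proof.
have := primD (primZ (2 / (beta - alpha)) (prim_id alpha beta)) (prim_cst alpha beta (- ((alpha + beta) / (beta - alpha)))).
move=> H; apply: (eq_prim H) => x _ //=.
by rewrite mulr1 addr0.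
Qed.

Lemma psi_bnd x : alpha < x < beta -> `|psi x| <= 1.
Proof.
move=> /andP[ax xb].
have -> : psi x = (2 * x - alpha - beta) / (beta - alpha).
  by rewrite /psi; field; rewrite gt_eqF.
rewrite normrM normfV (gtr0_norm len_gt0) ler_pdivrMr// mul1r ler_norml; lra.
Qed.

(** Integrate the derivative of psi F^2 over the damped interval: the signs of [psi] at the two ends
    make both boundary terms positive. *)
Lemma trace_identity f F : prim alpha beta f F ->
  traces F = 2 / (beta - alpha) * onI F + 2 * II alpha beta (fun x => psi x * (F x * f x)).
Proof.
move=> PF; have PP := prim_mul psi_prim (prim_mul PF PF).
have := prim_sub PP (lexx alpha) alpha_le_beta (lexx beta).
have -> : psi beta = 1 by rewrite /psi; field; rewrite gt_eqF.
have -> : psi alpha = -1 by rewrite /psi; field; rewrite gt_eqF.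
have IF := (prim_L2 PF).2.
have I2 : intg alpha beta (fun x => psi x * (F x * f x)).
  apply: (intg_mul_bnd (prim_meas psi_prim) (ae_onW psi_bnd)).
  by apply: eq_intg (intg_mul_prim PF.1 PF) => x _; rewrite mulrC.
rewrite (@eq_II _ _ _ _ (fun x => 2 / (beta - alpha) * F x ^+ 2 + 2 * (psi x * (F x * f x)))); last first.
  by move=> x _ /=; ring.
rewrite IID; [|exact: intgZ..]; rewrite !IIZ//.
by rewrite /traces /onI => ->; ring.
Qed.

Lemma trace_le f F eps : 0 < eps -> L2 alpha beta f -> prim alpha beta f F ->
  traces F <= 2 / (beta - alpha) * onI F + 2 * (eps * onI F + eps^-1 * onI f).
Proof.
move=> eps0 Lf PF; rewrite (trace_identity PF) lerD2l ler_pM2l//.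
have := young_II eps0 (prim_meas psi_prim) ler01 (ae_onW psi_bnd) (prim_L2 PF) Lf.
by rewrite mul1r; exact: le_trans (ler_norm _).
Qed.

(* [p^-1] up to a null set; the maximum makes it measurable and bounded. *)
Definition pinv x := (Num.max (p x) c0)^-1.

Lemma pinv_meas : measurable_fun `]0, L[ pinv.
Proof.
have c00 := c0_gt0.
pose g (y : R) := (Num.max y c0)^-1.
have cg : continuous g.
  move=> y; apply: cvgV; first by rewrite gt_eqF// lt_max c00 orbT.
  by apply: continuous_max; [exact: cvg_id|exact: cvg_cst].
have mg : measurable_fun setT g by exact: continuous_measurable_fun.
exact: (measurableT_comp mg p_meas).
Qed.

Lemma pinv_gt0 x : 0 < pinv x.
Proof. by rewrite /pinv invr_gt0 lt_max c0_gt0 orbT. Qed.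

Lemma pinv_le x : pinv x <= c0^-1.
Proof. by rewrite /pinv lef_pV2 ?posrE ?lt_max ?c0_gt0 ?orbT// le_max lexx orbT. Qed.

Lemma pinv_bnd : ae_on 0 L (fun x => `|pinv x| <= c0^-1).
Proof. by apply: ae_onW => x _; rewrite gtr0_norm ?pinv_gt0 ?pinv_le. Qed.

Lemma p_pinv : ae_on 0 L (fun x => pinv x * p x = 1).
Proof.
have c00 := c0_gt0; apply: ae_on_imp p_bnd => x _ /andP[h1 _].
by rewrite /pinv (max_idPl h1) mulVf// gt_eqF//; lra.
Qed.

Lemma weight_pinv : weight 0 L pinv.
Proof.
split; first exact: pinv_meas.
by exists c0^-1; [rewrite invr_ge0 ltW|exact: pinv_bnd].
Qed.

Lemma weight_cst s t c : weight s t (cst c).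
Proof. by split; [exact: measurable_cst|exists `|c| => //; exact: ae_onW]. Qed.

Lemma p_norm_bnd : ae_on 0 L (fun x => `|p x| <= K).
Proof.
have c00 := c0_gt0; apply: ae_on_imp p_bnd => x _ /andP[h1 h2].
by rewrite ger0_norm//; lra.
Qed.

Lemma d_norm_bnd : ae_on 0 L (fun x => `|d x| <= K).
Proof. by apply: ae_on_imp d_bnd => x _ /andP[h1 h2]; rewrite ger0_norm. Qed.

Lemma weight_p s t : 0 <= s -> t <= L -> weight s t p.
Proof.
move=> s0 tL; split; first exact: measS p_meas.
by exists K; [exact: ltW|exact: ae_onS p_norm_bnd].
Qed.

Lemma weight_psip : weight alpha beta (fun x => psi x * p x).
Proof.
split; first by apply: measurable_funM; [exact: prim_meas psi_prim|exact: measS p_meas].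
exists K; first exact: ltW.
apply: ae_on_imp (ae_onS alpha_ge0 beta_le_L p_norm_bnd) => x /psi_bnd h1 h2.
by rewrite normrM -[leRHS]mul1r ler_pM.
Qed.

Lemma weight_affine s t ma mb : weight s t (fun x => ma + mb * x).
Proof.
have Pm : prim s t (cst mb) (fun x => ma + mb * x).
  have H := primD (prim_cst s t ma) (primZ mb (prim_id s t)).
  by apply: (eq_prim H) => x _ //=; rewrite add0r mulr1.
split; first exact: prim_meas Pm.
have [M M0 HM] := prim_bounded Pm; exists M => //.
by apply: ae_onW => x /andP[h1 h2]; apply: HM; rewrite !ltW.
Qed.

Lemma sqr_II_le f : L2 alpha beta f ->
  II alpha beta f ^+ 2 <= (beta - alpha) * onI f.
Proof.
move=> Lf; apply: discriminant_le0 => t.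
have If := L2_intg Lf; have If2 := Lf.2; have I1 := intg_cst alpha beta 1.
rewrite -[beta - alpha]mul1r -(II_cst 1 alpha_le_beta) /onI -!IIZ// -!IID//; try by do ?[apply: intgZ|apply: intgD].
by apply: II_ge0 => x _ /=; rewrite (_ : _ + _ = (1 + t * f x) ^+ 2) ?sqr_ge0//; ring.
Qed.

(** The weight 1/p is the one for which the mean of the flux sees only d r: S / p is q plus (d / p)
    r, and [q] has integral zero. *)
Definition mean f := (II 0 L pinv)^-1 * II 0 L (fun x => pinv x * f x).

Definition Yop f : R -> R := fun x => J f x + -1 * mean (J f).

Lemma II_pinv_gt0 : 0 < II 0 L pinv.
Proof.
have c00 := c0_gt0; have K0 := K_gt0; have L0 := L_gt0.
apply: (@lt_le_trans _ _ (II 0 L (cst K^-1))).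
  by rewrite II_cst ?ltW// subr0 mulr_gt0// invr_gt0.
apply: le_II; [exact: intg_cst|exact: intg_bnd pinv_meas pinv_bnd|].
apply: ae_on_imp p_bnd => x _ /andP[h1 h2].
by rewrite /pinv (max_idPl h1) lef_pV2 ?posrE//; lra.
Qed.

(** Evaluated against the constant 1 this form is [mean (J f)], which thereby inherits linearity and
    a bound. *)
Lemma mean_form : L2form L (fun f g => (II 0 L pinv)^-1 * WF 0 L pinv (J f) g).
Proof.
apply: L2formZ; apply: (@L2form_opl _ _ (WF 0 L pinv) J).
- by apply: WF_form => //; [exact: ltW|exact: weight_pinv].
- exact: J_op.
- by move=> f g h _ _ _ fg; apply: eq_II => x xL; rewrite fg.
Qed.

Lemma meanE f : mean (J f) = (II 0 L pinv)^-1 * WF 0 L pinv (J f) (cst 1).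
Proof. by congr (_ * _); apply: eq_II => x _; rewrite mulr1. Qed.

Lemma Yop_op : L2op L Yop.
Proof.
have [J1 J2 [C C0 HC]] := J_op L_gt0; have [M1 _ [D D0 HD]] := mean_form.
have L1 := L2_cst 0 L (1 : R).
split.
- by move=> f Lf; apply: L2D; [exact: J1|exact: (L2_cst 0 L (-1 * mean (J f)))].
- move=> c f g Lf Lg x xL; rewrite /Yop J2// !meanE.
  rewrite (M1 c f g _ Lf Lg L1).
  have aux (s t y z : R) : c * s + t + -1 * (c * y + z) = c * (s + -1 * y) + (t + -1 * z) by ring.
  exact: aux.
exists (2 * C + 2 * (Num.sqrt L * (D * nrm L (cst 1)))).
  by rewrite addr_ge0// mulr_ge0// mulr_ge0 ?sqrtr_ge0// mulr_ge0// nrm_ge0.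
move=> f Lf; have n0 := nrm_ge0 L f.
have E0 : 0 <= Num.sqrt L * (D * nrm L (cst 1)).
  by rewrite mulr_ge0 ?sqrtr_ge0// mulr_ge0// nrm_ge0.
apply: le_nrm; first by rewrite addr_ge0// mulr_ge0.
have h1 := HC f Lf; have h2 := HD f (cst 1) Lf L1; rewrite -meanE in h2.
have LJ := J1 f Lf; set m := mean (J f) in h2 *.
have Lm := L2_cst 0 L (-1 * m).
apply: (@le_trans _ _ (2 * sqn L (J f) + 2 * sqn L (cst (-1 * m)))).
  rewrite /sqn -!IIZ; [|exact: Lm.2|exact: LJ.2].
  rewrite -IID; [|by apply: intgZ; exact: LJ.2|by apply: intgZ; exact: Lm.2].
  apply: le_II; first exact: (L2D LJ Lm).2.
    by apply: intgD; apply: intgZ; [exact: LJ.2|exact: Lm.2].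
  apply: ae_onW => x _; rewrite /Yop -/m /=.
  have := sqr_ge0 (J f x + m); nra.
rewrite -!sqr_nrm nrm_cst// mulN1r normrN.
set a := nrm L (J f) in h1 *; have a0 : 0 <= a by exact: nrm_ge0.
have h3 : Num.sqrt L * `|m| <= Num.sqrt L * (D * nrm L (cst 1)) * nrm L f.
  by rewrite -mulrA ler_wpM2l ?sqrtr_ge0// mulrAC.
set b := Num.sqrt L * `|m| in h3 *; have b00 : 0 <= b by rewrite mulr_ge0 ?sqrtr_ge0.
set A := C * nrm L f in h1; set B := _ * nrm L f in h3.
rewrite -exprMn.
have -> : (2 * C + 2 * (Num.sqrt L * (D * nrm L (cst 1)))) * nrm L f = 2 * A + 2 * B.
  by rewrite /A /B; ring.
nra.
Qed.

(** All three weights have slope 1, which produces the energy. They vanish at 0 and at L, where [v]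
    is zero but [S] is not controlled, and the drop of the middle one to [- K / c0 * (L - l)] at l
    dominates the value [- (L - l)] on the other side. *)
Definition Fa f g := WF 0 alpha (fun x => 0 + 1 * x) f g +
  (WF beta l (fun x => - (K / c0 * (L - l) + l) + 1 * x) f g +
   WF l L (fun x => - L + 1 * x) f g).
(** [Fb] and [Fc] compensate the terms in p q w and p q rho that arise in bounding the traces of [S]
    and the norm of w. [Fd] and [Fe] pair one of q and v with a primitive of the other. *)
Definition Fb f g := -2 * WF alpha beta (fun x => psi x * p x) f g.
Definition Fc f g := WF alpha beta p f g.
Definition Fd f g := -1 * WF alpha beta (cst 1) f (Yop g).
Definition Fe f g := -1 * WF alpha beta (cst 1) (J f) g.

Lemma Fa_form : L2form L Fa.
Proof.
by apply: L2formD; [|apply: L2formD]; apply: WF_form => //; try exact: ltW; exact: weight_affine.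
Qed.

Lemma Fb_form : L2form L Fb.
Proof. by apply: L2formZ; apply: WF_form => //; exact: weight_psip. Qed.

Lemma Fc_form : L2form L Fc.
Proof. by apply: WF_form => //; exact: weight_p. Qed.

Lemma WF1_form : L2form L (WF alpha beta (cst 1)).
Proof. by apply: WF_form => //; exact: weight_cst. Qed.

Lemma sub_itv x : alpha < x < beta -> 0 < x < L.
Proof. by have := alpha_ge0; have := beta_le_L; lra. Qed.

Lemma Fd_form : L2form L Fd.
Proof.
apply: L2formZ; apply: (@L2form_opr _ _ (WF alpha beta (cst 1)) Yop).
- exact: WF1_form.
- exact: Yop_op.
- by move=> f g h _ _ _ fg; apply: eq_II => x /sub_itv xL; rewrite fg.
Qed.

Lemma Fe_form : L2form L Fe.
Proof.
apply: L2formZ; apply: (@L2form_opl _ _ (WF alpha beta (cst 1)) J).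
- exact: WF1_form.
- exact: J_op.
- by move=> f g h _ _ _ fg; apply: eq_II => x /sub_itv xL; rewrite fg.
Qed.

Lemma onI_le f : L2 0 L f -> onI f <= sqn L f.
Proof.
move=> Lf; apply: le_II_sub => //; first exact: Lf.2.
by apply: ae_onW => x _; exact: sqr_ge0.
Qed.

Lemma young_num (a b eps : R) : 0 < eps -> `|a * b| <= eps * a ^+ 2 + eps^-1 * b ^+ 2.
Proof.
move=> eps0; have eV : 0 < eps^-1 by rewrite invr_gt0.
rewrite normrM -[a ^+ 2]real_normK ?num_real// -[b ^+ 2]real_normK ?num_real//.
set x := `|a|; set y := `|b|.
have -> : eps * x ^+ 2 + eps^-1 * y ^+ 2 = x * y + (eps * (x - eps^-1 * y / 2) ^+ 2 + 3 / 4 * eps^-1 * y ^+ 2).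
  by field; rewrite gt_eqF.
rewrite lerDl addr_ge0// mulr_ge0 ?sqr_ge0//; first exact: ltW.
by rewrite mulr_ge0// ltW.
Qed.

Lemma J_sqr f x : L2 0 L f -> 0 <= x <= L -> J f x ^+ 2 <= L * sqn L f.
Proof.
move=> Lf xL; have := sup_II L_gt0 Lf xL.
rewrite -[J f x ^+ 2]real_normK ?num_real// => h.
rewrite -(sqr_nrm L f) -[X in X * _](sqr_sqrtr (ltW L_gt0)) -exprMn.
by rewrite lerXn2r ?nnegrE ?mulr_ge0 ?sqrtr_ge0.
Qed.

Lemma weight_psid : measurable_fun `]alpha, beta[ (fun x => psi x * d x) /\
  ae_on alpha beta (fun x => `|psi x * d x| <= K).
Proof.
split; first by apply: measurable_funM; [exact: prim_meas psi_prim|exact: measS d_meas].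
apply: ae_on_imp (ae_onS alpha_ge0 beta_le_L d_norm_bnd) => x /psi_bnd h1 h2.
by rewrite normrM -[leRHS]mul1r ler_pM.
Qed.

(** * Inequalities along a single flow *)

Section OneFlow.
Variables (q r w rho v S : R -> R).
Hypothesis Hf : flow q r w rho v S.

Let Lq : L2 0 L q. Proof. by case: Hf => -[]. Qed.
Let Lr : L2 0 L r. Proof. by case: Hf => -[]. Qed.
Let Lrho : L2 0 L rho. Proof. by case: Hf => -[]. Qed.
Let Pv : prim 0 L r v. Proof. by case: Hf => _ []. Qed.
Let v0 : v 0 = 0. Proof. by case: Hf => _ []. Qed.
Let vL : v L = 0. Proof. by case: Hf => _ []. Qed.
Let PS : prim 0 L w S. Proof. by case: Hf => _ _ []. Qed.
Let HS : ae_on 0 L (fun x => S x = p x * q x + d x * r x). Proof. by case: Hf => _ _ []. Qed.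
Let Pw : prim 0 L rho w. Proof. by case: Hf. Qed.
Let q0 : II 0 L q = 0. Proof. by case: Hf. Qed.
Let Lv : L2 0 L v. Proof. exact: prim_L2 Pv. Qed.
Let Lw : L2 0 L w. Proof. exact: prim_L2 Pw. Qed.
Let LS : L2 0 L S. Proof. exact: prim_L2 PS. Qed.

Lemma pqq_intg s t : 0 <= s -> t <= L -> intg s t (fun x => p x * q x ^+ 2).
Proof.
move=> s0 tL; apply: (@intg_mul_bnd _ _ _ K); first exact: measS p_meas.
  have := c0_gt0; move=> c00; apply: ae_on_imp (ae_onS s0 tL p_bnd) => x _ /andP[h1 h2].
  by rewrite ger0_norm//; lra.
by apply: (intgS s0 tL); exact: Lq.2.
Qed.

Lemma energy_ge0 : 0 <= energy q v.
Proof.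
apply: addr_ge0; last by apply: II_ge0 => x _; exact: sqr_ge0.
apply: II_ae_ge0; first exact: pqq_intg.
have := c0_gt0; move=> c00.
by apply: ae_on_imp p_bnd => x _ /andP[h1 h2]; rewrite mulr_ge0 ?sqr_ge0//; lra.
Qed.

Lemma sqn_q_le : sqn L q <= c0^-1 * energy q v.
Proof.
rewrite mulrC ler_pdivlMr//.
apply: (@le_trans _ _ (II 0 L (fun x => p x * q x ^+ 2))); last first.
  by rewrite lerDl; apply: II_ge0 => x _; exact: sqr_ge0.
rewrite mulrC /sqn -IIZ; last exact: Lq.2.
apply: le_II; [by apply: intgZ; exact: Lq.2|exact: pqq_intg|].
by apply: ae_on_imp p_bnd => x _ /andP[h1 h2]; rewrite ler_wpM2r ?sqr_ge0.
Qed.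

Lemma sqn_v_le : sqn L v <= energy q v.
Proof.
rewrite lerDr; apply: II_ae_ge0; first exact: pqq_intg.
have := c0_gt0; move=> c00.
by apply: ae_on_imp p_bnd => x _ /andP[h1 h2]; rewrite mulr_ge0 ?sqr_ge0//; lra.
Qed.

(* The multiplier m q v: its time derivative on an interval where p = k and d = 0. *)
Lemma elastic_interval s t k ma mb : 0 <= s -> s <= t -> t <= L -> 0 < k ->
  ae_on s t (fun x => p x = k) -> ae_on s t (fun x => d x = 0) ->
  WF s t (fun x => ma + mb * x) r v + WF s t (fun x => ma + mb * x) q w =
  ((ma + mb * t) * (v t ^+ 2 + k^-1 * S t ^+ 2) -
   (ma + mb * s) * (v s ^+ 2 + k^-1 * S s ^+ 2)) / 2 -
  mb / 2 * (II s t (fun x => p x * q x ^+ 2) + II s t (fun x => v x ^+ 2)).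
Proof.
move=> s0 st tL k0 pk d0.
have kn0 : k != 0 by rewrite gt_eqF.
have Sk : ae_on s t (fun x => S x = k * q x).
  apply: ae_on_imp2 (ae_onS s0 tL HS) (ae_on_and pk d0) => x _ -> [-> ->].
  by rewrite mul0r addr0.
have Pm : prim s t (cst mb) (fun x => ma + mb * x).
  have := primD (prim_cst s t ma) (primZ mb (prim_id s t)).
  by move=> H; apply: (eq_prim H) => x _ //=; rewrite add0r mulr1.
have Pv' := primS Pv s0 tL; have PS' := primS PS s0 tL.
have PP := prim_mul Pm (primD (prim_mul Pv' Pv') (primZ k^-1 (prim_mul PS' PS'))).
have := prim_sub PP (lexx s) st (lexx t).
set m := fun x => ma + mb * x.
have mm : measurable_fun `]s, t[ m by exact: prim_meas Pm.
have wm : weight s t m.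
  split => //; have [M M0 HM] := prim_bounded Pm; exists M => //.
  by apply: ae_onW => x /andP[h1 h2]; apply: HM; rewrite !ltW.
have Irv := WF_intg s0 tL wm Lr Lv.
have Iqw := WF_intg s0 tL wm Lq Lw.
have ISw := WF_intg s0 tL wm LS Lw.
have Ivv := (L2S s0 tL Lv).2; have ISS := (L2S s0 tL LS).2.
have e1 : II s t (fun x => p x * q x ^+ 2) = k^-1 * II s t (fun x => S x ^+ 2).
  rewrite -IIZ//; apply: II_ae.
  - exact: intg_meas (pqq_intg s0 tL).
  - by apply: intg_meas; exact: intgZ.
  - apply: ae_on_imp2 pk Sk => x _ -> ->; rewrite exprMn; field; exact: kn0.
have e2 : WF s t m q w = k^-1 * II s t (fun x => m x * (S x * w x)).
  rewrite -IIZ//; apply: II_ae.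
  - exact: intg_meas Iqw.
  - by apply: intg_meas; exact: intgZ.
  - by apply: ae_on_imp Sk => x _ ->; field.
rewrite (@eq_II _ _ _ _ (fun x => (mb * v x ^+ 2 + mb * k^-1 * S x ^+ 2) + (2 * (m x * (r x * v x)) + 2 * k^-1 * (m x * (S x * w x))))); last first.
  by move=> x _ /=; rewrite /m; ring.
rewrite IID; [|by apply: intgD; exact: intgZ|by apply: intgD; exact: intgZ].
rewrite !IID; [|exact: intgZ..]; rewrite !IIZ// e1 e2 -/(WF s t m r v).
move=> H; rewrite /WF in H *; rewrite !expr2; lra.
Qed.

Lemma pqq_I_le : II alpha beta (fun x => p x * q x ^+ 2) <= K * onI q.
Proof.
rewrite -IIZ; last exact: (L2I Lq).2.
apply: le_II; [exact: pqq_intg|by apply: intgZ; exact: (L2I Lq).2|].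
apply: ae_on_imp (ae_onS alpha_ge0 beta_le_L p_bnd) => x _ /andP[h1 h2].
by rewrite ler_wpM2r ?sqr_ge0.
Qed.

Lemma elastic_le :
  energy q v + 2 * (Fa r v + Fa q w) <=
  (alpha + K / c0 * (L - l) + l) * (1 + c0^-1) * (traces v + traces S) +
  (K * onI q + onI v).
Proof.
have ll := ltW l_lt_L; have bl := beta_le_l; have b0 := beta_gt0; have l0 := l_ge0.
have /andP[k1a _] := k1_bnd; have /andP[k2a k2b] := k2_bnd; have /andP[k3a _] := k3_bnd.
have k1p := lt_le_trans c0_gt0 k1a; have k2p := lt_le_trans c0_gt0 k2a.
have k3p := lt_le_trans c0_gt0 k3a.
have e1 := @elastic_interval 0 alpha k1 0 1 (lexx 0) alpha_ge0 alpha_le_L k1p p_left d_left.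
have d2 := ae_onS (lexx beta) ll d_right; have d3 := ae_onS beta_le_l (lexx L) d_right.
have e2 := @elastic_interval beta l k2 (- (K / c0 * (L - l) + l)) 1 b0 bl ll k2p p_mid d2.
have e3 := @elastic_interval l L k3 (- L) 1 l0 ll (lexx L) k3p p_right d3.
rewrite vL v0 in e1 e3.
have E : energy q v =
   (II 0 alpha (fun x => p x * q x ^+ 2) + II 0 alpha (fun x => v x ^+ 2)) +
   (II alpha beta (fun x => p x * q x ^+ 2) + onI v) +
   ((II beta l (fun x => p x * q x ^+ 2) + II beta l (fun x => v x ^+ 2)) +
    (II l L (fun x => p x * q x ^+ 2) + II l L (fun x => v x ^+ 2))).
  have I1 := pqq_intg (lexx 0) (lexx L); have I2 := pqq_intg alpha_ge0 (lexx L).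
  have I3 := pqq_intg b0 (lexx L).
  have J1 := Lv.2; have J2 := (L2S alpha_ge0 (lexx L) Lv).2; have J3 := (L2S b0 (lexx L) Lv).2.
  rewrite /energy /onI.
  rewrite (II_split alpha_ge0 alpha_le_L I1) (II_split alpha_le_beta beta_le_L I2) (II_split bl ll I3).
  rewrite (II_split alpha_ge0 alpha_le_L J1) (II_split alpha_le_beta beta_le_L J2) (II_split bl ll J3).
  ring.
have hI := pqq_I_le.
have -> : Fa r v + Fa q w =
  (WF 0 alpha (fun x => 0 + 1 * x) r v + WF 0 alpha (fun x => 0 + 1 * x) q w) +
  ((WF beta l (fun x => - (K / c0 * (L - l) + l) + 1 * x) r v + WF beta l (fun x => - (K / c0 * (L - l) + l) + 1 * x) q w) +
   (WF l L (fun x => - L + 1 * x) r v + WF l L (fun x => - L + 1 * x) q w)).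
  by rewrite /Fa; ring.
rewrite e1 e2 e3 E /traces.
have := elastic_arith c0_gt0 alpha_ge0 b0 bl ll k1a k2a k2b k3a (sqr_ge0 (v alpha)) (sqr_ge0 (v beta))
  (sqr_ge0 (v l)) (sqr_ge0 (S alpha)) (sqr_ge0 (S beta)) (sqr_ge0 (S l)).
move: hI; set E1 := II 0 alpha _ + _; set E2 := II beta l _ + _; set E3 := II l L _ + _.
set EI := II alpha beta _; set KQ := K * onI q; set RHS := (X in _ <= X -> _).
set t1 := alpha * _; set t2 := (_ - beta) * _; set t3 := _ - _.
rewrite -/RHS -/KQ.
have -> : (0 + 1 * alpha) * (v alpha ^+ 2 + k1^-1 * S alpha ^+ 2) = t1 by rewrite /t1; ring.
have -> : (- (K / c0 * (L - l) + l) + 1 * l) * (v l ^+ 2 + k2^-1 * S l ^+ 2) =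
   - (K / c0 * (L - l) * (v l ^+ 2 + k2^-1 * S l ^+ 2)) by ring.
have -> : (- (K / c0 * (L - l) + l) + 1 * beta) * (v beta ^+ 2 + k2^-1 * S beta ^+ 2) = - t2.
  by rewrite /t2; ring.
have -> : (- L + 1 * l) * (v l ^+ 2 + k3^-1 * S l ^+ 2) =
   - (t3 + K / c0 * (L - l) * (v l ^+ 2 + k2^-1 * S l ^+ 2)) by rewrite /t3; ring.
have -> : (0 + 1 * 0) * (0 ^+ 2 + k1^-1 * S 0 ^+ 2) = 0 by ring.
have -> : (- L + 1 * L) * (0 ^+ 2 + k3^-1 * S L ^+ 2) = 0 by ring.
set z := _ * (L - l) * _.
exact: elastic_sum.
Qed.

Lemma v_traces : traces v <= (2 / (beta - alpha) + 2) * onI v + 2 * onI r.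
Proof.
have := trace_le ltr01 (L2I Lr) (primS Pv alpha_ge0 beta_le_L).
rewrite invr1; lra.
Qed.

Lemma S_onI : onI S <= 2 * K ^+ 2 * (onI q + onI r).
Proof.
have K0 := K_gt0; have Iq := (L2I Lq).2; have Ir := (L2I Lr).2.
rewrite /onI -IID// -IIZ; last exact: intgD.
apply: le_II; [exact: (L2I LS).2|by apply: intgZ; exact: intgD|].
have HS' := ae_onS alpha_ge0 beta_le_L HS.
have Hp := ae_onS alpha_ge0 beta_le_L p_norm_bnd.
have Hd := ae_onS alpha_ge0 beta_le_L d_norm_bnd.
apply: ae_on_imp2 HS' (ae_on_and Hp Hd) => x _ -> [hp hd].
have h1 : (p x * q x) ^+ 2 <= K ^+ 2 * q x ^+ 2.
  rewrite exprMn ler_wpM2r ?sqr_ge0// -[p x ^+ 2]real_normK ?num_real//.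
  by rewrite lerXn2r ?nnegrE// ltW.
have h2 : (d x * r x) ^+ 2 <= K ^+ 2 * r x ^+ 2.
  rewrite exprMn ler_wpM2r ?sqr_ge0// -[d x ^+ 2]real_normK ?num_real//.
  by rewrite lerXn2r ?nnegrE// ltW.
have := sqr_ge0 (p x * q x - d x * r x); nra.
Qed.

Lemma J_v x : 0 <= x <= L -> J r x = v x.
Proof. by move=> xL; rewrite /J; case: Pv => _ ->//; rewrite v0 add0r. Qed.

(* Fe is the product of v and of the primitive of q over the damped interval. *)
Lemma kinetic_le eps : 0 < eps ->
  onI v + (Fe r v + Fe q w) <= 2 * eps * (L / c0) * energy q v +
    eps^-1 * traces S + (onI q + onI S).
Proof.
move=> eps0; have c00 := c0_gt0.
have aL : 0 <= alpha <= L by rewrite alpha_ge0.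
have bL : 0 <= beta <= L by rewrite beta_gt0.
have e1 : Fe r v = - onI v.
  rewrite /Fe mulN1r; congr (- _); apply: eq_II => x /sub_itv/andP[h1 h2].
  by rewrite J_v ?mul1r ?expr2// !ltW.
have PJ : prim alpha beta q (J q) by apply: (primS (prim_II (L2_intg Lq))).
have PS' := primS PS alpha_ge0 beta_le_L.
have := prim_sub (prim_mul PJ PS') (lexx alpha) alpha_le_beta (lexx beta).
have IqS := L2_mul (L2I Lq) (L2I LS).
have IJw := L2_mul (prim_L2 PJ) (L2I Lw).
rewrite IID// => H.
have e2 : Fe q w = - II alpha beta (fun x => J q x * w x).
  by rewrite /Fe mulN1r; congr (- _); apply: eq_II => x _; rewrite mul1r.
have y1 := young_num (J q beta) (S beta) eps0.
have y2 := young_num (J q alpha) (S alpha) eps0.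
have j1 := J_sqr Lq bL; have j2 := J_sqr Lq aL.
have sq := ler_wpM2l (ltW L_gt0) sqn_q_le.
have mc : measurable_fun `]alpha, beta[ (cst (1 : R)) by exact: measurable_cst.
have y3 := young_II ltr01 mc ler01 (ae_onW (fun x _ => ltac:(by rewrite normr1) : `|cst 1 x| <= (1 : R))) (L2I Lq) (L2I LS).
rewrite !mul1r invr1 !mul1r -/(onI q) -/(onI S) in y3.
have e3 : II alpha beta (fun x => cst 1 x * (q x * S x)) = II alpha beta (fun x => q x * S x).
  by apply: eq_II => x _; rewrite mul1r.
rewrite e3 in y3.
have j1' := ler_wpM2l (ltW eps0) (le_trans j1 sq).
have j2' := ler_wpM2l (ltW eps0) (le_trans j2 sq).
have z1 := ler_norm (- (J q beta * S beta)); rewrite normrN in z1.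
have z2 := ler_norm (J q alpha * S alpha).
have z3 := ler_norm (II alpha beta (fun x => q x * S x)).
rewrite e1 e2 /traces.
have -> : 2 * eps * (L / c0) * energy q v = eps * (L * (c0^-1 * energy q v)) + eps * (L * (c0^-1 * energy q v)).
  by ring.
lra.
Qed.

(** The part in p q is of the kind a quadratic form can compensate; the part in d r is paid for by
    the dissipation. *)
Lemma flux_split m g : weight alpha beta (fun x => m x * p x) ->
  measurable_fun `]alpha, beta[ m ->
  measurable_fun `]alpha, beta[ (fun x => m x * d x) ->
  ae_on alpha beta (fun x => `|m x * d x| <= K) ->
  L2 0 L g ->
  II alpha beta (fun x => m x * (S x * g x)) =
  WF alpha beta (fun x => m x * p x) q g + II alpha beta (fun x => m x * d x * (r x * g x)).
Proof.
move=> wp mm md bd Lg.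
have I1 := WF_intg alpha_ge0 beta_le_L wp Lq Lg.
have I2 : intg alpha beta (fun x => m x * d x * (r x * g x)).
  by apply: (intg_mul_bnd md bd); exact: (L2_mul (L2I Lr) (L2I Lg)).
rewrite -IID//; apply: II_ae.
- apply: measurable_funM => //; apply: measurable_funM.
    exact: (L2I LS).1.
  exact: (L2I Lg).1.
- exact: intg_meas (intgD I1 I2).
- by apply: ae_on_imp (ae_onS alpha_ge0 beta_le_L HS) => x _ ->; ring.
Qed.

(** In the trace identity for [S], the term psi p q w is the time derivative of psi p q v minus psi
    p r v, and [Fb] removes that derivative. Young's inequality handles d r w with [theta] and p r v
    with [eps]. *)
Lemma flux_trace_le theta eps : 0 < theta -> 0 < eps ->
  traces S + (Fb r v + Fb q w) <= 2 / (beta - alpha) * onI S +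
    2 * (K * (theta * onI r + theta^-1 * onI w)) +
    2 * (K * (eps^-1 * onI r + eps * onI v)).
Proof.
move=> th0 eps0; have K0 := ltW K_gt0.
rewrite (trace_identity (primS PS alpha_ge0 beta_le_L)).
have [mpd bpd] := weight_psid.
rewrite (flux_split weight_psip (prim_meas psi_prim) mpd bpd Lw).
have y1 := young_II th0 mpd K0 bpd (L2I Lr) (L2I Lw).
have eV : 0 < eps^-1 by rewrite invr_gt0.
have [mpp _] := weight_psip.
have bpp : ae_on alpha beta (fun x => `|psi x * p x| <= K).
  apply: ae_on_imp (ae_onS alpha_ge0 beta_le_L p_norm_bnd) => x /psi_bnd h1 h2.
  by rewrite normrM -[leRHS]mul1r ler_pM.
have y2 := young_II eV mpp K0 bpp (L2I Lr) (L2I Lv); rewrite invrK in y2.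
have z1 := le_trans (ler_norm _) y1.
have z2 := opp_le_norm y2.
move: z1 z2; rewrite /Fb -/(onI r) -/(onI w) -/(onI v) -/(WF alpha beta _ r v) -/(WF alpha beta _ r w).
move: (WF _ _ _ r v) (WF _ _ _ q w) (WF _ _ _ r w) => x1 x2 x3.
move: (2 / _ * _) (K * _) (K * _) => x4 x5 x6.
exact: flux_sum.
Qed.

(* The only place where D(A^2) and the power kap^-3 enter: w = S' is controlled by
   the dissipation rate of the time derivative. *)
Lemma accel_le kap tau : 0 < kap -> 0 < tau ->
  onI w + (Fc r r + Fc q rho) <= kap * traces S + kap^-1 * traces w +
    2 * K * onI r + K * (tau * onI r + tau^-1 * onI rho).
Proof.
move=> k0 t0; have K0 := ltW K_gt0.
have PS' := primS PS alpha_ge0 beta_le_L; have Pw' := primS Pw alpha_ge0 beta_le_L.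
(* The derivative of S w is w^2 + S rho. In S rho the part p q rho is completed by [Fc], and the
   part d r rho brings in the dissipation of the time derivative. *)
have := prim_sub (prim_mul PS' Pw') (lexx alpha) alpha_le_beta (lexx beta).
have Iww := L2_mul (L2I Lw) (L2I Lw); have ISr := L2_mul (L2I LS) (L2I Lrho).
rewrite IID// => H.
have w1 : weight alpha beta (fun x => 1 * p x).
  by have := weight_p alpha_ge0 beta_le_L; rewrite (_ : (fun x => 1 * p x) = p)//; apply/funext => x; rewrite mul1r.
have md : measurable_fun `]alpha, beta[ (fun x => cst 1 x * d x).
  by apply: measurable_funM => //; exact: measS d_meas.
have bd : ae_on alpha beta (fun x => `|cst 1 x * d x| <= K).
  by apply: ae_on_imp (ae_onS alpha_ge0 beta_le_L d_norm_bnd) => x _; rewrite mul1r.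
have mc : measurable_fun `]alpha, beta[ (cst (1 : R)) by exact: measurable_cst.
have := @flux_split (cst 1) rho w1 mc md bd Lrho.
have e1 : II alpha beta (fun x => cst 1 x * (S x * rho x)) = II alpha beta (fun x => S x * rho x).
  by apply: eq_II => x _; rewrite mul1r.
have e2 : WF alpha beta (fun x => cst 1 x * p x) q rho = Fc q rho.
  by apply: eq_II => x _; rewrite mul1r.
rewrite e1 e2 => H2.
have y1 := young_II t0 md K0 bd (L2I Lr) (L2I Lrho).
have mp := measS alpha_ge0 beta_le_L p_meas.
have y2 := young_II ltr01 mp K0 (ae_onS alpha_ge0 beta_le_L p_norm_bnd) (L2I Lr) (L2I Lr).
rewrite invr1 !mul1r -/(onI r) in y2.
have z1 := opp_le_norm y1.
have z2 : Fc r r <= K * (onI r + onI r) := le_trans (ler_norm _) y2.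
have z3 := le_trans (ler_norm _) (young_num (S beta) (w beta) k0).
have z4 := opp_le_norm (young_num (S alpha) (w alpha) k0).
have e3 : onI w = II alpha beta (fun x => w x * w x) by apply: eq_II => x _; rewrite expr2.
rewrite e3 /traces.
rewrite -/(onI r) -/(onI rho) in z1.
move: H H2 z1 z2 z3 z4.
move: (II _ _ (fun x => w x * w x)) (II _ _ (fun x => S x * rho x)) (II _ _ (fun x => cst 1 x * d x * _)) => x1 x2 x3.
move: (Fc r r) (Fc q rho) (onI r) (onI rho) => x4 x5 x6 x7.
rewrite !mulrDr.
move: (S beta * w beta) (S alpha * w alpha) (kap * S beta ^+ 2) (kap * S alpha ^+ 2)
  (kap^-1 * w beta ^+ 2) (kap^-1 * w alpha ^+ 2) => y3 y4 y5 y6 y7 y8.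
exact: accel_sum.
Qed.

(* Yop v is the primitive of v whose mean for the weight p^-1 vanishes; its time derivative
   is S minus the weighted mean of d r, since q has mean zero. *)
Lemma strain_le eps CY : 0 < eps -> 0 <= CY ->
  (forall f, L2 0 L f -> nrm L (Yop f) <= CY * nrm L f) ->
  c0 * onI q + (Fd r v + Fd q w) <= eps * (beta - alpha + K) * onI q +
    eps * CY ^+ 2 * energy q v +
    (eps^-1 * ((II 0 L pinv)^-1 ^+ 2 * ((beta - alpha) * (K / c0) ^+ 2)) + eps^-1 * K + eps^-1) * onI r.
Proof.
move=> eps0 CY0 HY; have K0 := ltW K_gt0; have c00 := c0_gt0.
pose g x := pinv x * d x.
have mg : measurable_fun `]0, L[ g by apply: measurable_funM => //; exact: pinv_meas.
have bg : ae_on 0 L (fun x => `|g x| <= K / c0).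
  apply: ae_on_imp2 pinv_bnd d_norm_bnd => x _ h1 h2.
  by rewrite normrM mulrC ler_pM.
pose h x := g x * r x.
have Lh : L2 0 L h by exact: L2_mul_bnd mg bg Lr.
(* The weighted mean of d r, bounded by [r] on the damped interval alone because [d] vanishes
   elsewhere. *)
pose md := (II 0 L pinv)^-1 * II 0 L h.
have hI : II 0 L h = II alpha beta h.
  have Ih := L2_intg Lh; have Ih2 := intgS alpha_ge0 (lexx L) Ih.
  rewrite (II_split alpha_ge0 alpha_le_L Ih) (II_split alpha_le_beta beta_le_L Ih2).
  have z s t : 0 <= s -> t <= L -> ae_on s t (fun x => d x = 0) -> II s t h = 0.
    move=> s0 tL d0; rewrite (@II_ae _ s t h (fun=> 0)).
    - by rewrite /II /Rintegral integral0.
    - exact: measS Lh.1.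
    - exact: measurable_cst.
    - by apply: ae_on_imp d0 => x _; rewrite /h /g => ->; rewrite mulr0 mul0r.
  by rewrite (z _ _ (lexx 0) alpha_le_L d_left) (z _ _ beta_gt0 (lexx L) d_right) add0r addr0.
have md2 : md ^+ 2 <= (II 0 L pinv)^-1 ^+ 2 * ((beta - alpha) * (K / c0) ^+ 2) * onI r.
  rewrite /md exprMn hI -mulrA ler_wpM2l ?sqr_ge0//.
  apply: (le_trans (sqr_II_le (L2I Lh))); rewrite -mulrA; apply: ler_wpM2l.
    exact: ltW.
  rewrite /onI -IIZ; last exact: (L2I Lr).2.
  apply: le_II; [exact: (L2I Lh).2|by apply: intgZ; exact: (L2I Lr).2|].
  apply: ae_on_imp (ae_onS alpha_ge0 beta_le_L bg) => x _ hb.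
  rewrite exprMn ler_wpM2r ?sqr_ge0// -[g x ^+ 2]real_normK ?num_real//.
  by rewrite lerXn2r ?nnegrE// divr_ge0// ltW.
have Jw x : 0 <= x <= L -> J w x = S x - S 0.
  by move=> xL; rewrite /J; case: PS => _ ->//; ring.
have Iq := L2_intg Lq; have Ih := L2_intg Lh.
have Ipi : intg 0 L pinv by exact: intg_bnd pinv_meas pinv_bnd.
have IpS : intg 0 L (fun x => pinv x * S x).
  by apply: (intg_mul_bnd pinv_meas pinv_bnd); exact: L2_intg.
have IpSE : II 0 L (fun x => pinv x * S x) = II 0 L h.
  rewrite -[RHS]add0r -{2}q0 -IID//; apply: II_ae.
  - exact: intg_meas IpS.
  - exact: intg_meas (intgD Iq Ih).
  - apply: ae_on_imp2 HS p_pinv => x _ -> pp; rewrite /h /g mulrDr !mulrA pp; ring.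
have meanJ : mean (J w) = md - S 0.
  rewrite /mean (@eq_II _ 0 L (fun x => pinv x * J w x) (fun x => pinv x * S x - S 0 * pinv x)); last first.
    by move=> x /andP[x0 xL]; rewrite Jw ?(ltW x0) ?(ltW xL)//; ring.
  rewrite IIB//; last exact: intgZ.
  rewrite IIZ// IpSE /md; field.
  by rewrite gt_eqF// II_pinv_gt0.
have Yw x : 0 < x < L -> Yop w x = S x - md.
  by move=> /andP[x0 xL]; rewrite /Yop meanJ Jw ?(ltW x0) ?(ltW xL)//; ring.
have mdm := measS alpha_ge0 beta_le_L d_meas.
have bd := ae_onS alpha_ge0 beta_le_L d_norm_bnd.
have Idqr : intg alpha beta (fun x => d x * (q x * r x)).
  by apply: (intg_mul_bnd mdm bd); exact: (L2_mul (L2I Lq) (L2I Lr)).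
have IqI := L2_intg (L2I Lq).
have Ipq : intg alpha beta (fun x => p x * q x ^+ 2) by exact: pqq_intg.
(* On the damped interval [Yop w] is p q + d r - md, so p q^2 cancels and both remaining terms are
   controlled through [r]. *)
have e1 : II alpha beta (fun x => p x * q x ^+ 2) + Fd q w =
    md * II alpha beta q - II alpha beta (fun x => d x * (q x * r x)).
  have LY : L2 0 L (Yop w) by case: Yop_op => h1 _ _; exact: h1.
  have IqY := L2_mul (L2I Lq) (L2I LY).
  rewrite /Fd /WF (@eq_II _ alpha beta (fun x => cst 1 x * (q x * Yop w x)) (fun x => q x * Yop w x)); last first.
    by move=> x _; rewrite mul1r.
  rewrite mulN1r -IIB// -IIZ// -IIB//; last exact: intgZ.
  apply: II_ae.
  - exact: intg_meas (intgB Ipq IqY).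
  - exact: intg_meas (intgB (intgZ md IqI) Idqr).
  - apply: ae_on_imp (ae_onS alpha_ge0 beta_le_L HS) => x /sub_itv xL Sx.
    by rewrite Yw// Sx; ring.
have low : c0 * onI q <= II alpha beta (fun x => p x * q x ^+ 2).
  rewrite -IIZ; last exact: (L2I Lq).2.
  apply: le_II; [by apply: intgZ; exact: (L2I Lq).2|exact: Ipq|].
  apply: ae_on_imp (ae_onS alpha_ge0 beta_le_L p_bnd) => x _ /andP[h1 h2].
  by rewrite ler_wpM2r ?sqr_ge0.
have LYv : L2 0 L (Yop v) by case: Yop_op => h1 _ _; exact: h1.
have mc : measurable_fun `]alpha, beta[ (cst (1 : R)) by exact: measurable_cst.
have eV : 0 < eps^-1 by rewrite invr_gt0.
have bc : ae_on alpha beta (fun x => `|cst 1 x| <= (1 : R)) by apply: ae_onW => x _; rewrite normr1.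
have y1 := young_II eV mc ler01 bc (L2I Lr) (L2I LYv).
rewrite mul1r invrK -/(onI r) -/(onI (Yop v)) in y1.
have y2 := young_II eps0 mdm K0 bd (L2I Lq) (L2I Lr).
have y3 := young_num (II alpha beta q) md eps0.
have y4 := sqr_II_le (L2I Lq).
have y5 : onI (Yop v) <= CY ^+ 2 * energy q v.
  apply: (le_trans (onI_le LYv)); rewrite -(sqr_nrm L).
  apply: (@le_trans _ _ ((CY * nrm L v) ^+ 2)).
    by rewrite lerXn2r ?nnegrE ?mulr_ge0 ?nrm_ge0// HY.
  by rewrite exprMn ler_wpM2l ?sqr_ge0// sqr_nrm sqn_v_le.
have y4' := ler_wpM2l (ltW eps0) y4; have y5' := ler_wpM2l (ltW eps0) y5.
have y6 := ler_wpM2l (ltW eV) md2.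
have z1 := opp_le_norm y1.
have z2 := opp_le_norm y2.
have z3 := le_trans (ler_norm _) y3.
rewrite -/(onI q) -/(onI r) in z2; rewrite mulrC in z3.
have e2 : Fd r v = - II alpha beta (fun x => cst 1 x * (r x * Yop v x)) by rewrite /Fd mulN1r.
rewrite -[eps * CY ^+ 2 * energy q v]mulrA.
rewrite e2; move: e1 low y4' y5' y6 z1 z2 z3.
move: (II _ _ (fun x => p x * q x ^+ 2)) (Fd q w) (II _ _ (fun x => d x * _)) (II _ _ (fun x => cst 1 x * _)) => x1 x2 x3 x4.
move: (md * II alpha beta q) (CY ^+ 2 * energy q v) ((II 0 L pinv)^-1 ^+ 2 * ((beta - alpha) * (K / c0) ^+ 2)) => x5 x6 x7.
move: (II alpha beta q ^+ 2) (md ^+ 2) (onI (Yop v)) (onI q) (onI r) (eps^-1) => x8 x9 x10 x11 x12 x13.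
exact: strain_sum.
Qed.

End OneFlow.
Definition damped f := II 0 L (fun x => d x * f x ^+ 2).

Lemma damped_intg f : L2 0 L f -> intg 0 L (fun x => d x * f x ^+ 2).
Proof. by move=> Lf; apply: (intg_mul_bnd d_meas d_norm_bnd); exact: Lf.2. Qed.

Lemma onI_damped f : L2 0 L f -> c0 * onI f <= damped f.
Proof.
move=> Lf; have Id := damped_intg Lf.
have d0 : ae_on 0 L (fun x => 0 <= d x * f x ^+ 2).
  by apply: ae_on_imp d_bnd => x _ /andP[h1 h2]; rewrite mulr_ge0 ?sqr_ge0.
apply: (le_trans _ (le_II_sub alpha_ge0 alpha_le_beta beta_le_L Id d0)).
rewrite -IIZ; last exact: (L2I Lf).2.
apply: le_II; [by apply: intgZ; exact: (L2I Lf).2|exact: intgS Id|].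
by apply: ae_on_imp d_ge => x _ h; rewrite ler_wpM2r ?sqr_ge0.
Qed.

(** The constants follow the order of absorption: [eps] is fixed once [B1] is known, [eps1] once
    [B2] is, [eps3] once [B5] is. The threshold on [kap] makes [kap^-1 * (2 / (beta - alpha))] at
    most 1/4, as the traces of w require. *)
Lemma static_estimate : exists F1 F2 : (R -> R) -> (R -> R) -> R, [/\ L2form L F1, L2form L F2 &
  exists2 C : R, 0 < C & exists2 kap0 : R, 0 < kap0 &
  forall kap q r w rho v S, kap0 <= kap -> flow q r w rho v S ->
    energy q v + (F1 r v + F1 q w) + kap^-1 * (F2 r r + F2 q rho) <=
    C * (kap * damped r + kap ^- 3 * damped rho)].
Proof.
have c00 := c0_gt0; have K0 := K_gt0; have L0 := L_gt0; have len0 := len_gt0.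
have [_ _ [CY CY0 HCY]] := Yop_op.
pose A := (alpha + K / c0 * (L - l) + l) * (1 + c0^-1).
have cV : 0 < c0^-1 by rewrite invr_gt0.
have lp : 0 < l by apply: lt_le_trans beta_le_l; apply: le_lt_trans alpha_ge0 alpha_lt_beta.
have A_gt0 : 0 < A.
  apply: mulr_gt0; last by apply: addr_gt0.
  apply: ltr_wpDl => //; apply: addr_ge0 => //; apply: mulr_ge0; first by rewrite divr_ge0 ?(ltW K0) ?(ltW c00).
  by rewrite subr_ge0 ltW.
pose A' := 2 / (beta - alpha).
have A'0 : 0 < A' by rewrite divr_gt0.
pose A2 := A' + 2.
have A20 : 0 < A2 by rewrite addr_gt0.
pose B1 := A * A2 + 1.
have B10 : 0 < B1 := addr_gt0 (mulr_gt0 A_gt0 A20) ltr01.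
pose A3 := L / c0.
have A30 : 0 < A3 by rewrite divr_gt0.
pose eps := (8 * A3 * B1)^-1.
have eps0 : 0 < eps by rewrite invr_gt0 (mulr_gt0 (mulr_gt0 _ A30) B10).
have e0 : 0 < eps^-1 by rewrite invr_gt0.
pose B2 := B1 * eps^-1 + A.
have B20 : 0 < B2 := addr_gt0 (mulr_gt0 B10 e0) A_gt0.
pose eps1 := (16 * K * B2)^-1.
have eps10 : 0 < eps1 by rewrite invr_gt0 (mulr_gt0 (mulr_gt0 _ K0) B20).
have e10 : 0 < eps1^-1 by rewrite invr_gt0.
have K2 : 0 < K ^+ 2 by rewrite exprn_gt0.
pose D1 := 4 * K ^+ 2 * A'.
have p2 : 0 < 2 :> R by []. have p4 : 0 < 4 :> R by [].
have D10 : 0 < D1 := mulr_gt0 (mulr_gt0 p4 K2) A'0.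
pose D2 := 4 * K ^+ 2 * A' + 32 * K ^+ 2 + 3 * K + 4 * K * eps1^-1 + 16.
have D20 : 0 < D2.
  apply: addr_gt0 => //; apply: addr_gt0; last exact: mulr_gt0 (mulr_gt0 p4 K0) e10.
  by apply: addr_gt0; [apply: addr_gt0 => //; exact: mulr_gt0|exact: mulr_gt0].
pose B5 := K + B1 + B1 * (2 * K ^+ 2) + B2 * D1.
have B50 : 0 < B5.
  apply: addr_gt0; last exact: mulr_gt0 B20 D10.
  by apply: addr_gt0; [exact: addr_gt0|exact: mulr_gt0 B10 (mulr_gt0 p2 K2)].
have M0 : 0 <= 2 / c0 * B5 * CY ^+ 2.
  by apply: mulr_ge0; [by rewrite !mulr_ge0 ?invr_ge0 ?(ltW B50) ?(ltW c00)|exact: sqr_ge0].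
have M1 : 0 < 2 / c0 * B5 * CY ^+ 2 + 1 by rewrite ltr_wpDl.
have lK : 0 < beta - alpha + K by rewrite addr_gt0.
pose eps3 := Num.min (c0 / 2 / (beta - alpha + K)) (4^-1 / (2 / c0 * B5 * CY ^+ 2 + 1)).
have eps30 : 0 < eps3 by rewrite lt_min !divr_gt0.
have h3 : eps3 * (beta - alpha + K) <= c0 / 2.
  by rewrite -ler_pdivlMr// ge_min lexx.
have h4 : 2 / c0 * B5 * (eps3 * CY ^+ 2) <= 1 / 4.
  have -> : 2 / c0 * B5 * (eps3 * CY ^+ 2) = eps3 * (2 / c0 * B5 * CY ^+ 2).
    by move: (2 / c0) (CY ^+ 2) => x y; ring.
  apply: (@le_trans _ _ (eps3 * (2 / c0 * B5 * CY ^+ 2 + 1))).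
    by rewrite ler_pM2l// lerDl.
  by rewrite -ler_pdivlMr// div1r ge_min lexx orbT.
pose Cr := eps3^-1 * ((II 0 L pinv)^-1 ^+ 2 * ((beta - alpha) * (K / c0) ^+ 2)) + eps3^-1 * K + eps3^-1.
have Cr0 : 0 <= Cr.
  have e30 : 0 <= eps3^-1 by rewrite invr_ge0 ltW.
  apply: addr_ge0 => //; apply: addr_ge0; apply: mulr_ge0 => //; last exact: ltW.
  by apply: mulr_ge0; [exact: sqr_ge0|apply: mulr_ge0; [exact: ltW|exact: sqr_ge0]].
pose C := 4 * (2 * A + B1 * (2 * K ^+ 2) + B2 * D2 + 2 / c0 * B5 * Cr).
have C0 : 0 < C.
  apply: mulr_gt0 => //; apply: ltr_wpDr.
    by apply: mulr_ge0 => //; rewrite mulr_ge0 ?divr_ge0 ?ltW.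
  apply: addr_gt0; last exact: mulr_gt0 B20 D20.
  by apply: addr_gt0; [exact: mulr_gt0|exact: mulr_gt0 B10 (mulr_gt0 p2 K2)].
exists (fun f g => 8 * Fa f g + (4 * B1 * Fe f g + (8 * B2 * Fb f g + 8 / c0 * B5 * Fd f g))).
exists (fun f g => 4 * B2 * Fc f g); split.
- apply: L2formD; first exact: (L2formZ _ Fa_form).
  apply: L2formD; first exact: (L2formZ _ Fe_form).
  by apply: L2formD; [exact: (L2formZ _ Fb_form)|exact: (L2formZ _ Fd_form)].
- exact: (L2formZ _ Fc_form).
exists (C * c0^-1); first exact: mulr_gt0.
exists (Num.max 1 (8 / (beta - alpha))); first by rewrite lt_max ltr01.
move=> kap q r w rho v S; rewrite ge_max => /andP[kap1 kap8] Hf.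
have kp : 0 < kap by apply: lt_le_trans kap1.
have i0 : 0 < kap^-1 by rewrite invr_gt0.
have ki : kap * kap^-1 = 1 by rewrite mulfV// gt_eqF.
have iA : kap^-1 * A' <= 1 / 4.
  exact: inv_scale_le.
have [[Lq Lr Lrho] [Pv v0 vL] [PS HS] Pw q0] := Hf.
have LS := prim_L2 PS; have Lw := prim_L2 Pw; have Lv := prim_L2 Pv.
have VE : onI v <= energy q v by apply: (le_trans (onI_le Lv)); exact: sqn_v_le Hf.
have W0 := onI_ge0 w; have r0 := onI_ge0 r; have rho0 := onI_ge0 rho; have Q0 := onI_ge0 q.
(* Young parameters. With [8 * K * kap] and [kap / 8] the multiples of [onI w] produced can be
   absorbed; [kap ^+ 2], after division by [kap], yields the weights [kap] of r and [kap ^- 3] of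
   rho. *)
have th0 : 0 < 8 * K * kap by do ?apply: mulr_gt0.
have t0 : 0 < kap ^+ 2 by rewrite exprn_gt0.
have t8 : 0 < kap / 8 by rewrite divr_gt0.
have f1 := flux_trace_le Hf th0 eps10.
have f2 := accel_le Hf kp t0.
have f3 := trace_le t8 (L2I Lrho) (primS Pw alpha_ge0 beta_le_L).
have f4 := S_onI Hf.
rewrite invfM in f1; rewrite -exprVn in f2; rewrite invf_div [8 / kap]mulrC in f3.
rewrite [kap^-1 * 8]mulrC in f3.
have F := flux_arith K0 A'0 kap1 i0 ki iA eps10 e10 W0 r0 rho0 VE f4 f1 f2 f3.
pose Z := kap * onI r + kap^-1 ^+ 3 * onI rho.
have rZ : onI r <= Z.
  apply: (@le_trans _ _ (kap * onI r)); first by rewrite ler_peMl.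
  by rewrite lerDl mulr_ge0// exprn_ge0// ltW.
have h1 : B1 * (2 * eps * A3) = 1 / 4 by rewrite /eps; field; rewrite !gt_eqF.
have h2 : B2 * (4 * K * eps1) = 1 / 4 by rewrite /eps1; field; rewrite !gt_eqF.
have b1E : B1 = A * A2 + 1 by []. have b2E : B2 = B1 * eps^-1 + A by [].
have b5E : B5 = K + B1 + B1 * (2 * K ^+ 2) + B2 * D1 by [].
have := static_arith A_gt0 A20 K0 A30 c00 (ltW D10) (ltW D20) Cr0 eps0 e0 b1E h1 b2E h2 b5E
  h3 h4 (energy_ge0 Hf) Q0 r0 rZ (elastic_le Hf) (v_traces Hf) f4 (kinetic_le Hf eps0) F
  (strain_le Hf eps30 CY0 HCY).
rewrite -/C => H.
have hZ : Z <= c0^-1 * (kap * damped r + kap ^- 3 * damped rho).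
  rewrite -exprVn mulrDr; apply: lerD.
    rewrite mulrCA ler_pM2l// ler_pdivlMl//; exact: onI_damped.
  rewrite mulrCA ler_pM2l ?exprn_gt0// ler_pdivlMl//; exact: onI_damped.
rewrite -[leRHS]mulrA; apply: (le_trans _ (ler_wpM2l (ltW C0) hZ)).
apply: le_trans H; rewrite le_eqVlt; apply/orP; left; apply/eqP; rewrite /=.
move: (Fa r v) (Fa q w) (Fe r v) (Fe q w) (Fb r v) (Fb q w) (Fd r v) (Fd q w) (Fc r r) (Fc q rho) (8 / c0) (energy q v) kap^-1.
by clearbody B1 B2 B5 => *; ring.
Qed.

End Static.

(** * Weak derivatives *)

(** [hs / cs] and [ht / ct] are averages of a function near two points, each within [e / 2] of the
    value there; the last equation says that the averages are equal. *)
Lemma tent_arith {R : realFieldType} (es et cs ct hs ht e m : R) : 0 < m ->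
  `|hs - es * cs| <= e / 4 * m -> `|ht - et * ct| <= e / 4 * m ->
  m / 2 <= cs -> m / 2 <= ct -> ct * hs - cs * ht = 0 -> `|es - et| <= e.
Proof.
move=> m0 A1 A2 M1 M2 E0.
have cs0 : 0 < cs by lra.
have ct0 : 0 < ct by lra.
have e0 : 0 <= e.
  by have := le_trans (normr_ge0 _) A1; rewrite pmulr_lge0//; lra.
have quot x c h : 0 < c -> m / 2 <= c -> `|h - x * c| <= e / 4 * m -> `|h / c - x| <= e / 2.
  move=> c0 mc H.
  have -> : h / c - x = (h - x * c) / c by field; exact: lt0r_neq0.
  rewrite normrM normfV (gtr0_norm c0) ler_pdivrMr//; apply: (le_trans H); nra.
have E1 : hs / cs = ht / ct.
  have -> : hs = cs * ht / ct.
    by apply: (mulfI (lt0r_neq0 ct0)); rewrite (subr0_eq E0); field; exact: lt0r_neq0.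
  by field; rewrite !lt0r_neq0.
have -> : es - et = (ht / ct - et) - (hs / cs - es) by rewrite E1; ring.
have B1 := quot es cs hs cs0 M1 A1; have B2 := quot et ct ht ct0 M2 A2.
apply: (le_trans (ler_normB _ _)); lra.
Qed.

Section WeakDerivative.
Context {R : realType}.
Implicit Types (a b c s t x y eps : R) (f g h u phi F G U : R -> R).
Notation mu := (@lebesgue_measure R).

(** By Lebesgue differentiation [g] is almost everywhere the derivative of its primitive, here
    locally constant. *)
Lemma II_eq0_ae a b g : intg a b g -> (forall x, a <= x <= b -> II a x g = 0) ->
  ae_on a b (fun x => g x = 0).
Proof.
move=> Ig H; pose gr := g \_ `]a, b[.
have Ir := intg_restrict Ig.
have [ab|ba] := ltP a b; last by apply: ae_onW => x /andP[ax xb]; lra.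
have Iy y : mu.-integrable `]-oo, y] (EFin \o gr) by apply: integrableS Ir.
have Lr : locally_integrable [set: R] gr by exact: integrable_locally.
have := FTC1Ny Iy Lr; apply: ae_imp => x [dF FE] /andP[ax xb].
have -> : g x = gr x by rewrite /gr patchE ifT// inE/= in_itv/= ax xb.
rewrite -FE; set F := fun x => _.
have F0 y : a < y < b -> F y = 0.
  move=> /andP[ay yb]; rewrite /F.
  have -> : \int[mu]_(t in `]-oo, y]) gr t = II a y g.
    rewrite /II [LHS]Rintegral_mkcond [RHS]Rintegral_mkcond.
    have -> : gr \_ `]-oo, y] = g \_ `]a, y].
      apply/funext => t; rewrite /gr !patchE !mem_setE !in_itv/=.
      by case: (leP t y) => ty; rewrite ?andbT ?andbF// (le_lt_trans ty yb) andbT.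
    rewrite -!Rintegral_mkcond Rintegral_itv_bndo_bndc//.
    by apply: intgS Ig => //; exact: ltW.
  by rewrite H// (ltW ay) ltW.
rewrite derive1E; apply/cvg_lim => //.
apply/cvgrPdist_le => /= eps eps0.
have Hk : \forall k \near (0 : R)^', a < k + x < b.
  apply/nbhs_ballP; exists (Num.min (x - a) (b - x)) => /=.
    by rewrite lt_min; apply/andP; split; lra.
  move=> k; rewrite /ball/= sub0r normrN lt_min !ltr_norml => /andP[h1 h2] _.
  by apply/andP; split; lra.
near=> k.
have xk : a < k + x < b by near: k.
by rewrite scaler1 F0// (F0 x) ?ax// subrr scaler0 subrr normr0 ltW.
Unshelve. all: by end_near. Qed.

Lemma prim_continuous a b f F : a <= b -> prim a b f F -> {within `[a, b], continuous F}.
Proof.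
move=> ab [If HF].
have c : {within `[a, b], continuous (fun x => F a + II a x f)}.
  apply: within_continuousD; last exact: II_continuous.
  by apply: continuous_subspaceT; exact: cst_continuous.
apply: subspace_eq_continuous c => x; rewrite inE/= in_itv/= => xab.
by rewrite /from_subspace /= (HF x).
Qed.

Lemma within_continuous_near a b F x eps : {within `[a, b], continuous F} ->
  a <= x <= b -> 0 < eps ->
  exists2 del, 0 < del & forall y, a <= y <= b -> `|y - x| < del -> `|F y - F x| < eps.
Proof.
move=> cF xab eps0.
have xI : `[a, b]%classic x by rewrite /= in_itv.
have /cvgrPdist_lt/(_ _ eps0) := cF x.
rewrite /prop_near1 /nbhs /= -nbhs_subspace_in// => /nbhs_ballP[del /= del0 H].
exists del => // y yab yx; rewrite distrC; apply: H; last by rewrite /= in_itv.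
by rewrite /ball/= distrC.
Qed.

(** A difference at one point persists on an interval of positive length. The endpoints are
    included, which is what makes boundary values well defined. *)
Lemma continuous_ae_eq a b F G : a < b -> {within `[a, b], continuous F} ->
  {within `[a, b], continuous G} -> ae_on a b (fun x => F x = G x) ->
  forall x, a <= x <= b -> F x = G x.
Proof.
move=> ab cF cG FG x xab; apply/eqP; rewrite -subr_eq0; apply/negPn/negP => ne.
have e0 : 0 < `|F x - G x| / 2 by rewrite divr_gt0// normr_gt0.
have [d1 d10 H1] := within_continuous_near cF xab e0.
have [d2 d20 H2] := within_continuous_near cG xab e0.
have /andP[ax xb] := xab.
pose s := Num.max a (x - Num.min d1 d2); pose t := Num.min b (x + Num.min d1 d2).
have m0 : 0 < Num.min d1 d2 by rewrite lt_min d10.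
have st : s < t by rewrite gt_max !lt_min ab/=; apply/andP; split; [lra|apply/andP; split; lra].
have [A [mA A0 HA]] := FG.
have : (mu `]s, t[ <= mu A)%E.
  apply: le_measure; rewrite ?inE//.
  move=> y; rewrite /= in_itv/= gt_max lt_min => /andP[/andP[ay xy] /andP[yb yx]].
  apply: HA => /= Hy; move: (Hy ltac:(lra)) => E.
  have yx1 : `|y - x| < Num.min d1 d2 by rewrite ltr_norml; lra.
  move: yx1; rewrite lt_min => /andP[y1 y2].
  have h1 := H1 y ltac:(lra) y1; have h2 := H2 y ltac:(lra) y2.
  rewrite E in h1.
  have : `|F x - G x| <= `|F x - G y| + `|G y - G x|.
    by apply: (le_trans _ (ler_normD _ _)); rewrite addrA subrK.
  by rewrite [`|F x - G y|]distrC; lra.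
rewrite A0 lebesgue_measure_itv/= lte_fin st -EFinB lee_fin; lra.
Qed.

Lemma prim_unique a b f g F G : a < b -> prim a b f F -> prim a b g G ->
  ae_on a b (fun x => F x = G x) -> ae_on a b (fun x => f x = g x).
Proof.
move=> ab PF PG FG; have [If HF] := PF; have [Ig HG] := PG.
have E := continuous_ae_eq ab (prim_continuous (ltW ab) PF) (prim_continuous (ltW ab) PG) FG.
have : ae_on a b (fun x => f x - g x = 0).
  apply: II_eq0_ae; first exact: intgB.
  move=> x /[dup] xab /andP[ax xb].
  rewrite IIB; [|exact: intgS If|exact: intgS Ig].
  have := E x xab; rewrite HF// HG// (E a) ?lexx ?ltW// => /addrI ->.
  by rewrite subrr.
by apply: ae_on_imp => x _ /subr0_eq.
Qed.

Definition real_weak_derivative a b u g : Prop :=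
  forall phi, test_function a b phi ->
    II a b (fun x => u x * (phi^`())%classic x) = - II a b (fun x => g x * phi x).

Lemma test_prim a b phi : a < b -> test_function a b phi ->
  prim a b (phi^`())%classic phi /\ phi a = 0 /\ phi b = 0.
Proof.
move=> ab [dphi cphi _ sphi].
have out x : ~ a < x < b -> phi x = 0.
  move=> nx; apply/eqP/negPn/negP => px; apply: nx.
  have := sphi x; rewrite /= in_itv/=; apply; exact: subset_closure.
have ca : {within `[a, b], continuous (phi^`())%classic} by exact: continuous_subspaceT.
have Ic : mu.-integrable `[a, b] (EFin \o (phi^`())%classic).
  by apply: continuous_compact_integrable => //; exact: segment_compact.
split; last by split; apply: out => /andP[]; rewrite ltxx.
split; first by apply: integrableS Ic => //; exact: subset_itv_oo_cc.
move=> x /andP[]; rewrite le_eqVlt => /predU1P[<- _|ax xb].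
  by rewrite II_empty// addr0.
have Icx : mu.-integrable `[a, x] (EFin \o (phi^`())%classic).
  by apply: integrableS Ic => //; apply: subset_itvl; rewrite bnd_simp.
have -> : II a x (phi^`())%classic = \int[mu]_(t in `[a, x]) (phi^`())%classic t.
  have I1 : mu.-integrable `]a, x] (EFin \o (phi^`())%classic).
    by apply: integrableS Icx => //; apply: subset_itvr; rewrite bnd_simp.
  have I2 : mu.-integrable `]a, x[ (EFin \o (phi^`())%classic).
    by apply: integrableS Icx => //; exact: subset_itv_oo_cc.
  by rewrite -(Rintegral_itv_obnd_cbnd I1) -(Rintegral_itv_bndo_bndc I2).
have cphi' y : {for y, continuous phi}.
  by apply: differentiable_continuous; apply/derivable1_diffP; exact: dphi.
have E := @continuous_FTC2 R (phi^`())%classic phi a x ax (continuous_subspaceT cphi).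
rewrite /Rintegral E//=; first by ring.
by split; [move=> y _; exact: dphi|exact: cvg_at_right_filter (cphi' a)|exact: cvg_at_left_filter (cphi' x)].
Qed.

Lemma prim_weak_derivative a b u g U : a < b -> measurable_fun `]a, b[ u ->
  prim a b g U -> ae_on a b (fun x => u x = U x) -> real_weak_derivative a b u g.
Proof.
move=> ab mu_ PU uU phi tphi.
have [Pphi [pa pb]] := test_prim ab tphi.
have PP := prim_mul PU Pphi.
have := prim_sub PP (lexx a) (ltW ab) (lexx b); rewrite pa pb !mulr0 subrr.
have I1 := intg_mul_prim PU.1 Pphi.
have I2 : intg a b (fun x => U x * (phi^`())%classic x).
  by apply: eq_intg (intg_mul_prim Pphi.1 PU) => x _; rewrite mulrC.
rewrite IID// => H.
rewrite (@II_ae _ a b (fun x => u x * (phi^`())%classic x) (fun x => U x * (phi^`())%classic x)).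
- lra.
- by apply: measurable_funM => //; exact: intg_meas Pphi.1.
- exact: intg_meas I2.
- by apply: ae_on_imp uU => x _ ->.
Qed.

(** The test function is the primitive of [psi] from minus infinity, defined and C^1 on the whole
    line; the zero mean is what makes it vanish again beyond [t]. *)
Lemma test_function_of_mean0 a b s t psi : a < s -> s <= t -> t < b ->
  continuous psi -> (forall x, ~ s <= x <= t -> psi x = 0) -> II a b psi = 0 ->
  exists phi, test_function a b phi /\ forall x, (phi^`())%classic x = psi x.
Proof.
move=> as_ st tb cpsi out mean0.
have psiE : psi = psi \_ `[s, t].
  apply/funext => x; rewrite patchE; case: ifPn => //; rewrite notin_setE /= in_itv/= => /out.
  by [].
have Ist : mu.-integrable `[s, t] (EFin \o psi).
  by apply: continuous_compact_integrable; [exact: segment_compact|exact: continuous_subspaceT].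
have IT : mu.-integrable setT (EFin \o psi).
  by rewrite psiE -restrict_EFin; apply/integrable_restrict => //=; rewrite setTI.
have Iy y : mu.-integrable `]-oo, y] (EFin \o psi) by apply: integrableS IT.
pose phi x := \int[mu]_(y in `]-oo, x]) psi y.
have D x : derivable phi x 1 /\ (phi^`())%classic x = psi x.
  have x1 : x < x + 1 by rewrite ltrDl.
  have x2 : ((-oo%O : itv_bound R) < BRight x)%E by rewrite ltNyr.
  exact: (@continuous_FTC1 R psi -oo%O x (x + 1) x1 (Iy _) x2 (cpsi x)).
have dE : (phi^`())%classic = psi by apply/funext => x; case: (D x).
have phi_l x : x < s -> phi x = 0.
  move=> xs; rewrite /phi (@eq_Rintegral _ _ _ _ _ (cst 0)); last first.
    by move=> y; rewrite inE/= in_itv/= => yx; apply: out; lra.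
  by rewrite /Rintegral integral0.
have IIo y z : intg y z psi by apply: integrableS IT.
have phi_E x : a <= x -> phi x = II a x psi.
  move=> ax; have Ioc : mu.-integrable `]a, x] (EFin \o psi) by apply: integrableS IT.
  have h1 : (BInfty R true <= BRight a)%O by [].
  have h2 : (BRight a <= BRight x)%O by rewrite bnd_simp.
  have E := @Rintegral_itvB R psi (BInfty R true) (BRight x) a (Iy x) h1 h2.
  have -> : phi x = phi x - phi a by rewrite (phi_l a)// subr0.
  rewrite [LHS]E /II (Rintegral_itv_bndo_bndc (IIo a x)); first by [].
have phi_r x : t < x -> phi x = 0.
  move=> tx; rewrite phi_E; last lra.
  have [xb|bx] := leP x b.
    have : II a b psi = II a x psi + II x b psi by apply: II_split => //; lra.
    rewrite mean0 (@eq_II _ x b psi (cst 0)); last by move=> y yx; apply: out; lra.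
    by rewrite II_cst// mul0r addr0.
  have -> : II a x psi = II a b psi + II b x psi by apply: II_split => //; lra.
  rewrite mean0 (@eq_II _ b x psi (cst 0)); last by move=> y yx; apply: out; lra.
  by rewrite II_cst ?ltW// mul0r addr0.
have sub : closure [set x | phi x != 0] `<=` `[s, t]%classic.
  have cl : closed `[s, t]%classic by exact: interval_closed.
  rewrite [X in _ `<=` X]((closure_id _).1 cl); apply: closureS => x /= px.
  rewrite in_itv/=; apply/negPn/negP => nx; move/eqP: px; apply.
  by move: nx; rewrite negb_and -!ltNge => /orP[/phi_l|/phi_r].
exists phi; split; last by move=> x; rewrite dE.
split.
- by move=> x; case: (D x).
- by rewrite dE.
- apply: (subclosed_compact _ (@segment_compact _ s t) sub); exact: closed_closure.
- apply: (subset_trans sub) => x /=; rewrite !in_itv/= => /andP[sx xt].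
  by apply/andP; split; lra.
Qed.

Definition tent s eps : R -> R := fun x => Num.max 0 (eps - `|x - s|).

Lemma tent_continuous s eps : continuous (tent s eps).
Proof.
move=> x; apply: (@continuous_max _ _ (fun=> 0) (fun x => eps - `|x - s|)); first exact: cvg_cst.
apply: cvgB; first exact: cvg_cst.
apply: cvg_norm; apply: cvgB; [exact: cvg_id|exact: cvg_cst].
Qed.

Lemma tent_ge0 s eps x : 0 <= tent s eps x.
Proof. by rewrite /tent le_max lexx. Qed.

Lemma tent_le s eps x : 0 <= eps -> tent s eps x <= eps.
Proof. by move=> e0; rewrite /tent ge_max e0/= lerBlDr lerDl. Qed.

Lemma tent_out s eps x : ~ s - eps <= x <= s + eps -> tent s eps x = 0.
Proof.
move=> H; apply/max_idPl; rewrite subr_le0 leNgt; apply/negP.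
by rewrite ltr_norml => h; apply: H; lra.
Qed.

Lemma tent_intg s eps a b : intg a b (tent s eps).
Proof.
have : mu.-integrable `[a, b] (EFin \o tent s eps).
  apply: continuous_compact_integrable; first exact: segment_compact.
  by apply: continuous_subspaceT; exact: tent_continuous.
by apply: integrableS => //; exact: subset_itv_oo_cc.
Qed.

Lemma II_supp a b s t f : a <= s -> s <= t -> t <= b -> intg a b f ->
  (forall x, ~ s <= x <= t -> f x = 0) -> II a b f = II s t f.
Proof.
move=> as_ st tb If out; have sb := le_trans st tb; have at_ := le_trans as_ st.
rewrite (II_split as_ sb If) (II_split st tb (intgS as_ (lexx b) If)).
rewrite (@eq_II _ a s f (cst 0)); last by move=> x xx; apply: out; lra.
rewrite (@eq_II _ t b f (cst 0)); last by move=> x xx; apply: out; lra.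
by rewrite !II_cst// !mul0r add0r addr0.
Qed.

Lemma tent_mass s eps a b : 0 < eps -> a <= s - eps -> s + eps <= b ->
  eps ^+ 2 / 2 <= II a b (tent s eps).
Proof.
move=> e0 as_ sb; have It := tent_intg s eps a b.
apply: (@le_trans _ _ (II (s - eps / 2) (s + eps / 2) (tent s eps))); last first.
  apply: le_II_sub => //; try lra.
  by apply: ae_onW => x _; exact: tent_ge0.
apply: (@le_trans _ _ (II (s - eps / 2) (s + eps / 2) (cst (eps / 2)))).
  by rewrite II_cst; [rewrite expr2; lra|lra].
apply: le_II; [exact: intg_cst|exact: tent_intg|].
apply: ae_onW => x xs; rewrite /cst /tent le_max; apply/orP; right.
have : `|x - s| < eps / 2 by rewrite ltr_norml; lra.
lra.
Qed.

Lemma lebesgue_pt_avg h a b s eta : a < s < b -> intg a b h ->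
  lebesgue_pt (h \_ `]a, b[) s -> 0 < eta ->
  exists2 del, 0 < del & forall eps, 0 < eps < del ->
    [/\ a < s - eps, s + eps < b &
      II (s - eps) (s + eps) (fun y => `|h y - h s|) <= eta * eps].
Proof.
move=> /andP[as_ sb] Ih lp eta0.
(* The average divides by the length of the ball, which is twice its radius: hence [eta / 2]. *)
have : \forall r \near 0^'+, (davg (h \_ `]a, b[) s r < (eta / 2)%:E)%E.
  have : nbhs (0%E : \bar R) [set z | (z < (eta / 2)%:E)%E].
    apply: open_nbhs_nbhs; split; first exact: open_ereal_lt_ereal.
    by rewrite /= lte_fin divr_gt0.
  by move/lp.
move=> /nbhs_ballP[d /= d0 H].
exists (Num.min d (Num.min (s - a) (b - s))).
  by rewrite !lt_min d0/=; apply/andP; split; lra.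
move=> eps /andP[e0]; rewrite !lt_min => /andP[ed /andP[e1 e2]].
have se : a < s - eps by lra.
have se' : s + eps < b by lra.
split => //.
have := H eps; rewrite /ball/= sub0r normrN gtr0_norm// => /(_ ed e0).
rewrite /davg /iavg (lebesgue_measure_ball _ (ltW e0)).
have Ih' : intg (s - eps) (s + eps) h by apply: intgS Ih; exact: ltW.
have Id : intg (s - eps) (s + eps) (fun y => `|h y - h s|).
  by apply: intg_norm; exact: (intgB Ih' (intg_cst _ _ _)).
set X := (X in (_ * X)%E); have -> : X = (II (s - eps) (s + eps) (fun y => `|h y - h s|))%:E.
  rewrite /II /Rintegral fineK; last exact: integrable_fin_num.
  rewrite /X ball_itv; apply: eq_integral => y; rewrite inE/= in_itv/= => /andP[y1 y2].
  rewrite /= !patchE !mem_setE !in_itv/=.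
  by rewrite (lt_trans se y1) (lt_trans y2 se') as_ sb.
have e2n : (eps *+ 2) != 0 by rewrite mulrn_eq0/= lt0r_neq0.
rewrite inver (negbTE e2n) -EFinM lte_fin.
rewrite mulrC ltr_pdivrMr; last by rewrite mulr2n; lra.
rewrite mulr2n => h1; have E : eta / 2 * (eps + eps) = eta * eps by field.
by rewrite -E; exact: ltW.
Qed.

Lemma tent_avg h a b s eps eta : 0 < eps -> a < s - eps -> s + eps < b -> intg a b h ->
  II (s - eps) (s + eps) (fun y => `|h y - h s|) <= eta * eps ->
  `|II a b (fun x => h x * tent s eps x) - h s * II a b (tent s eps)| <= eta * eps ^+ 2.
Proof.
move=> e0 as_ sb Ih He.
have It := tent_intg s eps a b.
have mt := intg_meas It.
have bt : ae_on a b (fun x => `|tent s eps x| <= eps).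
  by apply: ae_onW => x _; rewrite ger0_norm ?tent_ge0// tent_le// ltW.
have I1 : intg a b (fun x => h x * tent s eps x).
  by apply: eq_intg (intg_mul_bnd mt bt Ih) => x _; rewrite mulrC.
have Id : intg a b (fun y => `|h y - h s|).
  by apply: intg_norm; exact: (intgB Ih (intg_cst _ _ _)).
rewrite -IIZ// -IIB//; last exact: intgZ.
have I2 := intgB I1 (intgZ (h s) It).
rewrite (@II_supp a b (s - eps) (s + eps)); [|lra|lra|lra|exact: I2|]; last first.
  by move=> x /tent_out ->; rewrite !mulr0 subr0.
have le1 : a <= s - eps by lra.
have le2 : s + eps <= b by lra.
have I2' := intgS le1 le2 I2; have Id' := intgS le1 le2 Id.
apply: (le_trans (norm_II I2')).
apply: (@le_trans _ _ (eps * II (s - eps) (s + eps) (fun y => `|h y - h s|))).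
  rewrite -IIZ//; apply: le_II; [exact: intg_norm|exact: intgZ|].
  apply: ae_onW => x _ /=; rewrite -mulrBl normrM mulrC ler_wpM2r//.
  by rewrite ger0_norm ?tent_ge0// tent_le// ltW.
by rewrite expr2 mulrCA; apply: ler_wpM2l => //; exact: ltW.
Qed.

(* Tested against the primitive of a difference of two tents with balanced masses,
   centred at Lebesgue points of h. *)
Lemma du_bois_reymond a b h : a < b -> intg a b h ->
  (forall phi, test_function a b phi -> II a b (fun x => h x * (phi^`())%classic x) = 0) ->
  exists c, ae_on a b (fun x => h x = c).
Proof.
move=> ab Ih H.
have Lr : locally_integrable [set: R] (h \_ `]a, b[) by exact: integrable_locally.
have Lae := lebesgue_differentiation Lr.
have key s t : a < s < b -> a < t < b -> lebesgue_pt (h \_ `]a, b[) s ->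
    lebesgue_pt (h \_ `]a, b[) t -> h s = h t.
  move=> sab tab ls lt; apply/eqP; rewrite -subr_eq0 -normr_le0.
  apply/ler_addgt0Pl => e e_gt0; rewrite addr0.
  have eta0 : 0 < e / 4 by rewrite divr_gt0.
  have [d1 d10 H1] := lebesgue_pt_avg sab Ih ls eta0.
  have [d2 d20 H2] := lebesgue_pt_avg tab Ih lt eta0.
  pose eps := Num.min d1 d2 / 2.
  have m0 : 0 < Num.min d1 d2 by rewrite lt_min d10.
  have m1 : Num.min d1 d2 <= d1 by rewrite ge_min lexx.
  have m2 : Num.min d1 d2 <= d2 by rewrite ge_min lexx orbT.
  have eps0 : 0 < eps by rewrite divr_gt0.
  have ed1 : 0 < eps < d1 by rewrite /eps; lra.
  have ed2 : 0 < eps < d2 by rewrite /eps; lra.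
  have [s1 s2 s3] := H1 eps ed1; have [t1 t2 t3] := H2 eps ed2.
  have A1 := tent_avg eps0 s1 s2 Ih s3; have A2 := tent_avg eps0 t1 t2 Ih t3.
  have M1 := tent_mass eps0 (ltW s1) (ltW s2); have M2 := tent_mass eps0 (ltW t1) (ltW t2).
  have Is := tent_intg s eps a b; have It := tent_intg t eps a b.
  move: A1 A2 M1 M2; set cs := II a b (tent s eps); set ct := II a b (tent t eps).
  set hs := II a b (fun x => h x * tent s eps x); set ht := II a b (fun x => h x * tent t eps x).
  move=> A1 A2 M1 M2.
  have bt z : ae_on a b (fun x => `|tent z eps x| <= eps).
    by apply: ae_onW => x _; rewrite ger0_norm ?tent_ge0// tent_le// ltW.
  have J1 : intg a b (fun x => h x * tent s eps x).
    by apply: eq_intg (intg_mul_bnd (intg_meas Is) (bt s) Ih) => x _; rewrite mulrC.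
  have J2 : intg a b (fun x => h x * tent t eps x).
    by apply: eq_intg (intg_mul_bnd (intg_meas It) (bt t) Ih) => x _; rewrite mulrC.
  pose psi x := ct * tent s eps x - cs * tent t eps x.
  have cpsi : continuous psi.
    by move=> x; apply: cvgB; apply: cvgMr; exact: tent_continuous.
  have mpsi : II a b psi = 0.
    by rewrite /psi IIB ?IIZ//; [rewrite -/cs -/ct; ring|exact: intgZ|exact: intgZ].
  pose u := Num.min (s - eps) (t - eps); pose v := Num.max (s + eps) (t + eps).
  have u1 : u <= s - eps by rewrite ge_min lexx.
  have u2 : u <= t - eps by rewrite ge_min lexx orbT.
  have v1 : s + eps <= v by rewrite le_max lexx.
  have v2 : t + eps <= v by rewrite le_max lexx orbT.
  have au : a < u by rewrite lt_min s1.
  have vb : v < b by rewrite gt_max s2.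
  have opsi x : ~ u <= x <= v -> psi x = 0.
    move=> nx; rewrite /psi !tent_out ?mulr0 ?subr0//; apply: contra_not nx => /andP[x1 x2].
      by rewrite (le_trans u2 x1) (le_trans x2 v2).
    by rewrite (le_trans u1 x1) (le_trans x2 v1).
  have uv : u <= v by apply: (le_trans u1 (le_trans _ v1)); rewrite lerBlDr -addrA lerDl addr_ge0 ?ltW.
  have [phi [tphi dphi]] := test_function_of_mean0 au uv vb cpsi opsi mpsi.
  have := H phi tphi.
  rewrite (@eq_II _ a b _ (fun x => ct * (h x * tent s eps x) - cs * (h x * tent t eps x))); last first.
    by move=> x _; rewrite dphi /psi; ring.
  rewrite IIB ?IIZ//; [|exact: intgZ..]; rewrite -/hs -/ht => E0.
  exact: (tent_arith (exprn_gt0 2 eps0) A1 A2 M1 M2 E0).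
have [s sab ls] : exists2 s, a < s < b & lebesgue_pt (h \_ `]a, b[) s.
  apply: contrapT => nex; case: Lae => A [mA A0 HA].
  have : (mu `]a, b[ <= mu A)%E.
    apply: le_measure; rewrite ?inE//.
    by move=> y; rewrite /= in_itv/= => yab; apply: HA => /= ly; apply: nex; exists y.
  rewrite A0 lebesgue_measure_itv/= lte_fin ab -EFinB lee_fin; lra.
exists (h s); apply: ae_imp Lae => t lt tab; exact: key.
Qed.

(** Subtracting from [u] the primitive of [g] leaves a function with zero weak derivative, hence
    almost everywhere constant. *)
Lemma weak_derivative_prim a b u g : a < b -> intg a b u -> intg a b g ->
  real_weak_derivative a b u g ->
  exists U, prim a b g U /\ ae_on a b (fun x => u x = U x).
Proof.
move=> ab Iu Ig H.
have PG := prim_II Ig.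
have IG := L2_intg (prim_L2 PG).
have Ih := intgB Iu IG.
have [c hc] : exists c, ae_on a b (fun x => u x - II a x g = c).
  apply: (du_bois_reymond ab Ih) => phi tphi.
  have [Pphi _] := test_prim ab tphi.
  have WG := prim_weak_derivative ab (II_meas Ig) PG (ae_onW (fun x _ => erefl)) tphi.
  have Wu := H phi tphi.
  have I1 : intg a b (fun x => u x * (phi^`())%classic x).
    have [M M0 HM] : exists2 M, 0 <= M & forall x, a <= x <= b -> `|(phi^`())%classic x| <= M.
      have /compact_bounded/= : compact ((phi^`())%classic @` `[a, b]).
        apply: continuous_compact; last exact: segment_compact.
        by apply: continuous_subspaceT; case: tphi.
      move=> [M [_ HM]]; exists (Num.max 0 (M + 1)); first by rewrite le_max lexx.
      move=> x xab; rewrite le_max; apply/orP; right; apply: HM; first by rewrite ltrDl.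
      by exists x => //=; rewrite in_itv.
    apply: (@eq_intg _ a b (fun x => (phi^`())%classic x * u x)); first by move=> x _; rewrite mulrC.
    apply: (@intg_mul_bnd _ _ _ M) => //; first exact: intg_meas Pphi.1.
    by apply: ae_onW => x xab; apply: HM; lra.
  have I2 : intg a b (fun x => II a x g * (phi^`())%classic x).
    by apply: eq_intg (intg_mul_prim Pphi.1 PG) => x _; rewrite mulrC.
  rewrite (@eq_II _ a b _ (fun x => u x * (phi^`())%classic x - II a x g * (phi^`())%classic x)); last first.
    by move=> x _; rewrite mulrBl.
  by rewrite IIB// Wu WG subrr.
exists (fun x => c + II a x g); split.
  have P := primD (prim_cst a b c) PG.
  by apply: (eq_prim P) => x _ //=; rewrite add0r.
by apply: ae_on_imp hc => x _ <-; rewrite subrK.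
Qed.

End WeakDerivative.

(** * Real and imaginary parts *)

Section ComplexParts.
Context {R : realType}.
Implicit Types (a b : R) (f g : cfun R) (e : bool) (z w : R[i]) (F G : bool -> R -> R).
Notation mu := (@lebesgue_measure R).

(** The boolean index allows one statement, quantified over [e], for both parts. *)
Definition part e z : R := if e then complex.Im z else complex.Re z.

Definition glue_parts F : cfun R := fun x => (F false x +i* F true x)%C.

Lemma part_eq z w : (forall e, part e z = part e w) -> z = w.
Proof. by case: z w => [? ?] [? ?] H; move: (H false) (H true) => /= -> ->. Qed.

Lemma part_glue F e x : part e (glue_parts F x) = F e x.
Proof. by case: e. Qed.

Lemma partN e z : part e (- z) = - part e z.
Proof. by case: e z => [] []. Qed.

Lemma partD e z w : part e (z + w) = part e z + part e w.
Proof. by case: e z w => [] [? ?] []. Qed.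

Lemma part_real e z (r : R) : part e (z * r%:C%C) = part e z * r.
Proof. by case: e z => [] [x y] /=; ring. Qed.

Lemma part_real_l e z (r : R) : part e (r%:C%C * z) = r * part e z.
Proof. by rewrite mulrC part_real mulrC. Qed.

Lemma part_mul e z w :
  part e (z * w) = part false z * part e w + (-1) ^+ (~~ e) * part true z * part (~~ e) w.
Proof. by case: e z w => [] [x y] [u v] /=; ring. Qed.

Lemma part0 e : part e 0 = 0.
Proof. by case: e. Qed.

Lemma sqmod_parts f x : sqmod f x = part false (f x) ^+ 2 + part true (f x) ^+ 2.
Proof.
rewrite /sqmod /ComplexField.Normc.normc; case: (f x) => u v /=.
by rewrite sqr_sqrtr// addr_ge0// sqr_ge0.
Qed.

Lemma norm_part e z : `|part e z|%:C%C <= `|z|.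
Proof.
rewrite normc_def lecR -sqrtr_sqr ler_sqrt ?addr_ge0 ?sqr_ge0//.
by case: e; rewrite /= ?lerDl ?lerDr sqr_ge0.
Qed.

Lemma norm_parts z : `|z| <= (`|part false z| + `|part true z|)%:C%C.
Proof.
rewrite normc_def lecR -[leRHS]ger0_norm ?addr_ge0// -sqrtr_sqr ler_sqrt ?sqr_ge0//.
rewrite -[complex.Re z ^+ 2]real_normK ?num_real// -[complex.Im z ^+ 2]real_normK ?num_real//=.
have := normr_ge0 (complex.Re z); have := normr_ge0 (complex.Im z).
set x := `|_|; set y := `|_|; nra.
Qed.

Lemma spaceL2_parts a b f : spaceL2 a b f <-> forall e, L2 a b (fun x => part e (f x)).
Proof.
split=> [[mR mI If]|H].
  have me e : measurable_fun `]a, b[ (fun x => part e (f x)) by case: e.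
  have sqm e : measurable_fun `]a, b[ (fun x => part e (f x) ^+ 2) by exact: measurable_funX.
  move=> e; split=> //; apply: (le_integrable _ _ _ If) => //.
    by apply/measurable_EFinP; exact: sqm.
  move=> x _ /=; rewrite lee_fin sqmod_parts ger0_norm ?sqr_ge0// ger0_norm ?addr_ge0 ?sqr_ge0//.
  by case: e; rewrite ?lerDl ?lerDr sqr_ge0.
have [m0 I0] := H false; have [m1 I1] := H true; split => //.
by apply: eq_intg (intgD I0 I1) => x _; rewrite /= sqmod_parts.
Qed.

Lemma weak_derivative_parts a b f g : weak_derivative a b f g <->
  forall e, real_weak_derivative a b (fun x => part e (f x)) (fun x => part e (g x)).
Proof.
have cI e (h : cfun R) phi : part e (cintegral a b (fun x => h x * (phi x)%:C%C)) =
    II a b (fun x => part e (h x) * phi x).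
  rewrite /cintegral /II; case: e => /=; apply: eq_Rintegral => x _.
    exact: (part_real true).
  exact: (part_real false).
split=> [H e phi tphi|H phi tphi].
  by rewrite -!cI H// partN.
by apply: part_eq => e; rewrite partN !cI H.
Qed.

Lemma part_continuous a b f e : {within `[a, b], continuous f} ->
  {within `[a, b], continuous (fun x => part e (f x))}.
Proof.
move=> cf x; apply/cvgrPdist_lt => /= eps eps0.
have /cvgrPdist_lt/(_ eps%:C%C) := cf x.
rewrite ltcR => /(_ eps0); apply: filterS => y.
rewrite -ltcR; apply: le_lt_trans.
have -> : part e (f x) - part e (f y) = part e (f x - f y) by rewrite partD partN.
exact: norm_part.
Qed.

Lemma glue_continuous a b F : (forall e, {within `[a, b], continuous (F e)}) ->
  {within `[a, b], continuous (glue_parts F)}.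
Proof.
move=> cF x; apply/cvgrPdist_lt => /= eps eps0.
have [r r0 re] : exists2 r : R, 0 < r & eps = r%:C%C.
  move: eps0; case: (eps) => r i; rewrite ltcE /= => /andP[/eqP -> r0].
  by exists r.
have r2 : 0 < r / 2 by rewrite divr_gt0.
have /cvgrPdist_lt/(_ _ r2) H0 := cF false x.
have /cvgrPdist_lt/(_ _ r2) H1 := cF true x.
apply: filterS2 H0 H1 => y h0 h1; rewrite re.
apply: (le_lt_trans (norm_parts _)); rewrite ltcR !partD !partN !part_glue.
by rewrite (splitr r) ltrD.
Qed.

(** The arbitrary choice in [trace] is harmless: continuous representatives coincide on the closed
    interval. *)
Lemma trace_parts a b f F : a < b -> (forall e, {within `[a, b], continuous (F e)}) ->
  (forall e, ae_on a b (fun x => part e (f x) = F e x)) ->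
  forall e x, a <= x <= b -> part e (trace a b f x) = F e x.
Proof.
move=> ab cF fF e x xab; rewrite /trace.
set Q := [set g : cfun R | _].
have Qg : Q (glue_parts F).
  split; first exact: glue_continuous.
  apply: ae_on_imp2 (fF false) (fF true) => y _ h0 h1.
  by apply: part_eq => -[]; rewrite part_glue.
have [cg gf] : Q (get Q) by apply: getPex; exists (glue_parts F).
apply: (@continuous_ae_eq _ a b (fun y => part e (get Q y)) (F e) ab) => //; first exact: part_continuous.
by apply: ae_on_imp2 gf (fF e) => y _ -> ->.
Qed.

(** With its converse [prim_Sobolev1], this is the dictionary between H^1 and primitives of square
    integrable functions; test functions are not seen beyond this point. *)
Lemma Sobolev1_prim a b f : a < b -> Sobolev1 a b f -> forall e,
  [/\ L2 a b (fun x => part e (weak_D a b f x)),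
      prim a b (fun x => part e (weak_D a b f x)) (fun x => part e (trace a b f x)) &
      ae_on a b (fun x => part e (f x) = part e (trace a b f x))].
Proof.
move=> ab [/spaceL2_parts f2 [g gP]].
have [/spaceL2_parts w2 /weak_derivative_parts wd] :
    spaceL2 a b (weak_D a b f) /\ weak_derivative a b f (weak_D a b f).
  by apply: (@getPex _ [set g : cfun R | spaceL2 a b g /\ weak_derivative a b f g]); exists g.
have /choice[F HF] e := weak_derivative_prim ab (L2_intg (f2 e)) (L2_intg (w2 e)) (wd e).
have tr e x : a <= x <= b -> part e (trace a b f x) = F e x.
  apply: trace_parts => // e'; last by case: (HF e').
  by apply: prim_continuous (HF e').1; exact: ltW.
move=> e; have [P A] := HF e; split=> //; first by apply: eq_prim P _ _ => // x xab; rewrite tr.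
by apply: ae_on_imp A => x xab ->; rewrite tr//; lra.
Qed.

Lemma prim_Sobolev1 a b f F G : a < b ->
  (forall e, measurable_fun `]a, b[ (fun x => part e (f x))) ->
  (forall e, L2 a b (G e)) -> (forall e, prim a b (G e) (F e)) ->
  (forall e, ae_on a b (fun x => part e (f x) = F e x)) ->
  Sobolev1 a b f /\ forall e, ae_on a b (fun x => part e (weak_D a b f x) = G e x) /\
    forall x, a <= x <= b -> part e (trace a b f x) = F e x.
Proof.
move=> ab mf G2 PF fF.
have S1 : Sobolev1 a b f.
  split.
    apply/spaceL2_parts => e; apply: (L2_ae (mf e) _ (prim_L2 (PF e))).
    by apply: ae_on_imp (fF e) => x _ ->.
  exists (glue_parts G); split.
    apply/spaceL2_parts => e; rewrite (_ : (fun x => _) = G e)//.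
    by apply/funext => x; rewrite part_glue.
  apply/weak_derivative_parts => e.
  rewrite (_ : (fun x => part e (glue_parts G x)) = G e); last first.
    by apply/funext => x; rewrite part_glue.
  exact: prim_weak_derivative (PF e) (fF e).
have tr e x : a <= x <= b -> part e (trace a b f x) = F e x.
  apply: trace_parts => // e'; apply: prim_continuous (PF e'); exact: ltW.
split=> // e; split=> [|x]; last exact: tr.
have [w2 P A] := Sobolev1_prim ab S1 e.
by apply: prim_unique P (PF e) _ => //; apply: ae_onW => x xab; apply: tr; lra.
Qed.

End ComplexParts.

(** * Gluing at the interface *)

Definition glue {R : realType} {V : Type} (c : R) (f g : R -> V) (x : R) : V :=
  if x < c then f x else g x.

Section Glue.
Context {R : realType}.
Implicit Types (a b c x : R) (f g h F G : R -> R).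
Notation mu := (@lebesgue_measure R).

Lemma glue_l {V : Type} c (f g : R -> V) x : x < c -> glue c f g x = f x.
Proof. by rewrite /glue => ->. Qed.

Lemma glue_r {V : Type} c (f g : R -> V) x : c <= x -> glue c f g x = g x.
Proof. by rewrite /glue leNgt => /negbTE ->. Qed.

Lemma eq_measurable_oo a b f g : (forall x, a < x < b -> f x = g x) ->
  measurable_fun `]a, b[ f -> measurable_fun `]a, b[ g.
Proof.
move=> fg; apply: eq_measurable_fun => x; rewrite inE/= in_itv/= => /fg //.
Qed.

Lemma intg_glue a c b f g : a <= c -> c <= b -> intg a c f -> intg c b g ->
  intg a b (glue c f g).
Proof.
move=> ac cb If Ig.
have If' : intg a b (f \_ `]a, c[) by apply: integrableS (intg_restrict If).
have Ig' : intg a b (g \_ `]c, b[) by apply: integrableS (intg_restrict Ig).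
apply: intg_ae (intgD If' Ig').
  by apply: meas_glue; [exact: intg_meas If|exact: intg_meas Ig].
apply: (@ae_on_split _ a b c); apply: ae_onW => x /andP[h1 h2]; rewrite /= !patchE !mem_setE !in_itv/=.
  by rewrite h1 h2 (ltNge c x) (ltW h2)/= addr0 glue_l.
by rewrite (ltNge x c) (ltW h1)/= andbF h1 h2 add0r glue_r// ltW.
Qed.

(** Equal values at [c] are exactly what absolute continuity across the interface requires: a
    transmission condition becomes regularity of the glued function. *)
Lemma prim_glue a c b f g F G : a <= c -> c <= b -> prim a c f F -> prim c b g G ->
  F c = G c -> prim a b (glue c f g) (glue c F G).
Proof.
move=> ac cb [If HF] [Ig HG] FG.
have I := intg_glue ac cb If Ig.
have Fa : glue c F G a = F a.
  rewrite /glue; case: ltP => // ca; have -> : a = c by apply/eqP; rewrite eq_le ac.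
  by [].
split=> // x /andP[ax xb]; rewrite Fa; have [xc|cx] := ltP x c.
  rewrite glue_l// HF ?ax ?ltW//; congr (_ + _); apply: eq_II => y /andP[ay yx].
  by rewrite glue_l// (lt_trans yx).
rewrite glue_r// HG ?cx// -FG HF ?ac ?lexx// -addrA.
rewrite (II_split ac cx (intgS (lexx a) xb I)); congr (_ + (_ + _)); apply: eq_II => y /andP[h1 h2].
  by rewrite glue_l.
by rewrite glue_r// ltW.
Qed.

Lemma prim_ae a b f g F : prim a b f F -> measurable_fun `]a, b[ g ->
  ae_on a b (fun x => f x = g x) -> prim a b g F.
Proof.
move=> [If HF] mg fg; split; first exact: intg_ae If.
move=> x /[dup] xab /andP[ax xb]; rewrite HF//; congr (_ + _); apply: II_ae.
- exact: measS (lexx a) xb (intg_meas If).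
- exact: measS (lexx a) xb mg.
- exact: ae_onS (lexx a) xb fg.
Qed.

Lemma ae_on_glue a c b (P : R -> Prop) (Q : R -> Prop) (S : R -> Prop) :
  ae_on a c P -> ae_on c b Q -> (forall x, x < c -> P x -> S x) ->
  (forall x, c <= x -> Q x -> S x) -> ae_on a b S.
Proof.
move=> hP hQ PS QS; apply: (@ae_on_split _ a b c).
  by apply: ae_on_imp hP => x /andP[_ xc]; exact: PS.
by apply: ae_on_imp hQ => x /andP[cx _]; apply: QS; exact: ltW.
Qed.

Lemma L2_prim_glue a c b f g : a <= c -> c <= b -> L2 a c f -> L2 c b g ->
  L2 a b (glue c f g).
Proof.
move=> ac cb [mf If] [mg Ig]; split; first exact: meas_glue.
by apply: eq_intg (intg_glue ac cb If Ig) => x _; rewrite /glue; case: ifP.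
Qed.

End Glue.

(** * Pairs as functions on the whole interval *)

Section TransmissionPairs.
Context {R : realType}.
Variables (l L : R) (l_gt0 : 0 < l) (l_lt_L : l < L).
Implicit Types (u v : pair_space R) (e : bool) (F G : bool -> R -> R).

Let l0 : 0 <= l. Proof. exact: ltW. Qed.
Let lL : l <= L. Proof. exact: ltW. Qed.

Definition val_part u e (x : R) : R := part e (glue l u.1 u.2 x).

Definition deriv_part u e (x : R) : R :=
  part e (glue l (weak_D 0 l u.1) (weak_D l L u.2) x).

Definition trace_part u e (x : R) : R :=
  part e (glue l (trace 0 l u.1) (trace l L u.2) x).

(** No condition at the outer ends, so that the notion applies to the flux of a state as well as to
    elements of [V2]. *)
Definition H1pair u : Prop :=
  [/\ Sobolev1 0 l u.1, Sobolev1 l L u.2 & trace 0 l u.1 l = trace l L u.2 l].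

Lemma part_glue_fun (f g : cfun R) e :
  (fun x => part e (glue l f g x)) = glue l (fun x => part e (f x)) (fun x => part e (g x)).
Proof. by apply/funext => x; rewrite /glue; case: ifP. Qed.

Lemma spaceH_parts u : spaceH l L u <-> forall e, L2 0 L (val_part u e).
Proof.
split=> [[/spaceL2_parts h1 /spaceL2_parts h2] e|H].
  by rewrite /val_part part_glue_fun; exact: L2_prim_glue.
split; apply/spaceL2_parts => e.
  have [m I] := L2S (lexx 0) lL (H e); split.
    by apply: eq_measurable_oo m => x /andP[_ xl]; rewrite /val_part glue_l.
  by apply: eq_intg I => x /andP[_ xl]; rewrite /val_part glue_l.
have [m I] := L2S l0 (lexx L) (H e); split.
  by apply: eq_measurable_oo m => x /andP[xl _]; rewrite /val_part glue_r// ltW.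
by apply: eq_intg I => x /andP[xl _]; rewrite /val_part glue_r// ltW.
Qed.

Lemma H1pair_prim u : H1pair u -> forall e,
  [/\ L2 0 L (deriv_part u e), prim 0 L (deriv_part u e) (trace_part u e) &
      ae_on 0 L (fun x => val_part u e x = trace_part u e x)].
Proof.
move=> [S1 S2 tr] e.
have [L1 P1 A1] := Sobolev1_prim l_gt0 S1 e.
have [L2_ P2 A2_] := Sobolev1_prim l_lt_L S2 e.
split.
- by rewrite /deriv_part part_glue_fun; exact: L2_prim_glue.
- rewrite /deriv_part /trace_part !part_glue_fun; apply: prim_glue => //.
  by rewrite tr.
apply: (ae_on_glue A1 A2_) => x xl.
  by rewrite /val_part /trace_part !glue_l.
by rewrite /val_part /trace_part !glue_r.
Qed.

Lemma prim_H1pair u F G : (forall e, measurable_fun `]0, L[ (val_part u e)) ->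
  (forall e, L2 0 L (G e)) -> (forall e, prim 0 L (G e) (F e)) ->
  (forall e, ae_on 0 L (fun x => val_part u e x = F e x)) ->
  H1pair u /\ forall e, [/\ ae_on 0 L (fun x => deriv_part u e x = G e x),
    part e (trace 0 l u.1 0) = F e 0 & part e (trace l L u.2 L) = F e L].
Proof.
move=> mu_ LG PF HF.
have [e|e|e|e|S1 H1] := @prim_Sobolev1 _ 0 l u.1 F G l_gt0.
- apply: eq_measurable_oo (measS (lexx 0) lL (mu_ e)) => x /andP[_ xl].
  by rewrite /val_part glue_l.
- exact: L2S (lexx 0) lL (LG e).
- exact: primS (PF e) (lexx 0) lL.
- apply: ae_on_imp (ae_onS (lexx 0) lL (HF e)) => x /andP[_ xl].
  by rewrite /val_part glue_l.
have [e|e|e|e|S2 H2] := @prim_Sobolev1 _ l L u.2 F G l_lt_L.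
- apply: eq_measurable_oo (measS l0 (lexx L) (mu_ e)) => x /andP[xl _].
  by rewrite /val_part glue_r// ltW.
- exact: L2S l0 (lexx L) (LG e).
- exact: primS (PF e) l0 (lexx L).
- apply: ae_on_imp (ae_onS l0 (lexx L) (HF e)) => x /andP[xl _].
  by rewrite /val_part glue_r// ltW.
split.
  split=> //; apply: part_eq => e.
  by rewrite (H1 e).2 ?(H2 e).2 ?lexx ?l0 ?lL.
move=> e; have [d1 t1] := H1 e; have [d2 t2] := H2 e; split.
- apply: (ae_on_glue d1 d2) => x xl; first by rewrite /deriv_part glue_l.
  by rewrite /deriv_part glue_r.
- by rewrite t1// lexx l0.
- by rewrite t2// lexx lL.
Qed.

Lemma V2_prim u : V2 l L u -> forall e,
  [/\ L2 0 L (deriv_part u e), prim 0 L (deriv_part u e) (trace_part u e),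
      ae_on 0 L (fun x => val_part u e x = trace_part u e x),
      trace_part u e 0 = 0 & trace_part u e L = 0].
Proof.
move=> [S1 S2 tr t0 tL] e.
have HU : H1pair u by split.
have [? ? ?] := H1pair_prim HU e.
split=> //; rewrite /trace_part.
  by rewrite glue_l// t0 part0.
by rewrite glue_r// tL part0.
Qed.

Lemma prim_V2 u F G : (forall e, measurable_fun `]0, L[ (val_part u e)) ->
  (forall e, L2 0 L (G e)) -> (forall e, prim 0 L (G e) (F e)) ->
  (forall e, ae_on 0 L (fun x => val_part u e x = F e x)) ->
  (forall e, F e 0 = 0 /\ F e L = 0) ->
  V2 l L u /\ forall e, ae_on 0 L (fun x => deriv_part u e x = G e x).
Proof.
move=> mu_ LG PF HF F0; have [[S1 S2 tr] H] := prim_H1pair mu_ LG PF HF.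
split; last by move=> e; case: (H e).
split=> //; apply: part_eq => e; rewrite part0; have [_ h0 hL] := H e.
  by rewrite h0 (F0 e).1.
by rewrite hL (F0 e).2.
Qed.

Lemma val_part_lin (c : R[i]) u v e x : val_part (c *: u + v) e x =
  part false c * val_part u e x + (-1) ^+ (~~ e) * part true c * val_part u (~~ e) x +
  val_part v e x.
Proof.
by rewrite /val_part /glue; case: ifP => _; rewrite partD part_mul.
Qed.

Lemma V2_meas u : V2 l L u -> forall e, measurable_fun `]0, L[ (val_part u e).
Proof.
move=> [[/spaceL2_parts s1 _] [/spaceL2_parts s2 _] _ _ _] e.
rewrite /val_part part_glue_fun; apply: meas_glue; first by case: (s1 e).
by case: (s2 e).
Qed.

Lemma V2_lin (c : R[i]) u v : V2 l L u -> V2 l L v -> V2 l L (c *: u + v) /\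
  forall e, ae_on 0 L (fun x => deriv_part (c *: u + v) e x =
    part false c * deriv_part u e x + (-1) ^+ (~~ e) * part true c * deriv_part u (~~ e) x +
    deriv_part v e x).
Proof.
move=> Vu Vv; have mu_ := V2_meas Vu; have mv := V2_meas Vv.
pose lin (F : pair_space R -> bool -> R -> R) e x :=
  part false c * F u e x + (-1) ^+ (~~ e) * part true c * F u (~~ e) x + F v e x.
apply: (@prim_V2 _ (lin trace_part) (lin deriv_part)) => e.
- rewrite (_ : val_part _ e = lin val_part e); last first.
    by apply/funext => x; rewrite val_part_lin.
  by apply: measurable_funD => //; apply: measurable_funD; exact: measurable_funM.
- have [Lu _ _ _ _] := V2_prim Vu e; have [Lu' _ _ _ _] := V2_prim Vu (~~ e).
  have [Lv _ _ _ _] := V2_prim Vv e.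
  by apply: L2D => //; apply: L2D; exact: L2Z.
- have [_ Lu _ _ _] := V2_prim Vu e; have [_ Lu' _ _ _] := V2_prim Vu (~~ e).
  have [_ Lv _ _ _] := V2_prim Vv e.
  by apply: primD => //; apply: primD; exact: primZ.
- have [_ _ Au _ _] := V2_prim Vu e; have [_ _ Au' _ _] := V2_prim Vu (~~ e).
  have [_ _ Av _ _] := V2_prim Vv e.
  apply: ae_on_imp2 (ae_on_and Au Au') Av => x _ [h1 h2] h3.
  by rewrite val_part_lin /lin h1 h2 h3.
- have [_ _ _ u0 uL] := V2_prim Vu e; have [_ _ _ u0' uL'] := V2_prim Vu (~~ e).
  have [_ _ _ v0 vL] := V2_prim Vv e.
  by rewrite /lin u0 uL u0' uL' v0 vL !mulr0 !addr0.
Qed.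

Lemma V2_0 : V2 l L 0.
Proof.
have v0 e x : val_part (0 : pair_space R) e x = 0.
  by rewrite /val_part /glue; case: ifP => _; exact: part0.
apply: (proj1 (@prim_V2 0 (fun _ => cst 0) (fun _ => cst 0) _ _ _ _ _)) => // e.
- by rewrite (_ : val_part _ e = cst 0)//; apply/funext => x.
- exact: L2_cst.
- exact: prim_cst.
- by apply: ae_onW => x _; rewrite v0.
Qed.

End TransmissionPairs.

(** * The transmission operator *)

Section ComponentForms.
Context {R : realType} {E : lmodType R[i]}.
Variables (L : R) (L_gt0 : 0 < L) (X : set E) (N : E -> R) (HX : subspace X).
Implicit Types (G : (R -> R) -> (R -> R) -> R) (c : E -> bool -> R -> R).

Lemma L2form_ael G f f' g : L2form L G -> L2 0 L f -> L2 0 L f' -> L2 0 L g ->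
  ae_on 0 L (fun x => f x = f' x) -> G f g = G f' g.
Proof.
move=> [G1 _ [C C0 HC]] Lf Lf' Lg ff'.
pose h x := -1 * f' x + f x.
have Lh : L2 0 L h by apply: L2D => //; exact: L2Z.
have h0 : nrm L h = 0.
  rewrite /nrm /sqn (@II_ae _ 0 L _ (cst 0)) ?II_cst ?mul0r ?sqrtr0//; first exact: ltW.
    exact: intg_meas Lh.2.
  by apply: ae_on_imp ff' => x _; rewrite /h => ->; rewrite mulN1r addNr expr0n.
have := HC _ _ Lh Lg; rewrite h0 mulr0 mul0r normr_le0 /h G1// mulN1r addrC subr_eq0.
by move=> /eqP.
Qed.

Lemma L2form_aer G f g g' : L2form L G -> L2 0 L f -> L2 0 L g -> L2 0 L g' ->
  ae_on 0 L (fun x => g x = g' x) -> G f g = G f g'.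
Proof.
move=> [G1 G2 [C C0 HC]] Lf Lg Lg'; apply: (@L2form_ael (fun a b => G b a)) => //.
by split=> //; exists C => // a b La Lb; rewrite mulrAC HC.
Qed.

(** Linearity holds almost everywhere only: weak derivatives are arbitrarily chosen representatives,
    and the choice does not commute with combinations. *)
Definition linear_component c : Prop :=
  (forall x e, X x -> L2 0 L (c x e)) /\
  (forall (r : R) x y e, X x -> X y ->
    ae_on 0 L (fun s => c (r%:C%C *: x + y) e s = r * c x e s + c y e s)).

Definition bounded_component c : Prop :=
  linear_component c /\ exists2 C : R, 0 <= C & forall x e, X x -> nrm L (c x e) <= C * N x.

Definition component_form G c c' (x y : E) : R :=
  G (c x false) (c' y false) + G (c x true) (c' y true).

Lemma component_form_real G c c' : L2form L G -> linear_component c ->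
  linear_component c' -> real_form X (component_form G c c').
Proof.
move=> HG [Lc lc] [Lc' lc']; have [G1 G2 _] := HG; split=> r x y z Xx Xy Xz.
  have Xs : X (r%:C%C *: x + y) by exact: HX.2.
  have K e : G (c (r%:C%C *: x + y) e) (c' z e) = r * G (c x e) (c' z e) + G (c y e) (c' z e).
    rewrite (L2form_ael HG _ _ _ (lc r x y e Xx Xy)); [|exact: Lc| |exact: Lc'].
      by rewrite G1//; [exact: Lc|exact: Lc|exact: Lc'].
    by apply: L2D; [apply: L2Z|]; exact: Lc.
  by rewrite /component_form !K; ring.
have Xs : X (r%:C%C *: x + y) by exact: HX.2.
have K e : G (c z e) (c' (r%:C%C *: x + y) e) = r * G (c z e) (c' x e) + G (c z e) (c' y e).
  rewrite (L2form_aer HG _ _ _ (lc' r x y e Xx Xy)); [|exact: Lc|exact: Lc'|].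
    by rewrite G2//; [exact: Lc'|exact: Lc'|exact: Lc].
  by apply: L2D; [apply: L2Z|]; exact: Lc'.
by rewrite /component_form !K; ring.
Qed.

Lemma component_form_bounded G c c' : (forall x, X x -> 0 <= N x) -> L2form L G ->
  bounded_component c -> bounded_component c' -> bounded_form X N (component_form G c c').
Proof.
move=> N0 HG [Hc [C C0 HC]] [Hc' [C' C'0 HC']]; split; first exact: component_form_real.
have [_ _ [D D0 HD]] := HG; exists (2 * (D * C * C')); first by rewrite !mulr_ge0.
move=> x y Xx Xy; have [Lc _] := Hc; have [Lc' _] := Hc'.
have K e : `|G (c x e) (c' y e)| <= D * C * C' * N x * N y.
  apply: (le_trans (HD _ _ (Lc x e Xx) (Lc' y e Xy))).
  rewrite (_ : D * C * C' * N x * N y = D * ((C * N x) * (C' * N y))); last by ring.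
  rewrite -mulrA; apply: ler_wpM2l => //.
  by apply: ler_pM => //; rewrite ?nrm_ge0 ?HC ?HC'.
apply: (le_trans (ler_normD _ _)); have := K false; have := K true.
rewrite -!mulrA !mulrA; set t := D * C * C' * N x * N y.
have -> : 2 * D * C * C' * N x * N y = t + t by rewrite /t; ring.
by move=> h1 h2; apply: lerD.
Qed.

Lemma WF_sym m f g : WF 0 L m f g = WF 0 L m g f.
Proof. by apply: eq_II => x _; rewrite [f x * _]mulrC. Qed.

Lemma component_form_sym G c x y : (forall f g, G f g = G g f) ->
  component_form G c c x y = component_form G c c y x.
Proof. by move=> sG; congr (_ + _). Qed.

Lemma real_formD (F F' : E -> E -> R) : real_form X F -> real_form X F' ->
  real_form X (fun x y => F x y + F' x y).
Proof.
by move=> [f1 f2] [g1 g2]; split=> r x y z Xx Xy Xz; rewrite ?f1 ?g1 ?f2 ?g2//; ring.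
Qed.

End ComponentForms.

(** * The energy space and the operator *)

Section StateSpace.
Context {R : realType}.
Variables (l L c0 K : R) (p1 p2 d : R -> R).
Hypotheses (l_gt0 : 0 < l) (l_lt_L : l < L) (c0_gt0 : 0 < c0) (K_gt0 : 0 < K).
Notation p := (glue l p1 p2).
Hypotheses (p_meas : measurable_fun `]0, L[ p) (d_meas : measurable_fun `]0, L[ d).
Hypotheses (p_bnd : ae_on 0 L (fun x => c0 <= p x <= K)).
Hypotheses (d_bnd : ae_on 0 L (fun x => 0 <= d x <= K)).
Hypothesis d_out : forall x, l <= x -> d x = 0.

Notation X := (calH2 l L).
Notation N := (norm_calH2 l L p1 p2).
Notation dom := (domA2 l L p1 p2 d).
Notation A := (A2 l L p1 p2 d).
Implicit Types (U W Z : state R) (e : bool).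

Let L_gt0 : 0 < L. Proof. exact: lt_trans l_lt_L. Qed.
Let l_le_L : l <= L. Proof. exact: ltW. Qed.
Let l_ge0 : 0 <= l. Proof. exact: ltW. Qed.

Definition strain U e : R -> R := deriv_part l L U.1 e.
Definition velocity U e : R -> R := val_part l U.2 e.

(** The real part of the inner product of the state space, that is, the polarisation of its squared
    norm. *)
Definition energy_form : state R -> state R -> R := fun U W =>
  component_form (WF 0 L p) strain strain U W + component_form (WF 0 L (cst 1)) velocity velocity U W.

Lemma p_weight : weight 0 L p.
Proof.
split=> //; exists K; first exact: ltW.
apply: ae_on_imp p_bnd => x _ /andP[h1 h2]; rewrite ger0_norm//.
by apply: le_trans h1; exact: ltW.
Qed.

Lemma one_weight : weight 0 L (cst 1).
Proof. by split=> //; exists 1 => //; apply: ae_onW => x _; rewrite normr1. Qed.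

Lemma part_realE e (r : R) : part e r%:C%C = if e then 0 else r.
Proof. by case: e. Qed.

Lemma velocity_component : linear_component L X velocity.
Proof.
split=> [U e [_ /(spaceH_parts l_gt0 l_lt_L)]|r U W e XU XW]; first exact.
apply: ae_onW => x _; rewrite /velocity (val_part_lin l r%:C%C U.2 W.2) !part_realE.
by rewrite mulr0 mul0r addr0.
Qed.

Lemma strain_component : linear_component L X strain.
Proof.
split=> [U e [VU _]|r U W e [VU _] [VW _]].
  by case: (V2_prim l_gt0 l_lt_L VU e).
have [_ /(_ e)] := V2_lin l_gt0 l_lt_L r%:C%C VU VW.
apply: ae_on_imp => x _; rewrite /strain => ->; rewrite !part_realE.
by rewrite mulr0 mul0r addr0.
Qed.

Lemma calH2_subspace : subspace X.
Proof.
split=> [|c U W [VU HU] [VW HW]].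
  split; first exact: V2_0.
  apply/(spaceH_parts l_gt0 l_lt_L) => e; rewrite (_ : val_part _ _ _ = cst 0); first exact: L2_cst.
  by apply/funext => x; rewrite /val_part /glue; case: ifP => _; exact: part0.
split; first by case: (V2_lin l_gt0 l_lt_L c VU VW).
apply/(spaceH_parts l_gt0 l_lt_L) => e; rewrite (_ : val_part _ _ _ = fun x =>
  part false c * val_part l U.2 e x + (-1) ^+ (~~ e) * part true c * val_part l U.2 (~~ e) x +
  val_part l W.2 e x).
  move/(spaceH_parts l_gt0 l_lt_L) : HU => HU; move/(spaceH_parts l_gt0 l_lt_L) : HW => HW.
  by apply: L2D => //; apply: L2D; exact: L2Z.
by apply/funext => x; exact: (val_part_lin l c U.2 W.2).
Qed.

Lemma sqnormL2_parts (m1 m2 : R -> R) (f g : cfun R) : weight 0 L (glue l m1 m2) ->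
  (forall e, L2 0 L (fun x => part e (glue l f g x))) ->
  sqnormL2 0 l m1 f + sqnormL2 l L m2 g =
  WF 0 L (glue l m1 m2) (fun x => part false (glue l f g x)) (fun x => part false (glue l f g x)) +
  WF 0 L (glue l m1 m2) (fun x => part true (glue l f g x)) (fun x => part true (glue l f g x)).
Proof.
move=> wm H; set h := fun e x => part e (glue l f g x).
have I e : intg 0 L (fun x => glue l m1 m2 x * (h e x * h e x)).
  exact: WF_intg (lexx 0) (lexx L) wm (H e) (H e).
rewrite /WF -(IID (I false) (I true)).
have I2 := intgD (I false) (I true).
rewrite (II_split l_ge0 l_le_L I2); congr (_ + _); apply: eq_II => x /andP[h1 h2];
  rewrite /= sqmod_parts /h.
  by rewrite !glue_l// -!expr2 mulrDr.
by rewrite !glue_r ?ltW// -!expr2 mulrDr.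
Qed.

Lemma norm_energy U : X U -> N U = Num.sqrt (energy_form U U).
Proof.
move=> XU; rewrite /norm_calH2; congr Num.sqrt; congr (_ + _).
  apply: sqnormL2_parts; first exact: p_weight.
  by move=> e; exact: (strain_component.1 U e XU).
rewrite /sqnormH (_ : cst 1 = glue l (fun=> 1) (fun=> 1)); last first.
  by apply/funext => x; rewrite /glue; case: ifP.
apply: sqnormL2_parts; last by move=> e; exact: (velocity_component.1 U e XU).
rewrite (_ : glue _ _ _ = cst 1); first exact: one_weight.
by apply/funext => x; rewrite /glue; case: ifP.
Qed.

Lemma p_form : L2form L (WF 0 L p).
Proof. by apply: WF_form => //; [exact: ltW|exact: p_weight]. Qed.

Lemma one_form : L2form L (WF 0 L (cst 1)).
Proof. by apply: WF_form => //; [exact: ltW|exact: one_weight]. Qed.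

Lemma energy_form_real : real_form X energy_form.
Proof.
exact: real_formD
  (component_form_real L_gt0 calH2_subspace p_form strain_component strain_component)
  (component_form_real L_gt0 calH2_subspace one_form velocity_component velocity_component).
Qed.

Lemma p_form_ge f : L2 0 L f -> c0 * sqn L f <= WF 0 L p f f.
Proof.
move=> Lf; rewrite -IIZ; last exact: Lf.2.
apply: le_II; [exact: intgZ Lf.2|exact: (WF_intg (lexx 0) (lexx L) p_weight)|].
by apply: ae_on_imp p_bnd => x _ /andP[h _]; rewrite -expr2 ler_wpM2r// sqr_ge0.
Qed.

Lemma one_formE f : WF 0 L (cst 1) f f = sqn L f.
Proof. by apply: eq_II => x _; rewrite mul1r expr2. Qed.

Lemma energy_bounds U : X U ->
  [/\ 0 <= energy_form U U, forall e, c0 * sqn L (strain U e) <= energy_form U U &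
      forall e, sqn L (velocity U e) <= energy_form U U].
Proof.
move=> XU; rewrite /energy_form /component_form !one_formE.
have P e := p_form_ge (strain_component.1 U e XU).
have S e : 0 <= c0 * sqn L (strain U e) by apply: mulr_ge0; [exact: ltW|exact: sqn_ge0].
have V e : 0 <= sqn L (velocity U e) by exact: sqn_ge0.
move: (P false) (P true) (S false) (S true) (V false) (V true).
move: (WF _ _ _ _ _) (WF _ _ _ _ _) => x2 x1.
have key (s t : bool -> R) (e : bool) : c0 * s false <= x1 -> c0 * s true <= x2 ->
    0 <= c0 * s false -> 0 <= c0 * s true -> 0 <= t false -> 0 <= t true ->
    [/\ 0 <= x1 + x2 + (t false + t true), c0 * s e <= x1 + x2 + (t false + t true) &
        t e <= x1 + x2 + (t false + t true)].
  by case: e => *; split; lra.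
move=> h1 h2 h3 h4 h5 h6.
have H e := key (fun e => sqn L (strain U e)) (fun e => sqn L (velocity U e)) e h1 h2 h3 h4 h5 h6.
by split=> [|e|e]; [case: (H true)|case: (H e)|case: (H e)].
Qed.

Lemma energy_form_norm : form_norm X N energy_form.
Proof.
split; [exact: energy_form_real| |by move=> U /energy_bounds[]|exact: norm_energy].
move=> U W _ _; rewrite /energy_form.
by rewrite (component_form_sym strain U W (@WF_sym _ L p)) (component_form_sym velocity U W (@WF_sym _ L (cst 1))).
Qed.

Lemma norm_calH2_ge0 U : X U -> 0 <= N U.
Proof. by move=> XU; rewrite norm_energy// sqrtr_ge0. Qed.

Lemma strain_bounded : bounded_component L X N strain.
Proof.
split; first exact: strain_component.
exists (Num.sqrt c0^-1); first exact: sqrtr_ge0.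
move=> U e XU; have [_ /(_ e) h _] := energy_bounds XU.
rewrite norm_energy// -sqrtrM ?invr_ge0 ?(ltW c0_gt0)// ler_sqrt; last first.
  by rewrite mulr_ge0 ?invr_ge0 ?(ltW c0_gt0)//; case: (energy_bounds XU).
by rewrite ler_pdivlMl.
Qed.

Lemma velocity_bounded : bounded_component L X N velocity.
Proof.
split; first exact: velocity_component.
exists 1 => // U e XU; have [? _ /(_ e) h] := energy_bounds XU.
by rewrite mul1r norm_energy// ler_sqrt.
Qed.

Lemma norm_eq0_parts U : X U ->
  (forall e, ae_on 0 L (fun x => strain U e x = 0) /\ ae_on 0 L (fun x => velocity U e x = 0)) ->
  N U = 0.
Proof.
move=> XU H; rewrite norm_energy// (_ : energy_form U U = 0) ?sqrtr0//.
have z G f : L2form L G -> L2 0 L f -> ae_on 0 L (fun x => f x = 0) -> G f f = 0.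
  move=> HG Lf f0; rewrite (@L2form_ael _ _ L_gt0 _ _ (cst 0) _ HG Lf (L2_cst _ _ _) Lf f0).
  have [G1 _ _] := HG; have := G1 1 _ _ _ (L2_cst 0 L 0) (L2_cst 0 L 0) Lf.
  rewrite (_ : (fun x => _) = cst 0); last by apply/funext => x; rewrite mulr0 addr0.
  by rewrite mul1r -[LHS]add0r => /addIr.
have Ls e := strain_component.1 U e XU; have Lv e := velocity_component.1 U e XU.
rewrite /energy_form /component_form.
rewrite (z _ _ p_form (Ls false) (H false).1) (z _ _ p_form (Ls true) (H true).1).
by rewrite (z _ _ one_form (Lv false) (H false).2) (z _ _ one_form (Lv true) (H true).2) !addr0.
Qed.

Definition flux U : pair_space R := (flux1 l p1 d U, flux2 l L p2 U).

Lemma flux_val U e x : val_part l (flux U) e x = p x * strain U e x + d x * deriv_part l L U.2 e x.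
Proof.
rewrite /val_part /strain /deriv_part /glue /=; case: ltP => xl.
  by rewrite /flux1 partD !part_real_l.
by rewrite /flux2 part_real_l d_out// mul0r addr0.
Qed.

(** Translation of the domain to the glued interval: these are the ingredients of [flow], apart from
    the derivative [rho] of w, which requires [A U] to be in the domain too. The strain has zero
    integral because the displacement vanishes at both ends. *)
Lemma dom_data U : dom U -> forall e,
  [/\ [/\ L2 0 L (strain U e), L2 0 L (strain (A U) e), L2 0 L (velocity U e) & L2 0 L (velocity (A U) e)],
    [/\ prim 0 L (strain (A U) e) (trace_part l L U.2 e), trace_part l L U.2 e 0 = 0,
        trace_part l L U.2 e L = 0 & ae_on 0 L (fun x => velocity U e x = trace_part l L U.2 e x)],
    prim 0 L (velocity (A U) e) (trace_part l L (flux U) e),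
    ae_on 0 L (fun x => trace_part l L (flux U) e x = p x * strain U e x + d x * strain (A U) e x) &
    II 0 L (strain U e) = 0].
Proof.
move=> [XU [VU2 S1 S2 tr]] e.
have HF : H1pair l L (flux U) by split.
have [LF PF AF] := H1pair_prim l_gt0 l_lt_L HF e.
have [LV PV AV V0 VL] := V2_prim l_gt0 l_lt_L VU2 e.
have [Lq Pq _ q0 qL] := V2_prim l_gt0 l_lt_L XU.1 e.
split; last first.
- by have := prim_sub Pq (lexx 0) (ltW L_gt0) (lexx L); rewrite q0 qL subrr.
- by apply: ae_on_imp AF => x _ <-; exact: flux_val.
- exact: PF.
- by split; [exact: PV|exact: V0|exact: VL|exact: AV].
by split; [exact: Lq|exact: LV|exact: (velocity_component.1 U e XU)|exact: LF].
Qed.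

Lemma dom_calH2 : dom `<=` X. Proof. by move=> U []. Qed.

Lemma A2_calH2 U : dom U -> X (A U).
Proof.
move=> dU; have D := dom_data dU; have [_ [VU2 _ _ _]] := dU; split=> //.
by apply/(spaceH_parts l_gt0 l_lt_L) => e; case: (D e) => -[].
Qed.

Lemma d_weight : weight 0 L d.
Proof.
split=> //; exists K; first exact: ltW.
by apply: ae_on_imp d_bnd => x _ /andP[h1 h2]; rewrite ger0_norm.
Qed.

(** Integrate the derivative of V S over the whole interval: [V] vanishes at both ends, and r S
    splits into p q r and d r^2. *)
Lemma power_balance (q r w v V S : R -> R) : L2 0 L q -> L2 0 L r -> L2 0 L v -> prim 0 L r V ->
  V 0 = 0 -> V L = 0 -> ae_on 0 L (fun x => v x = V x) -> prim 0 L w S -> L2 0 L w ->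
  ae_on 0 L (fun x => S x = p x * q x + d x * r x) ->
  WF 0 L p r q + WF 0 L (cst 1) w v = - damped L d r.
Proof.
move=> Lq Lr Lv PV V0 VL vV PS Lw HS.
have := prim_sub (prim_mul PV PS) (lexx 0) (ltW L_gt0) (lexx L).
have LV := prim_L2 PV; have LS := prim_L2 PS.
have I1 := L2_mul Lr LS; have I2 := L2_mul LV Lw.
rewrite VL V0 !mul0r subrr IID// => E.
have Ip : intg 0 L (fun x => p x * (r x * q x)) by exact: (WF_intg (lexx 0) (lexx L) p_weight).
have Id : intg 0 L (fun x => d x * (r x * r x)) by exact: (WF_intg (lexx 0) (lexx L) d_weight).
have E1 : II 0 L (fun x => r x * S x) = WF 0 L p r q + damped L d r.
  rewrite /damped (@eq_II _ 0 L (fun x => d x * r x ^+ 2) (fun x => d x * (r x * r x))); last first.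
    by move=> x _; rewrite expr2.
  rewrite -IID//; apply: II_ae; [exact: intg_meas I1|exact: intg_meas (intgD Ip Id)|].
  by apply: ae_on_imp HS => x _ /= ->; ring.
have E2 : II 0 L (fun x => V x * w x) = WF 0 L (cst 1) w v.
  apply: II_ae; first exact: intg_meas I2.
    apply: intg_meas (_ : intg 0 L _); exact: (WF_intg (lexx 0) (lexx L) one_weight Lw Lv).
  by apply: ae_on_imp vV => x _ /= ->; rewrite mul1r mulrC.
move: E; rewrite E1 E2 => E; lra.
Qed.

Lemma dissipation U : dom U -> energy_form (A U) U =
  - (damped L d (strain (A U) false) + damped L d (strain (A U) true)).
Proof.
move=> dU; have D := dom_data dU.
have P e : WF 0 L p (strain (A U) e) (strain U e) + WF 0 L (cst 1) (velocity (A U) e) (velocity U e) =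
    - damped L d (strain (A U) e).
  have [[? ? ? ?] [? ? ? ?] ? ? ?] := D e.
  exact: (@power_balance _ _ _ _ (trace_part l L U.2 e) (trace_part l L (flux U) e)).
have aux (x1 x2 y1 y2 D1 D2 : R) : x1 + y1 = - D1 -> x2 + y2 = - D2 ->
  x1 + x2 + (y1 + y2) = - (D1 + D2) by move=> h1 h2; rewrite addrACA h1 h2 opprD.
exact: aux (P false) (P true).
Qed.

Lemma damped_ge0 f : L2 0 L f -> 0 <= damped L d f.
Proof.
move=> Lf; apply: II_ae_ge0.
  apply: eq_intg (WF_intg (lexx 0) (lexx L) d_weight Lf Lf) => x _; by rewrite expr2.
by apply: ae_on_imp d_bnd => x _ /andP[h _]; rewrite mulr_ge0// sqr_ge0.
Qed.

Lemma dissipative U : dom U -> energy_form (A U) U <= 0.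
Proof.
move=> dU; rewrite dissipation// oppr_le0 addr_ge0// damped_ge0//.
  by case: (dom_data dU false) => -[].
by case: (dom_data dU true) => -[].
Qed.

(* For a given U = ((u_1, u_2), v) the preimage is (z, u), where z' = q is
   determined by the requirement that the flux p q + d u' be a primitive J v + c of v;
   the constant c is adjusted so that z vanishes at L. *)
Lemma A2_onto U : X U -> exists2 Z, dom Z & N (A Z - U) = 0.
Proof.
move=> XU; have Lv e := velocity_component.1 U e XU; have Lr e := strain_component.1 U e XU.
set v := velocity U in Lv; set r := strain U in Lr.
pose q0 e x := pinv c0 p x * (J (v e) x - d x * r e x).
have mpi := pinv_meas c0_gt0 p_meas; have bpi := @pinv_bnd _ L c0 p c0_gt0.
have PJ e := prim_II (L2_intg (Lv e)).
have [_ [Kd Kd0 bd]] := d_weight.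
have Lq0 e : L2 0 L (q0 e).
  apply: (L2_mul_bnd mpi bpi); apply: L2B; first exact: prim_L2 (PJ e).
  exact: L2_mul_bnd d_meas bd (Lr e).
have Lpi : L2 0 L (pinv c0 p) := L2_bnd mpi bpi.
have ipi : 0 < II 0 L (pinv c0 p).
  apply: (@lt_le_trans _ _ (II 0 L (cst K^-1))).
    by rewrite II_cst ?(ltW L_gt0)// subr0 mulr_gt0// invr_gt0.
  apply: le_II; [exact: intg_cst|exact: L2_intg|].
  apply: ae_on_imp p_bnd => x _ /andP[h1 h2].
  by rewrite /pinv (max_idPl h1) lef_pV2 ?posrE//; exact: lt_le_trans h1.
pose c e := - (II 0 L (pinv c0 p))^-1 * II 0 L (q0 e).
pose q e x := c e * pinv c0 p x + q0 e x.
have Lq e : L2 0 L (q e) by apply: L2D => //; exact: L2Z.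
have IIq e : II 0 L (q e) = 0.
  rewrite IID ?IIZ; [|exact: L2_intg|apply: intgZ; exact: L2_intg|exact: L2_intg].
  by rewrite /c; field; exact: lt0r_neq0.
pose z e x := II 0 x (q e).
have Pz e := prim_II (L2_intg (Lq e)).
(* One function serves for both components of the pair; their gluing is then [z] itself, and the
   condition at l holds by continuity. *)
pose zc : cfun R := glue_parts z.
pose Z : state R := ((zc, zc), U.1).
have zE e : val_part l Z.1 e = z e.
  by apply/funext => x; rewrite /val_part /glue if_same part_glue.
have [VZ dZ] : V2 l L Z.1 /\ forall e, ae_on 0 L (fun x => deriv_part l L Z.1 e x = q e x).
  apply: (@prim_V2 _ _ _ l_gt0 l_lt_L _ z) => e.
  - by rewrite zE; exact: prim_meas (Pz e).
  - exact: Lq.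
  - exact: Pz.
  - by rewrite zE; apply: ae_onW.
  - by rewrite /z II_empty.
have sZ : spaceH l L U.1.
  apply/(spaceH_parts l_gt0 l_lt_L) => e.
  have [Lr' Pr Ar _ _] := V2_prim l_gt0 l_lt_L XU.1 e.
  apply: L2_ae (V2_meas XU.1 e) _ (prim_L2 Pr).
  by apply: ae_on_imp Ar => x _ ->.
have XZ : X Z by split.
have fluxE e : ae_on 0 L (fun x => val_part l (flux Z) e x = c e + J (v e) x).
  apply: ae_on_imp2 (dZ e) (@p_pinv _ _ _ _ _ c0_gt0 p_bnd) => x _ dq pp.
  rewrite flux_val /strain dq /q /q0.
  have -> : p x * (c e * pinv c0 p x + pinv c0 p x * (J (v e) x - d x * r e x)) =
    (pinv c0 p x * p x) * (c e + J (v e) x - d x * r e x) by ring.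
  by rewrite pp mul1r /r /strain /=; ring.
have mflux e : measurable_fun `]0, L[ (val_part l (flux Z) e).
  rewrite (_ : val_part _ _ _ = fun x => p x * strain Z e x + d x * deriv_part l L Z.2 e x); last first.
    by apply/funext => x; rewrite flux_val.
  apply: measurable_funD; apply: measurable_funM => //.
    exact: (strain_component.1 Z e XZ).1.
  exact: (Lr e).1.
have Pflux e : prim 0 L (v e) (fun x => c e + J (v e) x).
  by apply: (eq_prim (primD (prim_cst 0 L (c e)) (PJ e))) => x _ //=; rewrite add0r.
have [[S1 S2 tr] dflux] := prim_H1pair l_gt0 l_lt_L mflux Lv Pflux fluxE.
have domZ : dom Z by split=> //; split=> //; case: XU.
exists Z => //.
have XAZ := A2_calH2 domZ.
have XD : X (A Z - U) := subspaceB calH2_subspace XAZ XU.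
have EqD : A Z - U = (-1)%:C%C *: U + A Z by exact: subE_real.
apply: norm_eq0_parts => // e; rewrite EqD; split.
  apply: ae_on_imp (strain_component.2 (-1) U (A Z) e XU XAZ) => x _ ->.
  by rewrite mulN1r /strain/= addNr.
have [dv _ _] := dflux e.
apply: ae_on_imp2 dv (velocity_component.2 (-1) U (A Z) e XU XAZ) => x _ h ->.
by rewrite mulN1r [velocity (A Z) e x]h addNr.
Qed.

Lemma energy_parts (q v V : R -> R) : L2 0 L q -> L2 0 L v -> L2 0 L V ->
  ae_on 0 L (fun x => v x = V x) ->
  energy L p q V = WF 0 L p q q + WF 0 L (cst 1) v v.
Proof.
move=> Lq Lv LV vV; congr (_ + _).
rewrite one_formE /sqn; apply: II_ae; [exact: intg_meas LV.2|exact: intg_meas Lv.2|].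
by apply: ae_on_imp vV => x _ ->.
Qed.

Lemma state_static (G1 G2 : (R -> R) -> (R -> R) -> R) (C kap0 : R) :
  L2form L G1 -> L2form L G2 ->
  (forall kap q r w rho v S, kap0 <= kap -> flow L p d q r w rho v S ->
    energy L p q v + (G1 r v + G1 q w) + kap^-1 * (G2 r r + G2 q rho) <=
      C * (kap * damped L d r + kap^-3 * damped L d rho)) ->
  forall U kap, dom U -> dom (A U) -> kap0 <= kap ->
  energy_form U U + (component_form G1 strain velocity (A U) U +
      component_form G1 strain velocity U (A U)) +
    kap^-1 * (component_form G2 strain strain (A U) (A U) +
      component_form G2 strain strain U (A (A U))) <=
  C * (kap * - energy_form (A U) U + kap^-3 * - energy_form (A (A U)) (A U)).
Proof.
move=> HG1 HG2 H U kap dU dAU kk.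
have D := dom_data dU; have D' := dom_data dAU.
have P e : (WF 0 L p (strain U e) (strain U e) +
      WF 0 L (cst 1) (velocity U e) (velocity U e)) +
    (G1 (strain (A U) e) (velocity U e) + G1 (strain U e) (velocity (A U) e)) +
    kap^-1 * (G2 (strain (A U) e) (strain (A U) e) + G2 (strain U e) (strain (A (A U)) e)) <=
    C * (kap * damped L d (strain (A U) e) + kap^-3 * damped L d (strain (A (A U)) e)).
  have [[Lq Lr Lv Lw] [PV V0 VL vV] PS HS Iq] := D e.
  have [[_ Lrho _ _] [PW _ _ wW] _ _ _] := D' e.
  have LV := prim_L2 PV; have LW := prim_L2 PW.
  (* [flow] asks for absolutely continuous v and w, so traces take the place of the velocities;
     [prim_ae] and invariance of the forms justify the exchange. *)
  have F : flow L p d (strain U e) (strain (A U) e) (trace_part l L (A U).2 e)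
      (strain (A (A U)) e) (trace_part l L U.2 e) (trace_part l L (flux U) e).
    split; [split; [exact: Lq|exact: Lr|exact: Lrho]|split; [exact: PV|exact: V0|exact: VL]| |
      exact: PW|exact: Iq].
    split; last exact: HS.
    exact: prim_ae PS (prim_meas PW) wW.
  have := H kap _ _ _ _ _ _ kk F; rewrite (energy_parts Lq Lv LV vV).
  rewrite (L2form_aer L_gt0 HG1 Lr Lv LV vV).
  by rewrite (L2form_aer L_gt0 HG1 Lq Lw LW wW).
have aux (a1 a2 b1 b2 x1 x2 y1 y2 s1 s2 t1 t2 D1 D2 E1 E2 k1 k3 EA EAA : R) :
  EA = - (D1 + D2) -> EAA = - (E1 + E2) ->
  a1 + b1 + (x1 + y1) + k1 * (s1 + t1) <= C * (kap * D1 + k3 * E1) ->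
  a2 + b2 + (x2 + y2) + k1 * (s2 + t2) <= C * (kap * D2 + k3 * E2) ->
  a1 + a2 + (b1 + b2) + (x1 + x2 + (y1 + y2)) + k1 * (s1 + s2 + (t1 + t2)) <=
  C * (kap * - EA + k3 * - EAA).
  move=> -> -> h1 h2; apply: le_trans (le_trans (lerD h1 h2) _); last by rewrite le_eqVlt; apply/orP; left; apply/eqP; ring.
  by rewrite le_eqVlt; apply/orP; left; apply/eqP; ring.
exact: aux (dissipation dU) (dissipation dAU) (P false) (P true).
Qed.

End StateSpace.

(** On an empty interval the given constant is arbitrary and may lie below [c0]; the maximum is a
    valid constant in every case and satisfies the lower bound. *)
Lemma max_cst_ge {R : realType} (a b c0 k : R) (f : R -> R) :
  ae_on a b (fun x => c0 <= f x) -> ae_on a b (fun x => f x = k) ->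
  ae_on a b (fun x => f x = Num.max k c0).
Proof.
by apply: ae_on_imp2 => x _ fx fk; rewrite -fk (max_idPl fx).
Qed.

(** * Application to the transmission problem *)

Section Decay.
Context {R : realType}.
Variables (alpha beta l L c0 : R) (p1 p2 a : R -> R) (T : R -> state R -> state R).
Hypotheses (alpha_ge0 : 0 <= alpha) (alpha_lt_beta : alpha < beta)
  (beta_le_l : beta <= l) (l_lt_L : l < L) (c0_gt0 : 0 < c0)
  (p1_Linfty : Linfty 0 l p1) (p2_Linfty : Linfty l L p2)
  (p1_ge : ae_on 0 l (fun x => c0 <= p1 x))
  (p2_ge : ae_on l L (fun x => c0 <= p2 x))
  (Da_Linfty : Linfty 0 l (damping alpha beta a))
  (a_ge : forall x, alpha < x < beta -> c0 <= a x)
  (p1_cst_left : exists k, ae_on 0 alpha (fun x => p1 x = k))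
  (p1_cst_right : exists k, ae_on beta l (fun x => p1 x = k))
  (p2_cst : exists k, ae_on l L (fun x => p2 x = k)).
Notation d := (damping alpha beta a).
Notation N := (norm_calH2 l L p1 p2).
Notation dom := (domA2 l L p1 p2 d).
Notation A := (A2 l L p1 p2 d).
Hypotheses (T_semigroup : C0_semigroup (calH2 l L) N T)
  (T_generator : generated_by (calH2 l L) N T dom A).

Lemma damping_in x : alpha < x < beta -> d x = a x.
Proof.
by move=> xab; rewrite /damping indicE mem_set ?mulr1//= in_itv.
Qed.

Lemma damping_out x : ~~ (alpha < x < beta) -> d x = 0.
Proof.
by move=> xab; rewrite /damping indicE memNset ?mulr0//= in_itv/=; exact/negP.
Qed.

Lemma damping_ge0 x : 0 <= d x.
Proof.
case: (boolP (alpha < x < beta)) => xab; last by rewrite damping_out.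
by rewrite damping_in//; apply: le_trans (a_ge xab); exact: ltW.
Qed.

Lemma transmission_decay : exists2 M : R, 0 < M & forall U t, dom U -> 0 <= t ->
  N (T t U) <= M / (1 + t) ^+ 2 * graph_norm N A U.
Proof.
have := l_lt_L; have := beta_le_l; have := alpha_lt_beta; have := alpha_ge0; have := c0_gt0.
move=> ineq1 ineq2 ineq3 ineq4 ineq5.
have l_gt0 : 0 < l by lra.
have l_ge0 := ltW l_gt0; have l_le_L := ltW l_lt_L.
have beta_ge0 : 0 <= beta by lra.
have [mp1 [M1 HM1]] := p1_Linfty; have [mp2 [M2 HM2]] := p2_Linfty.
have [md [Md HMd]] := Da_Linfty.
have [k1 Hk1] := p1_cst_left; have [k2 Hk2] := p1_cst_right; have [k3 Hk3] := p2_cst.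
(* A single upper bound for p, for the damping and for the three constant values of p. *)
pose K := `|M1| + `|M2| + `|Md| + Num.max k1 c0 + Num.max k2 c0 + Num.max k3 c0.
have n1 := normr_ge0 M1; have n2 := normr_ge0 M2; have nd := normr_ge0 Md.
have i1 := ler_norm M1; have i2 := ler_norm M2; have id_ := ler_norm Md.
have kc k : c0 <= Num.max k c0 by rewrite le_max lexx orbT.
have c1 := kc k1; have c2 := kc k2; have c3 := kc k3.
have K_gt0 : 0 < K by rewrite /K; lra.
have b1 : c0 <= Num.max k1 c0 <= K by rewrite /K; lra.
have b2 : c0 <= Num.max k2 c0 <= K by rewrite /K; lra.
have b3 : c0 <= Num.max k3 c0 <= K by rewrite /K; lra.
have d_out x : l <= x -> d x = 0.
  by move=> lx; apply: damping_out; rewrite negb_and -!leNgt (le_trans beta_le_l lx) orbT.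
have p_meas : measurable_fun `]0, L[ (glue l p1 p2) by exact: meas_glue.
have d_meas : measurable_fun `]0, L[ d.
  apply: (@eq_measurable_oo _ 0 L (glue l d (cst 0))); last exact: meas_glue.
  by move=> x _; rewrite /glue; case: ltP => // /d_out.
have p_bnd : ae_on 0 L (fun x => c0 <= glue l p1 p2 x <= K).
  apply: (ae_on_glue (ae_on_and p1_ge HM1) (ae_on_and p2_ge HM2)) => x xl [g1 g2].
    rewrite glue_l// g1; apply: (le_trans (ler_norm _)); rewrite /K; lra.
  rewrite glue_r// g1; apply: (le_trans (ler_norm _)); rewrite /K; lra.
have d_bnd : ae_on 0 L (fun x => 0 <= d x <= K).
  apply: (ae_on_glue HMd (ae_onW (fun x (_ : l < x < L) => I))) => x xl.
    move=> g; rewrite damping_ge0; apply: (le_trans (ler_norm _)); rewrite /K; lra.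
  by move=> _; rewrite d_out// lexx ltW.
have d_ge : ae_on alpha beta (fun x => c0 <= d x).
  by apply: ae_onW => x xab; rewrite damping_in// a_ge.
have d_left : ae_on 0 alpha (fun x => d x = 0).
  by apply: ae_onW => x /andP[_ xa]; apply: damping_out; rewrite (ltNge alpha) (ltW xa).
have d_right : ae_on beta L (fun x => d x = 0).
  by apply: ae_onW => x /andP[bx _]; apply: damping_out; rewrite (ltNge x) (ltW bx) andbF.
have p_left : ae_on 0 alpha (fun x => glue l p1 p2 x = Num.max k1 c0).
  apply: ae_on_imp (max_cst_ge (ae_onS (lexx 0) _ p1_ge) Hk1); last lra.
  by move=> x /andP[_ xa] <-; rewrite glue_l//; lra.
have p_mid : ae_on beta l (fun x => glue l p1 p2 x = Num.max k2 c0).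
  apply: ae_on_imp (max_cst_ge (ae_onS beta_ge0 (lexx l) p1_ge) Hk2).
  by move=> x /andP[_ xl] <-; rewrite glue_l.
have p_right : ae_on l L (fun x => glue l p1 p2 x = Num.max k3 c0).
  apply: ae_on_imp (max_cst_ge p2_ge Hk3).
  by move=> x /andP[lx _] <-; rewrite glue_r// ltW.
have [G1 [G2 [HG1 HG2 [C C_gt0 [kap0 kap0_gt0 HS]]]]] :=
  static_estimate alpha_ge0 alpha_lt_beta beta_le_l l_lt_L c0_gt0 p_meas d_meas p_bnd d_bnd
    d_ge d_left d_right p_left p_mid p_right b1 b2 b3.
have L_gt0 : 0 < L by lra.
have SB := strain_bounded l_gt0 l_lt_L c0_gt0 K_gt0 p_meas p_bnd.
have VB := velocity_bounded l_gt0 l_lt_L c0_gt0 K_gt0 p_meas p_bnd.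
have N0 := norm_calH2_ge0 l_gt0 l_lt_L c0_gt0 K_gt0 p_meas p_bnd.
have HX := calH2_subspace l_gt0 l_lt_L.
have HB := energy_form_norm l_gt0 l_lt_L c0_gt0 K_gt0 p_meas p_bnd.
have F1 := component_form_bounded L_gt0 HX N0 HG1 SB VB.
have F2 := component_form_bounded L_gt0 HX N0 HG2 SB SB.
exact: (semigroup_decay HX HB (@dom_calH2 _ _ _ _ _ _) (A2_calH2 l_gt0 l_lt_L d_out)
  T_semigroup T_generator (dissipative l_gt0 l_lt_L c0_gt0 K_gt0 p_meas d_meas p_bnd d_bnd d_out)
  (A2_onto l_gt0 l_lt_L c0_gt0 K_gt0 p_meas d_meas p_bnd d_bnd d_out) F1 F2 C_gt0 kap0_gt0
  (state_static l_gt0 l_lt_L c0_gt0 K_gt0 p_meas d_meas p_bnd d_bnd d_out HG1 HG2 HS)).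
Qed.

End Decay.

Theorem theorem3p1 (R : realType) (alpha beta l L c0 : R)
  (p1 p2 a : R -> R) (T : R -> state R -> state R)
  (alpha_ge0 : 0 <= alpha) (alpha_lt_beta : alpha < beta)
  (beta_le_l : beta <= l) (l_lt_L : l < L) (c0_gt0 : 0 < c0)
  (p1_Linfty : Linfty 0 l p1) (p2_Linfty : Linfty l L p2)
  (p1_ge : ae_on 0 l (fun x => c0 <= p1 x))
  (p2_ge : ae_on l L (fun x => c0 <= p2 x))
  (Da_Linfty : Linfty 0 l (damping alpha beta a))
  (a_ge : forall x, alpha < x < beta -> c0 <= a x)
  (p1_cst_left : exists k, ae_on 0 alpha (fun x => p1 x = k))
  (p1_cst_right : exists k, ae_on beta l (fun x => p1 x = k))
  (p2_cst : exists k, ae_on l L (fun x => p2 x = k))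
  (a_cont : {within `]alpha, beta[, continuous a})
  (T_semigroup : C0_semigroup (calH2 l L) (norm_calH2 l L p1 p2) T)
  (T_generator : generated_by (calH2 l L) (norm_calH2 l L p1 p2) T
     (domA2 l L p1 p2 (damping alpha beta a))
     (A2 l L p1 p2 (damping alpha beta a))) :
  polynomially_stable (norm_calH2 l L p1 p2) T
    (domA2 l L p1 p2 (damping alpha beta a))
    (A2 l L p1 p2 (damping alpha beta a)) /\
  exists2 M : R, 0 < M &
    forall (U : state R) (t : R),
      domA2 l L p1 p2 (damping alpha beta a) U -> 0 <= t ->
      norm_calH2 l L p1 p2 (T t U) <=
        M / (1 + t) ^+ 2 *
        graph_norm (norm_calH2 l L p1 p2)
          (A2 l L p1 p2 (damping alpha beta a)) U.
Proof.
have [M M_gt0 decay] := transmission_decay alpha_ge0 alpha_lt_beta beta_le_l l_lt_L c0_gt0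
  p1_Linfty p2_Linfty p1_ge p2_ge Da_Linfty a_ge p1_cst_left p1_cst_right p2_cst
  T_semigroup T_generator.
split; last by exists M.
exists 2 => //; exists M => // t U t_ge0 dU.
rewrite (_ : (1 + t) `^ 2 = (1 + t) ^+ 2); first exact: decay.
by rewrite powR_mulrn// addr_ge0.
Qed.
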